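(* Let $(C_0,D_0)$ and $(C_1,D_1)$ be two couples of distinct proper non-empty real projective conics. If they are rigidly isotopic, then they can also be connected by a rigid isotopy of the form $t\mapsto\alpha_t(s_t)$, $t\in[0,1]$, where $s_t$ is a (finite) sequence of slidings along one given pencil of conics, and $t\mapsto\alpha_t$ is a path in $PGL(3,\mathbb{R})$ with $\alpha_0=\mathrm{id}$.
   Context: For a non-zero real ternary quadratic form $f$, $[f]\in\mathbb{P}(S^2{\mathbb{R}^3}^* )$ is the associated algebraic conic; it is proper if $f$ is non-degenerate, and non-empty if its zero locus in $\mathbb{RP}^2$ is non-empty. A couple is an ordered pair. A pencil of conics is a projective line in $\mathbb{P}(S^2{\mathbb{R}^3}^* )$. $PGL(3,\mathbb{R})$ acts on conics and couples of conics in the natural way. Two couples of distinct proper conics are rigidly isotopic if they are connected by a (continuous) path in the space of couples of distinct proper conics along which the numbers of real and of imaginary (non-real complex) intersection points of each multiplicity of the two conics do not change; such a path is a rigid isotopy. A sliding for $[f]$ and $[g]$ ($f,g$ non-degenerate, non-proportional) is a path of the form $t\mapsto([f+tkg],[g])$ or $t\mapsto([f],[g+tkf])$, for $t$ in a closed interval containing $0$ and $k$ a real number, such that no $f+tkg$ (resp. $g+tkf$) is degenerate. A sequence of slidings along one pencil is a finite concatenation of (reparametrized) slidings of couples of conics all belonging to that pencil. *)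

(* Defs.v *)
From HB Require Import structures.
From mathcomp Require Import all_boot all_order all_algebra.
From mathcomp Require Import fraction complex.
From mathcomp Require Import all_classical all_reals all_analysis.

Set Implicit Arguments.
Unset Strict Implicit.
Unset Printing Implicit Defensive.

Import Order.TTheory GRing.Theory Num.Theory.
Import numFieldNormedType.Exports.

Local Open Scope classical_set_scope.
Local Open Scope ring_scope.
Local Open Scope quotient_scope.

Section Projectivization.
Context {K : fieldType} {V : lmodType K} (D : set V).

Definition proportional (u v : D) : bool :=
  `[< exists2 c : K, c != 0 & set_val u = c *: set_val v >].

Lemma proportional_equiv : equiv_class_of proportional.
Proof.
split=> [u|u v|v u w].
- by apply/asboolP; exists 1; rewrite ?oner_neq0 ?scale1r.
- apply/asboolP/asboolP => -[c c0 ->]; exists c^-1; rewrite ?invr_eq0//;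
  by rewrite scalerA mulVf ?scale1r.
- move=> /asboolP[c c0 uv] /asboolP[d d0 vw]; apply/asboolP.
  by exists (c * d); rewrite ?mulf_neq0// uv vw scalerA.
Qed.

Canonical proportional_equivRel := EquivRelPack proportional_equiv.

(* D / K^*, for D a set of vectors stable under non-zero scalars. *)
Definition projectivization := {eq_quot proportional}.

Definition represents (v : V) (p : projectivization) : Prop :=
  exists2 u : D, set_val u = v & p = \pi u.

Definition homogeneous_coords (p : projectivization) : V := set_val (repr p).

End Projectivization.

Definition projective_plane (K : fieldType) : Type :=
  projectivization [set v : 'cV[K]_3 | v <> 0].

(* The value at v of the quadratic form with Gram matrix A. *)
Definition qeval (A : comNzRingType) (G : 'M[A]_3) (v : 'cV[A]_3) : A :=
  (v^T *m G *m v) 0 0.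

Section IntersectionMultiplicity.
Variable K : fieldType.

(* 'X%:P and 'X are the two affine coordinates. *)
Local Notation Kxy := {poly {poly K}}.
Local Notation Kxy_frac := {fraction {poly {poly K}}}.
Local Notation frac := (@FracField.tofrac {poly {poly K}}).

Definition const2 (c : K) : Kxy := c%:P%:P.

(* The equation (x, y) |-> G (T (1, x, y)) of the conic G in the affine chart
   given by the frame T, in which the point spanned by the first column of T is
   the origin. *)
Definition affine_equation (T G : 'M[K]_3) : Kxy :=
  qeval (map_mx const2 G)
    (map_mx const2 T *m \col_(i < 3) [:: 1; 'X%:P; 'X]`_i).

(* The local ring at the origin, inside the field of fractions. *)
Definition local_ring : set Kxy_frac :=
  [set z | exists h u : Kxy, u.[0].[0] <> 0 /\ z = frac h / frac u].

Definition local_ideal (F G : Kxy) : set Kxy_frac :=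
  [set z | exists a b : Kxy_frac,
     [/\ local_ring a, local_ring b & z = a * frac F + b * frac G]].

(* The K-vector space local_ring / (F, G) has dimension m: it admits a basis of
   m elements. *)
Definition local_dim (F G : Kxy) (m : nat) : Prop :=
  exists e : 'I_m -> Kxy_frac,
    (forall i, local_ring (e i)) /\
    forall z, local_ring z ->
      exists! c : 'rV[K]_m,
        local_ideal F G (z - \sum_(i < m) frac (const2 (c 0 i)) * e i).

(* The local intersection multiplicity at p of the conics G1 and G2; it does
   not depend on the chart T centred at p. *)
Definition intersection_mult (G1 G2 : 'M[K]_3) (p : projective_plane K)
    (m : nat) : Prop :=
  exists T : 'M[K]_3,
    [/\ T \in unitmx, represents (col 0 T) p &
        local_dim (affine_equation T G1) (affine_equation T G2) m].

End IntersectionMultiplicity.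

Section Conics.
Variable R : realType.

(* A quadratic form is identified with its symmetric Gram matrix. *)
Definition nonzero_qform : Type :=
  [set A : 'M[R]_3 | A^T = A /\ A <> 0].

Definition conic : Type := quotient_topology
  (projectivization [set A : 'M[R]_3 | A^T = A /\ A <> 0]).

HB.instance Definition _ := Topological.on conic.

Definition conic_of (f : nonzero_qform) : conic := \pi f.

(* An arbitrary equation of c; what is defined below from form_of and from
   homogeneous_coords is invariant under rescaling of either. *)
Definition form_of (c : conic) : 'M[R]_3 := homogeneous_coords c.

Definition nondegenerate (A : 'M[R]_3) : Prop := \det A <> 0.

Definition proper (c : conic) : Prop := nondegenerate (form_of c).

Definition real_locus (c : conic) : set (projective_plane R) :=
  [set p | qeval (form_of c) (homogeneous_coords p) = 0].

Definition complexify m n (A : 'M[R]_(m, n)) : 'M[R[i]]_(m, n) :=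
  map_mx (real_complex R) A.

Definition complex_locus (c : conic) : set (projective_plane R[i]) :=
  [set p | qeval (complexify (form_of c)) (homogeneous_coords p) = 0].

Definition real_point (p : projective_plane R[i]) : Prop :=
  exists v : 'cV[R]_3, represents (complexify v) p.

Definition intersection_points (m : nat) (cd : conic * conic) :
    set (projective_plane R[i]) :=
  [set p | [/\ complex_locus cd.1 p, complex_locus cd.2 p &
    intersection_mult (complexify (form_of cd.1)) (complexify (form_of cd.2))
      p m]].

Definition real_intersection_points m cd :=
  intersection_points m cd `&` real_point.

Definition imaginary_intersection_points m cd :=
  intersection_points m cd `&` ~` real_point.

Definition distinct_proper (cd : conic * conic) : Prop :=
  [/\ proper cd.1, proper cd.2 & cd.1 <> cd.2].

Definition rigid_isotopy (gamma : R -> conic * conic) : Prop :=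
  [/\ {within `[0, 1], continuous gamma},
      forall t, t \in `[0, 1] -> distinct_proper (gamma t) &
      forall t t', t \in `[0, 1] -> t' \in `[0, 1] -> forall m,
        (real_intersection_points m (gamma t) #=
         real_intersection_points m (gamma t'))%card /\
        (imaginary_intersection_points m (gamma t) #=
         imaginary_intersection_points m (gamma t'))%card].

Definition connects (gamma : R -> conic * conic) (x y : conic * conic) : Prop :=
  gamma 0 = x /\ gamma 1 = y.

Definition rigidly_isotopic (x y : conic * conic) : Prop :=
  exists gamma, rigid_isotopy gamma /\ connects gamma x y.

(* The form a *: f + b *: g represents no conic when a = b = 0. *)
Definition is_pencil (L : set conic) : Prop :=
  exists f g : nonzero_qform, conic_of f <> conic_of g /\
    L = [set c | exists a b : R,
           represents (a *: set_val f + b *: set_val g) c].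

Definition swap_couple (x : conic * conic) : conic * conic := (x.2, x.1).

(* t |-> ([f + t k g], [g]) for t in [a, b]. *)
Definition sliding_left (a b : R) (sigma : R -> conic * conic) : Prop :=
  exists (f g : nonzero_qform) (k : R),
    [/\ nondegenerate (set_val f), nondegenerate (set_val g),
        conic_of f <> conic_of g &
        forall t, t \in `[a, b] ->
          [/\ nondegenerate (set_val f + (t * k) *: set_val g),
              represents (set_val f + (t * k) *: set_val g) (sigma t).1 &
              (sigma t).2 = conic_of g]].

Definition sliding (a b : R) (sigma : R -> conic * conic) : Prop :=
  a <= 0 <= b /\
  (sliding_left a b sigma \/ sliding_left a b (fun t => swap_couple (sigma t))).

(* A reparametrization is an increasing homeomorphism of [u, v] onto [a, b];
   a constant piece of s is obtained with k = 0. *)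
Definition reparametrized_sliding (u v : R) (s : R -> conic * conic) : Prop :=
  exists (a b : R) (sigma : R -> conic * conic) (phi : R -> R),
    [/\ sliding a b sigma,
        {within `[u, v], continuous phi},
        {in `[u, v] &, {homo phi : x y / x < y}},
        phi u = a /\ phi v = b &
        forall t, t \in `[u, v] -> s t = sigma (phi t)].

Definition sliding_sequence (L : set conic) (s : R -> conic * conic) : Prop :=
  (forall t, t \in `[0, 1] -> L (s t).1 /\ L (s t).2) /\
  exists (n : nat) (tau : nat -> R),
    [/\ tau 0%N = 0, tau n = 1,
        forall i, (i < n)%N -> tau i < tau i.+1 &
        forall i, (i < n)%N ->
          reparametrized_sliding (tau i) (tau i.+1) s].

Definition GL3 : Type := [set M : 'M[R]_3 | M \in unitmx].

Definition PGL3 : Type := quotient_topology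
  (projectivization [set M : 'M[R]_3 | M \in unitmx]).

HB.instance Definition _ := Topological.on PGL3.

Definition pgl_of (M : GL3) : PGL3 := \pi M.

Lemma GL3_1_subproof : [set M : 'M[R]_3 | M \in unitmx] 1%:M.
Proof. exact: unitmx1. Qed.

Definition pgl1 : PGL3 := pgl_of (SigSub (mem_set GL3_1_subproof)).

Lemma qform_act_subproof (M : GL3) (f : nonzero_qform) :
  [set A : 'M[R]_3 | A^T = A /\ A <> 0]
    ((invmx (set_val M))^T *m set_val f *m invmx (set_val M)).
Proof.
have uM : set_val M \in unitmx := set_valP M.
have [As A0] := set_valP f; split; first by rewrite !trmx_mul trmxK As mulmxA.
move=> E; apply: A0.
have := congr1 (fun B => (set_val M)^T *m B *m set_val M) E.
rewrite mulmx0 mul0mx !mulmxA -trmx_mul mulVmx// trmx1 mul1mx.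
by rewrite -mulmxA mulVmx// mulmx1.
Qed.

(* The equation of the image by M of the conic f = 0 is f \o M^-1. *)
Definition qform_act (M : GL3) (f : nonzero_qform) : nonzero_qform :=
  SigSub (mem_set (qform_act_subproof M f)).

Definition pgl_act (m : PGL3) (c : conic) : conic :=
  conic_of (qform_act (repr m) (repr c)).

Definition pgl_act_couple (m : PGL3) (x : conic * conic) : conic * conic :=
  (pgl_act m x.1, pgl_act m x.2).

Lemma conic_of_eqP (f g : nonzero_qform) :
  conic_of f = conic_of g <-> exists2 c : R, c != 0 & set_val f = c *: set_val g.
Proof.
split=> [/eqmodP/asboolP//|fg].
by apply/eqmodP/asboolP.
Qed.

Lemma pgl_of_eqP (M N : GL3) :
  pgl_of M = pgl_of N <-> exists2 c : R, c != 0 & set_val M = c *: set_val N.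
Proof.
split=> [/eqmodP/asboolP//|fg].
by apply/eqmodP/asboolP.
Qed.

Lemma properE (f : nonzero_qform) :
  proper (conic_of f) <-> nondegenerate (set_val f).
Proof.
have [c c0 E] : exists2 c : R, c != 0 & form_of (conic_of f) = c *: set_val f.
  by apply/conic_of_eqP; rewrite /conic_of reprK.
rewrite /proper /nondegenerate E detZ; split=> /eqP h; apply/eqP.
  by apply: contra h => /eqP ->; rewrite mulr0.
by rewrite mulf_neq0// expf_neq0.
Qed.

Lemma pgl_actE (M : GL3) (f : nonzero_qform) :
  pgl_act (pgl_of M) (conic_of f) = conic_of (qform_act M f).
Proof.
have [c c0 E] : exists2 c : R, c != 0 &
    set_val (repr (conic_of f)) = c *: set_val f.
  by apply/conic_of_eqP; rewrite /conic_of reprK.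
have [d d0 E'] : exists2 d : R, d != 0 &
    set_val (repr (pgl_of M)) = d *: set_val M.
  by apply/pgl_of_eqP; rewrite /pgl_of reprK.
apply/conic_of_eqP; exists (d^-1 * d^-1 * c).
  by rewrite !mulf_neq0 ?invr_eq0.
rewrite [LHS](_ : _ = (invmx (set_val (repr (pgl_of M))))^T *m
  set_val (repr (conic_of f)) *m invmx (set_val (repr (pgl_of M))))//.
rewrite [set_val (qform_act _ _)](_ : _ = (invmx (set_val M))^T *m
  set_val f *m invmx (set_val M))// E E'.
have uM : set_val M \in unitmx := set_valP M.
rewrite invmxZ ?unitmxZ ?unitfE// [(_ *: _)^T]linearZ/=.
by rewrite -scalemxAr -scalemxAl -scalemxAr -!scalemxAl !scalerA mulrAC.
Qed.

End Conics.

(* Main.v *)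
(* Represent a couple by Gram matrices (A, B) and put M = B^-1 A, whose Segre
   symbol is determined by the multiplicities of the intersection points: M has
   a multiple eigenvalue exactly when the conics are tangent at some complex
   point, and a common tangent point of multiplicity 3 or 4 corresponds to the
   symbol [3] or [(2,1)], one of multiplicity 2 to [2,1] or [(1,1),1] according
   to whether there is a transverse point as well.

   Along a rigid isotopy the symbol is constant.  For (A, B) close to (A0, B0) the
   pencil of (A, B) then contains a couple close to (A, B) whose matrix is
   h M0 h^-1 with h close to 1: it comes from an affine function of M when M has a
   multiple eigenvalue, and otherwise from a Moebius function of M sending the
   characteristic polynomial of M to that of M0.  After the congruence by h the
   second forms differ by a B0-selfadjoint matrix close to 1 commuting with M0, and
   the congruence by its square root carries one couple to the other.  So nearby
   couples differ by slidings and by congruences joined to 1 in GL3; by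
   connectedness of [0, 1] the two ends do.

   Both conics of a couple move together under a congruence, so slidings commute
   with it: the slidings can be performed inside the initial pencil and the
   congruences gathered in one path of PGL3.  Neither changes the multiplicities,
   as the local intersection ideal depends only on the pencil. *)

From HB Require Import structures.
Require Import Defs.
From mathcomp Require Import all_boot all_order all_algebra.
From mathcomp Require Import fraction complex ring lra zify polyrcf.
From mathcomp Require Import all_classical all_reals all_analysis.

Set Implicit Arguments.
Unset Strict Implicit.
Unset Printing Implicit Defensive.

Import Order.TTheory GRing.Theory Num.Theory.
Import numFieldNormedType.Exports.

Local Open Scope classical_set_scope.
Local Open Scope ring_scope.

(** * Local intersection multiplicity along a smooth conic *)

(** Multiplicity, defined by a local ring, meets linear algebra in one place: near a common point
    the conic [B] is parametrized by [(1, s, s^2)], and the multiplicity is the order at [0] of the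
    quartic obtained by restricting [A] to it. The coefficients of that quartic are also, up to
    constants, the entries of [B^-1 A] in an adapted frame.

    Three obstacles shape the rest. The generic case has to stay over the reals although two
    eigenvalues may be complex: a single real root [l] is used, and the other two enter only through
    the coefficients of a quadratic. No continuous choice of that root is constructed: the argument
    runs along the filter of pairs (couple, root), and the intermediate value theorem then supplies
    a root close to the base one. *)

Notation o0 := (@Ordinal 3 0 isT).
Notation o1 := (@Ordinal 3 1 isT).
Notation o2 := (@Ordinal 3 2 isT).

Lemma sum3 (V : nmodType) (F : 'I_3 -> V) : \sum_i F i = F o0 + F o1 + F o2.
Proof.
rewrite !big_ord_recl big_ord0 addr0 addrA; congr (_ + _ + _); congr F; exact/val_inj.
Qed.

Lemma ord3P (P : 'I_3 -> Prop) : P o0 -> P o1 -> P o2 -> forall i, P i.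
Proof.
move=> p0 p1 p2 [[|[|[|//]]] lti]; [move: p0|move: p1|move: p2];
by congr P; apply/val_inj.
Qed.

Lemma ord3_0 : (0 : 'I_3) = o0. Proof. exact/val_inj. Qed.

Lemma qeval3 (A : comNzRingType) (G : 'M[A]_3) (v : 'cV[A]_3) :
  qeval G v = \sum_i \sum_j v i 0 * G i j * v j 0.
Proof.
rewrite /qeval mxE exchange_big; apply: eq_bigr => j _; rewrite mxE mulr_suml.
by apply: eq_bigr => i _; rewrite mxE.
Qed.

(* The Gram matrix of 2 (x1^2 - x0 x2). *)
Definition conic_std (K : nzRingType) : 'M[K]_3 :=
  \matrix_(i, j) (nth [::] [:: [:: 0; 0; -1]; [:: 0; 2; 0]; [:: -1; 0; 0]] i)`_j.

(* The restriction of the form G to the conic conic_std, parametrized by (1, s, s^2). *)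
Definition conic_restr (K : comNzRingType) (G : 'M[K]_3) : {poly K} :=
  qeval (map_mx polyC G) (\col_(i < 3) 'X^i).

Lemma coprimep_Xn (K : fieldType) (p : {poly K}) m : p.[0] != 0 -> coprimep p ('X^m).
Proof.
move=> p0; apply: coprimep_expr; rewrite -['X]subr0 -polyC0.
by rewrite coprimep_XsubC.
Qed.

Lemma size_modp_Xn (K : fieldType) (p : {poly K}) m : (size (p %% 'X^m)%R <= m)%N.
Proof.
rewrite -ltnS -[m.+1](size_polyXn K m) ltn_modp.
by rewrite -size_poly_eq0 size_polyXn.
Qed.

Section FieldIdentities.
Variable F : fieldType.
Implicit Types d n q k a b c x y z : F.

(** These identities live in an abstract field, so that [field] never has to work on the elements
    [iota _] to which they are applied. *)
Lemma fraction_id1 d n q k : d != 0 -> k != 0 ->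
  q / d - (n / d) ^+ 2 = - k^-1 * (d^-1 * d^-1) * (k * (n ^+ 2 - d * q)).
Proof. by move=> d0 k0; field; rewrite k0 d0. Qed.

Lemma fraction_id2 d n q a00 a01 a02 a10 a11 a12 a20 a21 a22 : d != 0 ->
  let s := n / d in
  s ^+ 0 * a00 * s ^+ 0 + s ^+ 0 * a01 * s ^+ 1 + s ^+ 0 * a02 * s ^+ 2 +
  (s ^+ 1 * a10 * s ^+ 0 + s ^+ 1 * a11 * s ^+ 1 + s ^+ 1 * a12 * s ^+ 2) +
  (s ^+ 2 * a20 * s ^+ 0 + s ^+ 2 * a21 * s ^+ 1 + s ^+ 2 * a22 * s ^+ 2) =
  (d * a00 * d + d * a01 * n + d * a02 * q + (n * a10 * d + n * a11 * n + n * a12 * q)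
   + (q * a20 * d + q * a21 * n + q * a22 * q)) / d ^+ 2 -
  (q / d - s ^+ 2) * (a02 + a20 + (a12 + a21) * s + a22 * (q / d + s ^+ 2)).
Proof. by move=> d0 s; rewrite /s; field. Qed.

Lemma fraction_id3 d n q a b c : d != 0 ->
  (a * d + b * n + c * q) / d = a + b * (n / d) + c * (q / d).
Proof. by move=> d0; field. Qed.

Lemma fraction_id4 d a b z w F' G' : a != 0 -> b != 0 ->
  a * b * (d * (z / a * F' + w / b * G')) = d * (z * b * F' + w * a * G').
Proof. by move=> a0 b0; field; rewrite a0 b0. Qed.

End FieldIdentities.

Section LocalIntersection.
Variable K : fieldType.
Local Notation Kxy := {poly {poly K}}.

(* L stands for the field of fractions of K[x, y], kept abstract. *)
Variables (L : fieldType) (iota : {rmorphism Kxy -> L}).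
Hypothesis iota_inj : injective iota.

Definition loc_ring : set L :=
  [set z | exists h u : Kxy, u.[0].[0] <> 0 /\ z = iota h / iota u].

Definition loc_ideal (F G : Kxy) : set L :=
  [set z | exists a b : L,
     [/\ loc_ring a, loc_ring b & z = a * iota F + b * iota G]].

Definition loc_dim (F G : Kxy) (m : nat) : Prop :=
  exists e : 'I_m -> L,
    (forall i, loc_ring (e i)) /\
    forall z, loc_ring z ->
      exists! c : 'rV[K]_m,
        loc_ideal F G (z - \sum_(i < m) iota (const2 (c 0 i)) * e i).

Lemma iota0 : iota 0 = 0. Proof. exact: rmorph0. Qed.
Lemma iota1 : iota 1 = 1. Proof. exact: rmorph1. Qed.
Lemma iotaD : {morph iota : x y / x + y}. Proof. exact: rmorphD. Qed.
Lemma iotaB : {morph iota : x y / x - y}. Proof. exact: rmorphB. Qed.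
Lemma iotaM : {morph iota : x y / x * y}. Proof. exact: rmorphM. Qed.
Lemma iotaN : {morph iota : x / - x}. Proof. exact: rmorphN. Qed.
Lemma iotaXn n : {morph iota : x / x ^+ n}. Proof. exact: rmorphXn. Qed.
Lemma iota_eq x y : (iota x == iota y) = (x == y).
Proof. exact: inj_eq. Qed.
Lemma iota_eq0 x : (iota x == 0) = (x == 0). Proof. by rewrite -iota0 iota_eq. Qed.

Definition ev0 (h : Kxy) : K := h.[0].[0].

Lemma ev0D h g : ev0 (h + g) = ev0 h + ev0 g. Proof. by rewrite /ev0 !hornerD. Qed.
Lemma ev0M h g : ev0 (h * g) = ev0 h * ev0 g. Proof. by rewrite /ev0 !hornerM. Qed.
Lemma ev0X h n : ev0 (h ^+ n) = ev0 h ^+ n. Proof. by rewrite /ev0 !horner_exp. Qed.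
Lemma ev0C c : ev0 (const2 c) = c. Proof. by rewrite /ev0 !hornerC. Qed.
Lemma ev0_neq0 h : ev0 h != 0 -> iota h != 0.
Proof.
by apply: contra; rewrite iota_eq0 => /eqP ->; rewrite /ev0 !horner0.
Qed.

Lemma loc_ringP (z : L) :
  loc_ring z <-> exists h u, ev0 u != 0 /\ z = iota h / iota u.
Proof. by split=> -[h [u [/eqP u0 ->]]]; exists h, u. Qed.

Lemma loc_ring_poly h : loc_ring (iota h).
Proof.
apply/loc_ringP; exists h, 1; rewrite iota1 divr1; split=> //.
by rewrite /ev0 !hornerC oner_eq0.
Qed.

Lemma loc_ring_inv h : ev0 h != 0 -> loc_ring (iota h)^-1.
Proof. by move=> h0; apply/loc_ringP; exists 1, h; rewrite iota1 mul1r. Qed.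

Lemma loc_ringM z w : loc_ring z -> loc_ring w -> loc_ring (z * w).
Proof.
move=> /loc_ringP[h [u [u0 ->]]] /loc_ringP[g [v [v0 ->]]].
apply/loc_ringP; exists (h * g), (u * v); rewrite ev0M mulf_neq0 //; split=> //.
by rewrite !iotaM invfM mulrACA.
Qed.

Lemma loc_ringD z w : loc_ring z -> loc_ring w -> loc_ring (z + w).
Proof.
move=> /loc_ringP[h [u [u0 ->]]] /loc_ringP[g [v [v0 ->]]].
apply/loc_ringP; exists (h * v + g * u), (u * v).
rewrite ev0M mulf_neq0 //; split=> //.
by rewrite addf_div ?ev0_neq0// iotaM iotaD !iotaM.
Qed.

Lemma loc_ringN z : loc_ring z -> loc_ring (- z).
Proof.
move=> zO; rewrite -mulN1r; apply: loc_ringM => //.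
by rewrite -iota1 -iotaN; apply: loc_ring_poly.
Qed.

Section Ideal.
Variables F G : Kxy.
Local Notation I := (loc_ideal F G).

Lemma loc_idealD z w : I z -> I w -> I (z + w).
Proof.
move=> [a [b [aO bO ->]]] [c [d [cO dO ->]]]; exists (a + c), (b + d).
by split; [exact: loc_ringD..|rewrite !mulrDl addrACA].
Qed.

Lemma loc_idealM z w : loc_ring z -> I w -> I (z * w).
Proof.
move=> zO [a [b [aO bO ->]]]; exists (z * a), (z * b).
by split; [exact: loc_ringM..|rewrite mulrDr !mulrA].
Qed.

Lemma loc_idealN w : I w -> I (- w).
Proof.
move=> [a [b [aO bO ->]]]; exists (- a), (- b).
by split; [exact: loc_ringN..|rewrite !mulNr opprD].
Qed.

Lemma loc_ideal0 : I 0.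
Proof.
by exists 0, 0; split; rewrite ?mul0r ?addr0// -iota0; apply: loc_ring_poly.
Qed.

Lemma loc_idealF : I (iota F).
Proof.
exists (iota 1), (iota 0); split; try exact: loc_ring_poly.
by rewrite iota1 iota0 mul1r mul0r addr0.
Qed.

Lemma loc_idealG : I (iota G).
Proof.
exists (iota 0), (iota 1); split; try exact: loc_ring_poly.
by rewrite iota1 iota0 mul1r mul0r add0r.
Qed.

Lemma loc_ideal_sum n (w : 'I_n -> L) :
  (forall i, I (w i)) -> I (\sum_(i < n) w i).
Proof. by move=> wI; elim/big_ind: _ => //; [exact: loc_ideal0|exact: loc_idealD]. Qed.

End Ideal.

(** Each [e i] is expanded in the family [f] modulo the ideal. A row killed by the resulting matrix
    [M] is a relation between the [e i], excluded by uniqueness of coordinates, so [M] is row free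
    and has at least as many columns as rows. *)
Lemma loc_dim_le (F G : Kxy) m n : loc_dim F G m -> loc_dim F G n -> (m <= n)%N.
Proof.
move=> [e [eO eb]] [f [fO fb]].
pose M := \matrix_(i < m) sval (cid (fb (e i) (eO i))).
have MP i : loc_ideal F G (e i - \sum_(j < n) iota (const2 (M i j)) * f j).
  have := svalP (cid (fb (e i) (eO i))) => -[h _].
  by under eq_bigr do rewrite mxE.
have key (c : 'rV[K]_m) : loc_ideal F G
    (\sum_(i < m) iota (const2 (c 0 i)) * e i -
     \sum_(j < n) iota (const2 ((c *m M) 0 j)) * f j).
  rewrite [X in _ - X](_ : _ = \sum_(i < m) iota (const2 (c 0 i)) *
     (\sum_(j < n) iota (const2 (M i j)) * f j)); last first.
    under eq_bigr do rewrite mxE /const2 !rmorph_sum /= mulr_suml.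
    rewrite exchange_big /=; apply: eq_bigr => i _; rewrite mulr_sumr.
    by apply: eq_bigr => j _; rewrite !rmorphM mulrA.
  rewrite -sumrB; apply: loc_ideal_sum => i; rewrite -mulrBr.
  by apply: loc_idealM => //; apply: loc_ring_poly.
suff : row_free M.
  by rewrite -row_leq_rank => /leq_trans; apply; apply: rank_leq_col.
apply/row_freeP; apply: contrapT => nM.
have /eqP/rowV0Pn[c /sub_kermxP cM c0] : kermx M <> 0.
  move=> /eqP; rewrite kermx_eq0 => /row_freeP; exact: nM.
have := key c; rewrite cM.
have -> : \sum_(j < n) iota (const2 ((0 : 'rV[K]_n) 0 j)) * f j = 0.
  by apply: big1 => j _; rewrite mxE /const2 !rmorph0 mul0r.
rewrite subr0 => cI.
have O0 : loc_ring (0 : L) by rewrite -iota0; apply: loc_ring_poly.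
have [c' [_ cu]] := eb 0 O0.
move/eqP: c0; apply.
rewrite -(cu 0); last first.
  rewrite sub0r big1 ?oppr0; first exact: loc_ideal0.
  by move=> i _; rewrite mxE /const2 !rmorph0 mul0r.
by rewrite (cu c)// sub0r; apply: loc_idealN.
Qed.

Lemma loc_dim_unique (F G : Kxy) m n : loc_dim F G m -> loc_dim F G n -> m = n.
Proof. by move=> h k; apply/eqP; rewrite eqn_leq !(@loc_dim_le F G). Qed.


(** * Order of vanishing along a parametrized conic *)

Section Order.
Variables (P Pi A : 'M[K]_3) (kap c : K) (m : nat) (rho : {poly K}).
Hypotheses (c2 : c * 2 != 0) (PiP : Pi *m P = 1%:M) (PPi : P *m Pi = 1%:M).
Hypotheses (kap0 : kap != 0) (Pcol : forall i, P i o0 = kap *+ (i == o0)).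
Hypotheses (phiE : conic_restr A = 'X^m * rho) (rho0 : rho.[0] != 0).
Hypothesis (m0 : (0 < m)%N).

Let e : 'cV[Kxy]_3 := \col_(i < 3) [:: 1; 'X%:P; 'X]`_i.
Let v : 'cV[Kxy]_3 := map_mx (@const2 K) P *m e.
Let F : Kxy := qeval (map_mx (@const2 K) A) v.
Let G : Kxy := qeval (map_mx (@const2 K) (c *: conic_std K)) v.
Local Notation I := (loc_ideal F G).
(** In the adapted frame [D], [N], [Q] are the homogeneous coordinates of the point [(1, x, y)]; at
    the origin they are [kap], [0], [0]. The fraction [s] is the local parameter of the conic, and
    [q = s^2] holds on it. [at_s eta] is the value of [eta] at [s]. *)
Let D := v o0 0.
Let N := v o1 0.
Let Q := v o2 0.
Let s := iota N / iota D.
Let q := iota Q / iota D.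
Let at_s (eta : {poly K}) : L := (map_poly (iota \o (polyC \o polyC)) eta).[s].

Lemma Picol i : Pi i o0 = kap^-1 *+ (i == o0).
Proof.
have := congr1 (fun M : 'M[K]_3 => M i o0) PiP; rewrite mxE sum3 !Pcol /=.
rewrite !mulr0n !mulr0 !addr0 mulr1n mxE => /(congr1 (fun x => x * kap^-1)).
by by rewrite mulfK // => ->; rewrite mulr_natl.
Qed.

Lemma vE i : v i 0 = const2 (P i o0) + const2 (P i o1) * 'X%:P + const2 (P i o2) * 'X.
Proof. by rewrite /v mxE sum3 !mxE /= mulr1. Qed.

Lemma v0 i : ev0 (v i 0) = kap *+ (i == o0).
Proof. by rewrite vE !ev0D !ev0M !ev0C Pcol /ev0 !hornerE ?mulr0 ?addr0. Qed.

Lemma D0 : ev0 D = kap. Proof. by rewrite /D v0. Qed.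
Lemma iD0 : iota D != 0. Proof. by apply: ev0_neq0; rewrite D0. Qed.

Lemma G_E : G = const2 (c * 2) * (N ^+ 2 - D * Q).
Proof.
rewrite /G qeval3 !sum3 -/D -/N -/Q !mxE /= /const2 !(mulr0, polyC0, mul0r, addr0, add0r).
rewrite !rmorphM !rmorphN !rmorph1 /=.
ring.
Qed.

Lemma at_sD a b : at_s (a + b) = at_s a + at_s b.
Proof. by rewrite /at_s rmorphD hornerD. Qed.
Lemma at_sN a : at_s (- a) = - at_s a.
Proof. by rewrite /at_s rmorphN hornerN. Qed.
Lemma at_sM a b : at_s (a * b) = at_s a * at_s b.
Proof. by rewrite /at_s rmorphM hornerM. Qed.
Lemma at_sC a : at_s a%:P = iota (const2 a).
Proof. by rewrite /at_s map_polyC hornerC. Qed.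
Lemma at_sX : at_s 'X = s.
Proof. by rewrite /at_s map_polyX hornerX. Qed.
Lemma at_sXn n : at_s ('X^n) = s ^+ n.
Proof. by rewrite /at_s map_polyXn hornerXn. Qed.

Lemma loc_ring_frac h : loc_ring (iota h / iota D).
Proof. by apply: loc_ringM; [exact: loc_ring_poly|apply: loc_ring_inv; rewrite D0]. Qed.

(* s is the quotient of two affine forms, hence eta(s) is a polynomial in x, y
   divided by a power of D. *)
Lemma at_s_frac eta : exists h n,
  at_s eta = iota h / iota D ^+ n /\ ev0 h = eta.[0] * kap ^+ n.
Proof.
elim/poly_ind: eta => [|eta a [h [n [E E0]]]].
  by exists 0, 0%N; rewrite /at_s !rmorph0 !horner0 mul0r /ev0 !horner0 mul0r.
exists (h * N + const2 a * D ^+ n.+1), n.+1; split.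
  rewrite at_sD at_sM E at_sC at_sX /s iotaD !iotaM iotaXn mulrDl mulfK.
    by rewrite exprS invfM; congr (_ + _); ring.
  by rewrite expf_neq0 // iD0.
rewrite ev0D !ev0M ev0X D0 ev0C [ev0 N]v0 /= mulr0 add0r.
by rewrite !hornerE ?mulr0 ?add0r ?mulr1n.
Qed.

Lemma loc_ring_at_s eta : loc_ring (at_s eta).
Proof.
have [h [n [-> _]]] := at_s_frac eta; rewrite -iotaXn.
apply: loc_ringM; first exact: loc_ring_poly.
by apply: loc_ring_inv; rewrite ev0X D0 expf_neq0.
Qed.

Lemma loc_ring_at_s_inv eta : eta.[0] != 0 -> loc_ring (at_s eta)^-1.
Proof.
have [h [n [-> h0]]] := at_s_frac eta => e0; rewrite invfM invrK mulrC -iotaXn.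
apply: loc_ringM; first exact: loc_ring_poly.
by apply: loc_ring_inv; rewrite h0 mulf_neq0 // expf_neq0.
Qed.

(** By [G_E] this is [G] divided by the unit [- 2 c D^2]. *)
Lemma q_s2 : I (q - s ^+ 2).
Proof.
have cc : ev0 (const2 (c * 2)) != 0 by rewrite ev0C.
rewrite [X in I X](_ : _ =
  (- (iota (const2 (c * 2)))^-1 * ((iota D)^-1 * (iota D)^-1)) * iota G).
  apply: loc_idealM; last exact: loc_idealG.
  apply: loc_ringM; first by apply: loc_ringN; apply: loc_ring_inv.
  by apply: loc_ringM; apply: loc_ring_inv; rewrite D0.
rewrite G_E iotaM iotaB iotaXn iotaM /q /s.
exact: fraction_id1 iD0 (ev0_neq0 cc).
Qed.

(** [F / D^2] is the form [A] at [(1, s, q)]; replacing [q] by [s^2] changes it by a multiple of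
    [q - s^2]. *)
Lemma at_s_phi : I (at_s (conic_restr A)).
Proof.
have O2 (a : K) : loc_ring (iota (const2 a)) by apply: loc_ring_poly.
pose a i j := iota (const2 (A i j)).
have -> : at_s (conic_restr A) = iota F / iota D ^+ 2 - (q - s ^+ 2) *
   (a o0 o2 + a o2 o0 + (a o1 o2 + a o2 o1) * s + a o2 o2 * (q + s ^+ 2)).
  have -> : at_s (conic_restr A) = \sum_i \sum_j s ^+ (i : 'I_3) * a i j * s ^+ (j : 'I_3).
    rewrite /conic_restr qeval3 /at_s rmorph_sum horner_sum; apply: eq_bigr => i _.
    rewrite rmorph_sum horner_sum; apply: eq_bigr => j _.
    by rewrite !mxE -/(at_s _) 2!at_sM !at_sXn at_sC.
  have -> : iota F = \sum_i \sum_j iota (v i 0) * a i j * iota (v j 0).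
    rewrite /F qeval3 rmorph_sum; apply: eq_bigr => i _.
    by rewrite rmorph_sum; apply: eq_bigr => j _; rewrite [map_mx _ _ i j]mxE !rmorphM.
  rewrite !sum3 -/D -/N -/Q /q /s.
  have := iD0; move: (iota D) (iota N) (iota Q) => d n r d0.
  by apply: etrans (fraction_id2 n r _ _ _ _ _ _ _ _ _ d0) _.
apply: loc_idealD.
  rewrite mulrC; apply: loc_idealM; last exact: loc_idealF.
  by rewrite -iotaXn; apply: loc_ring_inv; rewrite ev0X D0 expf_neq0.
rewrite -mulNr mulrC; apply: loc_idealM; last first.
  by apply: loc_idealN; exact: q_s2.
have Os : loc_ring s by exact: loc_ring_frac.
have Oq : loc_ring q by exact: loc_ring_frac.
have Os2 : loc_ring (s ^+ 2) by apply: loc_ringM.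
have O2D (x y : K) : loc_ring (iota (const2 x) + iota (const2 y)).
  by apply: loc_ringD; exact: O2.
apply: loc_ringD; last by apply: loc_ringM; [exact: O2|exact: loc_ringD].
by apply: loc_ringD; [exact: O2D|apply: loc_ringM => //; exact: O2D].
Qed.

(** The cofactor [rho] takes at [s] a value that is a unit of the local ring, because [rho] does not
    vanish at [0]. *)
Lemma sm_ideal : I (s ^+ m).
Proof.
have := at_s_phi; rewrite phiE at_sM at_sXn => h.
have r0 : at_s rho != 0.
  have [h' [n [-> h0]]] := at_s_frac rho.
  by rewrite mulf_neq0 ?invr_eq0 ?expf_neq0 ?iD0 ?ev0_neq0 // h0 mulf_neq0 ?expf_neq0.
rewrite -[s ^+ m](mulKf r0) [at_s rho * _]mulrC.
by apply: loc_idealM => //; apply: loc_ring_at_s_inv.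
Qed.

(** The constant term [a] of the polynomial is recorded because it decides whether that polynomial
    can be inverted modulo ['X^m]. *)
Definition near_s (z : L) (a : K) :=
  loc_ring z /\ exists2 eta, eta.[0] = a & I (z - at_s eta).

Lemma near_sD z w a b : near_s z a -> near_s w b -> near_s (z + w) (a + b).
Proof.
move=> [Oz [eta <- zI]] [Ow [theta <- wI]]; split; first exact: loc_ringD.
exists (eta + theta); first by rewrite hornerD.
by rewrite at_sD opprD addrACA; apply: loc_idealD.
Qed.

Lemma near_sM z w a b : near_s z a -> near_s w b -> near_s (z * w) (a * b).
Proof.
move=> [Oz [eta <- zI]] [Ow [theta <- wI]]; split; first exact: loc_ringM.
exists (eta * theta); first by rewrite hornerM.
rewrite at_sM (_ : _ - _ = z * (w - at_s theta) + at_s theta * (z - at_s eta)); last by ring.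
by apply: loc_idealD; apply: loc_idealM => //; apply: loc_ring_at_s.
Qed.

Lemma near_sC a : near_s (iota (const2 a)) a.
Proof.
split; first exact: loc_ring_poly.
by exists a%:P; rewrite ?hornerC // at_sC subrr; apply: loc_ideal0.
Qed.

Lemma near_sV z a : loc_ring z^-1 -> a != 0 -> near_s z a -> near_s z^-1 a^-1.
Proof.
move=> Oz' a0 [Oz [eta ea zI]]; split=> //.
have /Bezout_eq1_coprimepP[[u w] /= uw] : coprimep eta ('X^m).
  by apply: coprimep_Xn; rewrite ea.
exists u.
  have : (u * eta + w * 'X^m).[0] = 1 by rewrite uw hornerE.
  rewrite hornerD !hornerM ea hornerXn expr0n gtn_eqF // mulr0 addr0 => h.
  by rewrite -[u.[0]](mulfK a0) h mul1r.
(* Since [0^-1] is [0], this case asks that [u] at [s] be in the ideal; there [eta] at [s] and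
   [s ^+ m] both lie in it, hence so does [1]. *)
have [z0|z0] := eqVneq z 0.
  rewrite z0 invr0 sub0r -mulN1r -(mulr1 (at_s u)).
  rewrite -[X in _ * (_ * X)](_ : at_s (u * eta + w * 'X^m) = 1); last first.
    by rewrite uw at_sC /const2 !rmorph1.
  move: zI; rewrite z0 sub0r => zI.
  rewrite at_sD !at_sM at_sXn mulN1r -mulrN; apply: loc_idealM; first exact: loc_ring_at_s.
  rewrite opprD -!mulrN; apply: loc_idealD; apply: loc_idealM; try exact: loc_ring_at_s.
    exact: zI.
  by apply: loc_idealN; apply: sm_ideal.
rewrite (_ : _ - _ = z^-1 * (at_s w * s ^+ m + at_s u * - (z - at_s eta))).
  apply: loc_idealM => //; apply: loc_idealD; apply: loc_idealM.
  - exact: loc_ring_at_s.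
  - exact: sm_ideal.
  - exact: loc_ring_at_s.
  - exact: loc_idealN.
have : at_s (u * eta + w * 'X^m) = 1 by rewrite uw at_sC /const2 !rmorph1.
rewrite at_sD !at_sM at_sXn => h.
rewrite (_ : _ + _ * - _ = 1 - at_s u * z); last by rewrite -h; ring.
by rewrite mulrBr mulr1 [at_s u * z]mulrC mulKf.
Qed.

Lemma near_s_s : near_s s 0.
Proof.
split; first exact: loc_ring_frac.
by exists 'X; rewrite ?hornerX // at_sX subrr; apply: loc_ideal0.
Qed.

Lemma near_s_q : near_s q 0.
Proof.
split; first exact: loc_ring_frac.
exists ('X^2); first by rewrite !hornerE expr0n.
by rewrite at_sXn; apply: q_s2.
Qed.

Lemma e_frac i : iota (e i 0) / iota D =
  iota (const2 (Pi i o0)) + iota (const2 (Pi i o1)) * s + iota (const2 (Pi i o2)) * q.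
Proof.
have -> : e = map_mx (@const2 K) Pi *m v.
  rewrite /v mulmxA -(map_mxM (polyC \o polyC)) PiP.
  by rewrite (map_mx1 (polyC \o polyC)) mul1mx.
rewrite mxE sum3 ![map_mx _ Pi _ _]mxE -/D -/N -/Q !(iotaD, iotaM) /s /q.
exact: fraction_id3 iD0.
Qed.

Lemma near_s_e i : near_s (iota (e i 0) / iota D) (kap^-1 *+ (i == o0)).
Proof.
rewrite e_frac -Picol.
have := near_sD (near_sD (near_sC (Pi i o0)) (near_sM (near_sC (Pi i o1)) near_s_s))
  (near_sM (near_sC (Pi i o2)) near_s_q).
by rewrite !mulr0 !addr0.
Qed.

Lemma near_s_D : near_s (iota D) kap.
Proof.
have := near_s_e o0; rewrite mxE /= iota1 mul1r mulr1n => h.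
rewrite -[iota D]invrK -[kap]invrK; apply: near_sV => //; last by rewrite invr_eq0.
by rewrite invrK; apply: loc_ring_poly.
Qed.

Lemma near_s_coord i : i != o0 -> near_s (iota (e i 0)) 0.
Proof.
move=> i0; have := near_sM (near_s_e i) near_s_D.
by rewrite divfK ?iD0 // (negbTE i0) mulr0n mul0r.
Qed.

Lemma near_s_poly h : near_s (iota h) (ev0 h).
Proof.
elim/poly_ind: h => [|h p IH]; first by have := near_sC 0; rewrite /const2 !rmorph0 /ev0 !horner0.
rewrite rmorphD rmorphM ev0D ev0M /=; apply: near_sD.
  apply: near_sM => //; have := near_s_coord (i := o2) isT; rewrite mxE /=.
  by rewrite /ev0 hornerX horner0.
elim/poly_ind: p => [|p a IHp]; first by have := near_sC 0; rewrite /const2 !rmorph0 /ev0 !horner0.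
rewrite polyCD polyCM rmorphD rmorphM ev0D ev0M /=; apply: near_sD.
  apply: near_sM => //; have := near_s_coord (i := o1) isT; rewrite mxE /=.
  by rewrite /ev0 !hornerE.
by have := near_sC a; rewrite -[X in near_s _ X](ev0C a).
Qed.

Lemma near_s_local z : loc_ring z -> exists a, near_s z a.
Proof.
move=> /loc_ringP[h [u [u0 ->]]]; exists (ev0 h * (ev0 u)^-1).
apply: near_sM; first exact: near_s_poly.
by apply: near_sV => //; [exact: loc_ring_inv|exact: near_s_poly].
Qed.

(* The substitution of the parametrization of the conic in K[x, y]; the
   denominator d of the parametrization is inverted modulo s^m. *)
Let d : {poly K} := (Pi o0 o0)%:P + (Pi o0 o1)%:P * 'X + (Pi o0 o2)%:P * 'X^2.
Let w i : {poly K} := (Pi i o0)%:P + (Pi i o1)%:P * 'X + (Pi i o2)%:P * 'X^2.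

Variables (d' r : {poly K}).
Hypothesis dd' : d * d' = 1 + r * 'X^m.

Let psi : Kxy -> {poly K} :=
  horner_eval (w o2 * d') \o map_poly (comp_poly (w o1 * d')).

Lemma psiD a b : psi (a + b) = psi a + psi b. Proof. exact: rmorphD. Qed.
Lemma psiM a b : psi (a * b) = psi a * psi b. Proof. exact: rmorphM. Qed.
Lemma psiB a b : psi (a - b) = psi a - psi b. Proof. exact: rmorphB. Qed.
Lemma psiXn a n : psi (a ^+ n) = psi a ^+ n. Proof. exact: rmorphXn. Qed.
Lemma psi_sum n (f : 'I_n -> Kxy) : psi (\sum_i f i) = \sum_i psi (f i).
Proof. exact: rmorph_sum. Qed.
Lemma psiC a : psi (const2 a) = a%:P.
Proof. by rewrite /psi /= /horner_eval map_polyC hornerC /= comp_polyC. Qed.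
Lemma psix : psi 'X%:P = w o1 * d'.
Proof. by rewrite /psi /= /horner_eval map_polyC hornerC /= comp_polyX. Qed.
Lemma psiy : psi 'X = w o2 * d'.
Proof. by rewrite /psi /= /horner_eval map_polyX hornerX. Qed.

(** Up to the factor [d'], the substitution undoes the change of frame and gives back the point
    [(1, X, X^2)]. The only error is that [d * d'] is [1] merely modulo ['X^m]. *)
Lemma psi_v i : exists a, psi (v i 0) = d' * 'X^i + a * 'X^m.
Proof.
exists (- ((P i o0)%:P * r)).
have Pw : (P i o0)%:P * w o0 + (P i o1)%:P * w o1 + (P i o2)%:P * w o2 = 'X^i.
  have PPi' j : P i o0 * Pi o0 j + P i o1 * Pi o1 j + P i o2 * Pi o2 j = (i == j)%:R.
    by have := congr1 (fun M : 'M[K]_3 => M i j) PPi; rewrite mxE sum3 mxE.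
  transitivity ((i == o0)%:R%:P + (i == o1)%:R%:P * 'X + (i == o2)%:R%:P * 'X^2 : {poly K}).
    by rewrite -!PPi' /w !polyCD !polyCM; ring.
  by clear PPi'; elim/ord3P: i; rewrite /= ?mulr1n ?mulr0n ?polyC0 ?polyC1; ring.
rewrite vE !psiD !psiM !psiC psix psiy -Pw.
have e1 : (P i o0)%:P = (P i o0)%:P * (w o0 * d') - (P i o0)%:P * r * 'X^m.
  by rewrite [w o0 * d']dd'; ring.
by rewrite {1}e1; ring.
Qed.

Lemma psi_G : 'X^m %| psi G.
Proof.
have [a aE] := psi_v o0; have [b bE] := psi_v o1; have [f fE] := psi_v o2.
rewrite G_E psiM psiB psiXn psiM [psi D]aE [psi N]bE [psi Q]fE.
apply: dvdp_mull; apply/dvdpP.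
exists (2 * d' * 'X * b + b ^+ 2 * 'X^m - d' * f - a * d' * 'X^2 - a * f * 'X^m).
by rewrite /=; ring.
Qed.

Lemma psi_F : 'X^m %| psi F.
Proof.
have [a aE] := psi_v o0; have [b bE] := psi_v o1; have [f fE] := psi_v o2.
pose x i := d' * 'X^(i : 'I_3).
pose u i := nth 0 [:: a; b; f] (i : 'I_3).
have vi i : psi (v i 0) = x i + u i * 'X^m by elim/ord3P: i.
rewrite /F qeval3; rewrite (_ : psi _ = \sum_i \sum_j (x i * (A i j)%:P * x j +
   (x i * (A i j)%:P * u j + u i * (A i j)%:P * x j +
    u i * (A i j)%:P * u j * 'X^m) * 'X^m)); last first.
  rewrite psi_sum; apply: eq_bigr => i _; rewrite psi_sum; apply: eq_bigr => j _.
  by rewrite !psiM [map_mx _ _ i j]mxE psiC !vi; ring.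
under eq_bigr do rewrite big_split /= -mulr_suml.
rewrite big_split /= -mulr_suml; apply: dvdp_add; last exact: dvdp_mulIr.
rewrite (_ : \sum_i _ = d' ^+ 2 * conic_restr A); last first.
  rewrite /conic_restr qeval3 mulr_sumr; apply: eq_bigr => i _.
  by rewrite mulr_sumr; apply: eq_bigr => j _; rewrite !mxE /x; ring.
by rewrite phiE mulrCA; apply: dvdp_mulIl.
Qed.

(** The substitution [psi] is defined on polynomials only, so [at_s eta] is handled through a
    numerator: its image is [eta] modulo ['X^m], up to a power of [d']. *)
Lemma at_s_psi eta : exists h n, [/\ at_s eta = iota h / iota D ^+ n,
  ev0 h = eta.[0] * kap ^+ n & 'X^m %| psi h - d' ^+ n * eta].
Proof.
elim/poly_ind: eta => [|eta a [h [n [E E0 dv]]]].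
  exists 0, 0%N; rewrite /at_s !rmorph0 !horner0 mul0r /ev0 !horner0 mul0r.
  by split=> //; rewrite [psi 0]rmorph0 mulr0 subr0 dvdp0.
exists (h * N + const2 a * D ^+ n.+1), n.+1; split.
- rewrite at_sD at_sM E at_sC at_sX /s iotaD !iotaM iotaXn mulrDl mulfK.
    by rewrite exprS invfM; congr (_ + _); ring.
  by rewrite expf_neq0 // iD0.
- rewrite ev0D !ev0M ev0X D0 ev0C [ev0 N]v0 /=.
  by rewrite !hornerE ?mulr0 ?add0r ?mulr1n.
have [b bE] := psi_v o0; have [f fE] := psi_v o1.
rewrite psiD !psiM psiC psiXn [psi D]bE [psi N]fE.
rewrite (_ : _ - _ = (psi h - d' ^+ n * eta) * (d' * 'X^o1 + f * 'X^m) +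
  d' ^+ n * eta * f * 'X^m +
  a%:P * ((d' * 'X^o0 + b * 'X^m) ^+ n.+1 - d' ^+ n.+1)); last first.
  rewrite [d' ^+ n.+1]exprSr; move: ((_ + _) ^+ n.+1) => y.
  by rewrite /= expr1; ring.
apply: dvdp_add; first by apply: dvdp_add; [exact: dvdp_mulr|exact: dvdp_mulIr].
apply: dvdp_mull; rewrite subrXX; apply: dvdp_mulr.
by rewrite /= expr0 mulr1 addrC addKr dvdp_mulIr.
Qed.

Lemma psi0 h : (w o1 * d').[0] = 0 -> (w o2 * d').[0] = 0 -> (psi h).[0] = ev0 h.
Proof.
move=> w1 w2; elim/poly_ind: h => [|h p IH]; first by rewrite /ev0 /psi /= /horner_eval rmorph0 !horner0.
rewrite psiD psiM psiy hornerD hornerM w2 mulr0 add0r ev0D ev0M.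
rewrite [ev0 'X]/ev0 hornerX horner0 mulr0 add0r.
by rewrite /psi /= /horner_eval map_polyC hornerC /= horner_comp w1 /ev0 hornerC.
Qed.

Lemma w0 i : (w i).[0] = Pi i o0.
Proof. by rewrite /w !hornerE /= ?expr0n ?mulr0 ?addr0. Qed.

(** Denominators are cleared and [psi] is applied. As [psi F] and [psi G] are divisible by ['X^m],
    so is [gam] times a polynomial prime to ['X], and the degree of [gam] is too small. This is the
    independence of [1, s, ..., s^(m-1)]. *)
Lemma ideal_at_s_eq0 (gam : {poly K}) : (size gam <= m)%N -> I (at_s gam) -> gam = 0.
Proof.
move=> sg [z1 [z2 [/loc_ringP[h1 [u1 [u10 ->]]] /loc_ringP[h2 [u2 [u20 ->]]]]]].
have [h [n [-> h0 dv]]] := at_s_psi gam => E.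
have {}E : u1 * u2 * h = D ^+ n * (h1 * u2 * F + h2 * u1 * G).
  apply/eqP; rewrite -iota_eq !(iotaM, iotaD) iotaXn; apply/eqP.
  have -> : iota h = iota D ^+ n * (iota h / iota D ^+ n).
    by rewrite mulrCA divff ?mulr1 // expf_neq0 // iD0.
  by rewrite E; apply: fraction_id4; apply: ev0_neq0.
have w1 : (w o1 * d').[0] = 0 by rewrite hornerM w0 Picol /= mul0r.
have w2 : (w o2 * d').[0] = 0 by rewrite hornerM w0 Picol /= mul0r.
have d0 : d'.[0] != 0.
  have : (d * d').[0] = 1.
    by rewrite dd' hornerD hornerM hornerXn expr0n gtn_eqF // mulr0 addr0 hornerE.
  rewrite hornerM => h'; apply/eqP => d0.
  by move: h'; rewrite d0 mulr0 => /esym/eqP; rewrite oner_eq0.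
have cop : coprimep ('X^m) (psi (u1 * u2) * d' ^+ n).
  rewrite coprimep_sym; apply: coprimep_Xn.
  by rewrite hornerM horner_exp psi0 // ev0M !mulf_neq0 // expf_neq0.
have : 'X^m %| psi (u1 * u2) * d' ^+ n * gam.
  rewrite -mulrA (_ : _ * gam = psi h - (psi h - d' ^+ n * gam)); last by rewrite opprB addrC subrK.
  rewrite mulrBr; apply: dvdp_sub; last exact: dvdp_mull.
  rewrite -psiM E psiM psiD !psiM; apply: dvdp_mull; apply: dvdp_add; apply: dvdp_mull.
    exact: psi_F.
  exact: psi_G.
rewrite Gauss_dvdpr // => dg; apply/eqP; apply: contraTT sg => g0.
by rewrite -ltnNge; have := dvdp_leq g0 dg; rewrite size_polyXn.
Qed.

Lemma at_s_rVpoly (a : 'rV[K]_m) :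
  at_s (rVpoly a) = \sum_(i < m) iota (const2 (a 0 i)) * s ^+ i.
Proof.
rewrite /rVpoly poly_def /at_s rmorph_sum horner_sum; apply: eq_bigr => i _.
by rewrite valK -mul_polyC -/(at_s _) at_sM at_sC at_sXn.
Qed.

Lemma order_loc_dim : loc_dim F G m.
Proof.
exists (fun i => s ^+ i); split=> [i|z Oz].
  by rewrite -at_sXn; apply: loc_ring_at_s.
have [a [_ [eta _ zeta]]] := near_s_local Oz.
have dE : eta - eta %% 'X^m = eta %/ 'X^m * 'X^m by rewrite {1}(divp_eq eta 'X^m) addrK.
have sub_s (b : 'rV[K]_m) : z - \sum_(i < m) iota (const2 (b 0 i)) * s ^+ i
    = (z - at_s eta) + at_s (eta - rVpoly b).
  by rewrite at_sD at_sN at_s_rVpoly addrA subrK.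
exists (poly_rV (eta %% 'X^m)); split=> [|b].
  rewrite sub_s; apply: loc_idealD => //.
  rewrite poly_rV_K; last first.
    exact: size_modp_Xn.
  rewrite dE at_sM at_sXn.
  by apply: loc_idealM; [exact: loc_ring_at_s|exact: sm_ideal].
rewrite sub_s => bI; apply: (can_inj (@rVpolyK _ _)).
rewrite poly_rV_K; last first.
  exact: size_modp_Xn.
have eb : I (at_s (eta %% 'X^m - rVpoly b)).
  have -> : eta %% 'X^m - rVpoly b = (eta - rVpoly b) - eta %/ 'X^m * 'X^m.
    by rewrite -dE; ring.
  rewrite at_sD at_sN [at_s (_ * 'X^m)]at_sM at_sXn; apply: loc_idealD.
    have -> : at_s (eta - rVpoly b) =
      (z - at_s eta + at_s (eta - rVpoly b)) - (z - at_s eta) by rewrite addrAC subrr add0r.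
    by apply: loc_idealD => //; apply: loc_idealN.
  by apply: loc_idealN; apply: loc_idealM; [exact: loc_ring_at_s|exact: sm_ideal].
apply/eqP; rewrite -subr_eq0; apply/eqP; apply: ideal_at_s_eq0 eb.
rewrite (leq_trans (size_polyD _ _)) // geq_max size_polyN size_poly andbT.
exact: size_modp_Xn.
Qed.

End Order.

(* A frame S adapted to the conic B at a point p parametrizes B as S (1, s, s^2). *)
Definition adapted (S B : 'M[K]_3) (c : K) : Prop :=
  [/\ S \in unitmx, c != 0 & S^T *m B *m S = c *: conic_std K].

(** The chart [T] and the adapted frame [S] have the same origin, so [P = S^-1 T] has first column
    [(kap, 0, 0)]. This makes the denominator of the parametrization invertible modulo ['X^m], and
    Bezout provides [d']. *)
Lemma affine_local_dim (T S A B : 'M[K]_3) (kap c : K) m rho :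
  2 != 0 :> K -> T \in unitmx -> adapted S B c ->
  col o0 T = kap *: col o0 S -> (0 < m)%N ->
  conic_restr (S^T *m A *m S) = 'X^m * rho -> rho.[0] != 0 ->
  loc_dim (affine_equation T A) (affine_equation T B) m.
Proof.
move=> n2 uT [uS c0 SB] TS m0 phiE rho0.
pose P := invmx S *m T; pose Pi := invmx T *m S.
have PiP : Pi *m P = 1%:M by rewrite /Pi /P mulmxA mulmxK // mulVmx.
have PPi : P *m Pi = 1%:M by rewrite /Pi /P mulmxA mulmxK // mulVmx.
have Pcol i : P i o0 = kap *+ (i == o0).
  transitivity ((invmx S *m col o0 T) i 0); first by rewrite colE mulmxA -colE [RHS]mxE.
  rewrite TS -scalemxAr colE mulmxA mulVmx // mul1mx !mxE eqxx andbT.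
  by case: (i == o0); rewrite ?mulr1 ?mulr0.
have kap0 : kap != 0.
  apply/eqP => k0; have /eqP := oner_eq0 K; apply.
  have := congr1 (fun M : 'M[K]_3 => M o0 o0) PiP.
  by rewrite mxE sum3 !Pcol k0 !mul0rn !mulr0 !addr0 mxE => /esym.
have c2 : c * 2 != 0 by rewrite mulf_neq0.
have cop : coprimep ((Pi o0 o0)%:P + (Pi o0 o1)%:P * 'X + (Pi o0 o2)%:P * 'X^2) ('X^m).
  apply: coprimep_Xn; rewrite !hornerE /= ?expr0n /= ?mulr0 ?addr0.
  by rewrite (Picol PiP kap0 Pcol) mulr1n invr_eq0.
have /Bezout_eq1_coprimepP[[u r] /= uw] := cop.
have dd' : ((Pi o0 o0)%:P + (Pi o0 o1)%:P * 'X + (Pi o0 o2)%:P * 'X^2) * u =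
  1 + - r * 'X^m by rewrite -uw; ring.
have affE (H : 'M[K]_3) : affine_equation T H =
   qeval (map_mx (@const2 K) (S^T *m H *m S))
     (map_mx (@const2 K) P *m \col_(i < 3) [:: 1; 'X%:P; 'X]`_i).
  rewrite /affine_equation /qeval.
  have -> : T = S *m P by rewrite /P mulKVmx.
  rewrite !(map_mxM (polyC \o polyC)) !trmx_mul !mulmxA.
  by rewrite -(map_trmx (polyC \o polyC)).
rewrite !affE SB.
exact: (order_loc_dim c2 PiP PPi kap0 Pcol phiE rho0 m0 dd').
Qed.
End LocalIntersection.

Definition iotaF (K : fieldType) : {rmorphism {poly {poly K}} -> {fraction {poly {poly K}}}} :=
  (@FracField.tofrac {poly {poly K}}).

Lemma iotaF_inj (K : fieldType) : injective (@iotaF K).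
Proof. by move=> x y /eqP; rewrite tofrac_eq => /eqP. Qed.

Lemma affine_mult (K : fieldType) (T S A B : 'M[K]_3) (kap c : K) m rho :
  2 != 0 :> K -> T \in unitmx -> adapted S B c ->
  col o0 T = kap *: col o0 S -> (0 < m)%N ->
  conic_restr (S^T *m A *m S) = 'X^m * rho -> rho.[0] != 0 ->
  local_dim (affine_equation T A) (affine_equation T B) m.
Proof.
move=> h1 h2 h3 h4 h5 h6 h7.
exact (affine_local_dim (@iotaF_inj K) h1 h2 h3 h4 h5 h6 h7).
Qed.

Lemma local_dim_uniq (K : fieldType) (F G : {poly {poly K}}) m n :
  local_dim F G m -> local_dim F G n -> m = n.
Proof. move=> h1 h2; exact (loc_dim_unique (@iotaF_inj K) h1 h2). Qed.

Section Representatives.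
Variables (K : fieldType) (V : lmodType K) (D : set V).

Lemma represents_hc (p : projectivization D) : represents (homogeneous_coords p) p.
Proof. by exists (repr p) => //; rewrite reprK. Qed.

Lemma hcP (p : projectivization D) : D (homogeneous_coords p).
Proof. exact: set_valP. Qed.

Lemma pi_eqP (u v : D) : \pi_(projectivization D)%qT u = \pi_(projectivization D)%qT v <->
  exists2 c : K, c != 0 & set_val u = c *: set_val v.
Proof.
split=> [/eqmodP/asboolP//|uv].
by apply/eqmodP/asboolP.
Qed.

Lemma represents_uniq (v w : V) (p : projectivization D) :
  represents v p -> represents w p -> exists2 c : K, c != 0 & v = c *: w.
Proof. by move=> [a <- ->] [b <- /pi_eqP]. Qed.

Lemma represents_hc_eq (v : V) (p : projectivization D) :
  represents v p -> exists2 c : K, c != 0 & v = c *: homogeneous_coords p.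
Proof. by move=> vp; apply: represents_uniq vp (represents_hc p). Qed.

Lemma represents_eq (v : V) (p q : projectivization D) :
  represents v p -> represents v q -> p = q.
Proof.
move=> [a <- ->] [b ab ->]; apply/pi_eqP; exists 1; rewrite ?oner_neq0 //.
by rewrite scale1r ab.
Qed.

Lemma represents_ex (v : V) : D v -> exists p : projectivization D, represents v p.
Proof.
move=> Dv; exists (\pi_(projectivization D)%qT (SigSub (mem_set Dv))).
by exists (SigSub (mem_set Dv)).
Qed.

Lemma representsZ (c : K) (v : V) (p : projectivization D) :
  (forall v, D v -> D (c *: v)) -> c != 0 -> represents v p -> represents (c *: v) p.
Proof.
move=> Dc c0 vp; have [u uv pu] := vp.
have Dv : D (c *: v) by apply: Dc; rewrite -uv; apply: set_valP.
exists (SigSub (mem_set Dv)) => //; rewrite pu; apply/pi_eqP; exists c^-1.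
  by rewrite invr_eq0.
by rewrite [in RHS]/set_val /= scalerA mulVf // scale1r.
Qed.
End Representatives.

(** * Bilinear forms and frames adapted to a point of a smooth conic *)

Section Bilinear.
Variable K : fieldType.
Implicit Types (B : 'M[K]_3) (x y z : 'cV[K]_3).

Definition bil B x y : K := (x^T *m B *m y) 0 0.

Lemma bilDl B x y z : bil B (x + y) z = bil B x z + bil B y z.
Proof. by rewrite /bil linearD /= !mulmxDl mxE. Qed.
Lemma bilDr B x y z : bil B z (x + y) = bil B z x + bil B z y.
Proof. by rewrite /bil mulmxDr mxE. Qed.
Lemma bilZl B a x y : bil B (a *: x) y = a * bil B x y.
Proof. by rewrite /bil linearZ /= -!scalemxAl mxE. Qed.
Lemma bilZr B a x y : bil B x (a *: y) = a * bil B x y.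
Proof. by rewrite /bil -scalemxAr mxE. Qed.
Lemma bilC B x y : B^T = B -> bil B x y = bil B y x.
Proof.
move=> sB; rewrite /bil -[in LHS](trmxK (_ *m y)) mxE !trmx_mul trmxK sB.
by rewrite mulmxA.
Qed.
Lemma bilE B x y : bil B x y = \sum_i x i 0 * (B *m y) i 0.
Proof. by rewrite /bil -mulmxA mxE; apply: eq_bigr => i _; rewrite mxE. Qed.
Lemma qeval_bil B x : qeval B x = bil B x x. Proof. by []. Qed.

Lemma congr_entry B (S : 'M[K]_3) i j : (S^T *m B *m S) i j = bil B (col i S) (col j S).
Proof.
rewrite /bil tr_col -row_mul mxE [RHS]mxE; apply: eq_bigr => k _.
by rewrite !mxE.
Qed.

End Bilinear.

Section Frames.
Variable K : fieldType.
Hypothesis two : 2 != 0 :> K.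
Implicit Types (A B S : 'M[K]_3) (u v w : 'cV[K]_3).

Definition col3 u v w : 'M[K]_3 := \matrix_(i, j) (nth 0 [:: u; v; w] j) i 0.

Lemma col_col3 u v w :
  [/\ col o0 (col3 u v w) = u, col o1 (col3 u v w) = v & col o2 (col3 u v w) = w].
Proof. by split; apply/matrixP => i j; rewrite !mxE ord1. Qed.

Lemma mul_col3 u v w (c : 'cV[K]_3) :
  col3 u v w *m c = c o0 0 *: u + c o1 0 *: v + c o2 0 *: w.
Proof. by apply/matrixP => i j; rewrite !mxE sum3 !mxE /= !ord1 ![_ * c _ _]mulrC. Qed.

Lemma unit_of_ker n (A : 'M[K]_n) :
  (forall c : 'cV[K]_n, A *m c = 0 -> c = 0) -> A \in unitmx.
Proof.
move=> h; rewrite -unitmx_tr -row_free_unit; apply: contrapT => /negP.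
rewrite -kermx_eq0 => /rowV0Pn[x /sub_kermxP xA /eqP]; apply.
have : A *m x^T = 0 by rewrite -[A]trmxK -trmx_mul xA trmx0.
by move/h => x0; rewrite -[x]trmxK x0 trmx0.
Qed.

Lemma ker_of_det n (A : 'M[K]_n) : \det A = 0 -> exists2 x : 'cV[K]_n, x != 0 & A *m x = 0.
Proof.
move=> /eqP A0; have : A^T \notin unitmx by rewrite unitmx_tr unitmxE unitfE A0.
rewrite -row_free_unit -kermx_eq0 => /rowV0Pn[x /sub_kermxP xA x0].
exists x^T; first by apply: contra x0 => /eqP h; rewrite -[x]trmxK h trmx0.
by rewrite -[A]trmxK -trmx_mul xA trmx0.
Qed.

Lemma ker_two (a b : 'cV[K]_3) :
  exists2 u : 'cV[K]_3, u != 0 & (a^T *m u = 0) /\ (b^T *m u = 0).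
Proof.
pose A := row_mx a b.
have : kermx A != 0.
  rewrite kermx_eq0 -row_leq_rank -ltnNge.
  by apply: leq_ltn_trans (rank_leq_col _) _.
move=> /rowV0Pn[x /sub_kermxP xA x0].
exists x^T; first by apply: contra x0 => /eqP h; rewrite -[x]trmxK h trmx0.
move: xA; rewrite /A mul_mx_row => /eqP; rewrite row_mx_eq0 => /andP[/eqP xa /eqP xb].
by split; rewrite -trmx_mul ?xa ?xb trmx0.
Qed.

Lemma conic_std_mul (c : 'cV[K]_3) :
  conic_std K *m c = \col_i [:: - c o2 0; 2 * c o1 0; - c o0 0]`_i.
Proof.
apply/colP; elim/ord3P; rewrite !mxE sum3 !mxE /= ?mulN1r ?mul0r ?addr0 ?add0r //.
Qed.

Lemma conic_std_unit : conic_std K \in unitmx.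
Proof.
apply: unit_of_ker => c; rewrite conic_std_mul => /colP E; apply/colP; elim/ord3P; rewrite mxE.
- by have := E o2; rewrite !mxE /= => /eqP; rewrite oppr_eq0 => /eqP.
- have := E o1; rewrite !mxE /= => /eqP; rewrite mulf_eq0 (negbTE two) => /eqP //.
- by have := E o0; rewrite !mxE /= => /eqP; rewrite oppr_eq0 => /eqP.
Qed.

(** The vector [v] is completed to a hyperbolic pair, and a vector [u] orthogonal to the pair
    supplies the middle column. *)
Lemma isotropic_frame B v : B^T = B -> B \in unitmx -> v != 0 -> bil B v v = 0 ->
  exists S c, adapted S B c /\ col o0 S = v.
Proof.
move=> sB uB v0 vv.
have [w vw] : exists w, bil B v w != 0.
  apply: contrapT => /forallNP h; move/eqP: v0; apply.
  have Bv : v^T *m B = 0.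
    apply/rowP => i; have /negP := h (delta_mx i 0); rewrite negbK => /eqP.
    by rewrite /bil -colE !mxE.
  by rewrite -[v]trmxK -[v^T](mulmxK uB) Bv mul0mx trmx0.
(* The correction along [v] makes [w'] isotropic without changing its product with [v]. *)
pose w' := w - (bil B w w / (2 * bil B v w)) *: v.
have vw' : bil B v w' = bil B v w by rewrite /w' bilDr -scaleNr bilZr vv mulr0 addr0.
have ww' : bil B w' w' = 0.
  rewrite /w' -scaleNr !(bilDl, bilDr, bilZl, bilZr) vv (bilC w v sB).
  by move: vw; move: (bil B v w) (bil B w w) => b a b0; field; rewrite two b0.
have [u u0 [uv uw]] := ker_two (B *m v) (B *m w').
have {}uv : bil B v u = 0 by rewrite /bil -{1}sB -trmx_mul uv mxE.
have {}uw : bil B w' u = 0 by rewrite /bil -{1}sB -trmx_mul uw mxE.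
pose b := bil B v w; pose g := bil B u u.
(* With this scale the product of the outer columns is [- g / 2] while the middle column has square
   [g]: the Gram matrix is [g / 2] times [conic_std]. *)
pose k := - (g / 2) / b.
pose S := col3 v u (k *: w').
have [S0 S1 S2] := col_col3 v u (k *: w').
have SBS : S^T *m B *m S = \matrix_(i, j)
  (nth [::] [:: [:: 0; 0; k * b]; [:: 0; g; 0]; [:: k * b; 0; 0]] i)`_j.
  apply/matrixP => i j; rewrite congr_entry mxE.
  elim/ord3P: i; elim/ord3P: j; rewrite ?S0 ?S1 ?S2 /= ?bilZl ?bilZr ?vv ?ww' ?vw' ?mulr0 //.
    by rewrite bilC.
  - by rewrite bilC // uw mulr0.
  - by rewrite bilC // vw'.
  - by rewrite uw mulr0.
have uS1 : col3 v u w' \in unitmx.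
  apply: unit_of_ker => c; rewrite mul_col3 => E.
  have c2 : c o2 0 = 0.
    have := congr1 (bil B v) E; rewrite !bilDr !bilZr vv uv vw' !mulr0 !add0r.
    rewrite [RHS]/bil mulmx0 mxE => /eqP; rewrite mulf_eq0 (negbTE vw) orbF.
    by move/eqP.
  have c0 : c o0 0 = 0.
    have := congr1 (bil B w') E; rewrite !bilDr !bilZr ww' uw bilC // vw' !mulr0 !addr0.
    rewrite [RHS]/bil mulmx0 mxE => /eqP; rewrite mulf_eq0 (negbTE vw) orbF.
    by move/eqP.
  move: E; rewrite c0 c2 !scale0r add0r addr0 => /eqP; rewrite scaler_eq0 (negbTE u0) orbF.
  by move=> /eqP c1; apply/colP; elim/ord3P; rewrite ?c0 ?c1 ?c2 mxE.
have g0 : g != 0.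
  apply: contraNN u0 => /eqP g0.
  have uS : u^T *m B *m col3 v u w' = 0.
    have [s0 s1 s2] := col_col3 v u w'.
    apply/rowP => j; rewrite [RHS]mxE.
    have -> : (u^T *m B *m col3 v u w') 0 j = bil B u (col j (col3 v u w')).
      by rewrite /bil colE mulmxA -colE [RHS]mxE.
    elim/ord3P: j; rewrite ?s0 ?s1 ?s2 //; first by rewrite bilC.
    by rewrite bilC.
  by rewrite -[u]trmxK -[u^T](mulmxK uB) -[u^T *m B](mulmxK uS1) uS !mul0mx trmx0.
have SBS' : S^T *m B *m S = (g / 2) *: conic_std K.
  rewrite SBS /k; apply/matrixP => i j; rewrite !mxE.
  elim/ord3P: i; elim/ord3P: j; rewrite /= ?mulr0 // ?mulrN1 ?divfK //; field.
exists S, (g / 2); split=> //.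
have g20 : g / 2 != 0 by rewrite mulf_neq0 // invr_eq0.
split=> //.
have : S^T *m B *m S \in unitmx by rewrite SBS' unitmxZ ?conic_std_unit // unitfE.
by rewrite !unitmx_mul => /andP[].
Qed.
End Frames.

(** * Multiplicities and the Segre symbol *)

Section Structure.
Variable K : fieldType.
Hypotheses (two : 2 != 0 :> K) (three : 3 != 0 :> K).
Implicit Types (M U S : 'M[K]_3).

Definition trl M : 'M[K]_3 := M - (\tr M / 3)%:M.
Definition tr2 M : K := \tr (trl M *m trl M).
Definition tr3 M : K := \tr (trl M *m trl M *m trl M).
(* When M has eigenvalues l, l, l + h, this is h. *)
Definition gap M : K := 3 * tr3 M / tr2 M.
(** With eigenvalues [l, l, l + h], [pdouble M] is [M - l] and [psimple M] is [M - l - h]. Built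
    from traces, they are rational in the entries of [M]: they vary continuously, follow conjugation
    and ignore the addition of a scalar to [M]. *)
Definition pdouble M : 'M[K]_3 := trl M + (gap M / 3)%:M.
Definition psimple M : 'M[K]_3 := trl M - (2 * gap M / 3)%:M.

(* The Segre symbols [2,1], [(1,1),1], [3] and [(2,1)], in this order. *)
Definition segre21 M := [/\ gap M != 0, pdouble M *m pdouble M *m psimple M = 0 &
  pdouble M *m psimple M <> 0].
Definition segre111 M := gap M != 0 /\ pdouble M *m psimple M = 0.
Definition segre3 M := trl M *m trl M *m trl M = 0 /\ trl M *m trl M <> 0.
Definition segre_21 M := trl M *m trl M = 0 /\ trl M <> 0.

(* B^-1 A is conjugate to l + tangent_mx a b d in a frame adapted to a common
   tangent point. *)
Definition tangent_mx (a b d : K) : 'M[K]_3 :=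
  \matrix_(i, j) (nth [::] [:: [:: 0; - b; - d]; [:: 0; a / 2; b / 2]; [:: 0; 0; 0]] i)`_j.

Definition tangent_form (a b d : K) : 'M[K]_3 :=
  \matrix_(i, j) (nth [::] [:: [:: 0; 0; 0]; [:: 0; a; b]; [:: 0; b; d]] i)`_j.

Lemma std_tangent a b d : conic_std K *m tangent_mx a b d = tangent_form a b d.
Proof.
apply/matrixP => i j; rewrite !mxE sum3 !mxE.
by elim/ord3P: i; elim/ord3P: j; rewrite /=; field.
Qed.

Lemma trl_conj S M : S \in unitmx -> trl (S *m M *m invmx S) = S *m trl M *m invmx S.
Proof.
move=> uS; rewrite /trl mxtrace_mulC mulmxA mulVmx // mul1mx mulmxBr mulmxBl.
by rewrite mul_mx_scalar -scalemxAl mulmxV // scalemx1.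
Qed.

Lemma trl_addC M a : trl (M + a%:M) = trl M.
Proof.
rewrite /trl mxtraceD mxtrace_scalar (_ : (_ + _) / 3 = \tr M / 3 + a).
  by rewrite raddfD /= opprD addrACA subrr addr0.
by rewrite -mulr_natr; field.
Qed.

Lemma tr2_conj S M : S \in unitmx -> tr2 (S *m M *m invmx S) = tr2 M.
Proof.
move=> uS; rewrite /tr2 trl_conj // !mulmxA mulmxKV // mxtrace_mulC !mulmxA.
by rewrite mulVmx // mul1mx.
Qed.

Lemma tr3_conj S M : S \in unitmx -> tr3 (S *m M *m invmx S) = tr3 M.
Proof.
move=> uS; rewrite /tr3 trl_conj // !mulmxA !mulmxKV // mxtrace_mulC !mulmxA.
by rewrite mulVmx // mul1mx.
Qed.

Lemma pdouble_conj S M : S \in unitmx ->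
  pdouble (S *m M *m invmx S) = S *m pdouble M *m invmx S.
Proof.
move=> uS; rewrite /pdouble /gap tr2_conj // tr3_conj // trl_conj // [in RHS]mulmxDr [in RHS]mulmxDl.
by rewrite mul_mx_scalar -scalemxAl mulmxV // scalemx1.
Qed.

Lemma psimple_conj S M : S \in unitmx ->
  psimple (S *m M *m invmx S) = S *m psimple M *m invmx S.
Proof.
move=> uS; rewrite /psimple /gap tr2_conj // tr3_conj // trl_conj // [in RHS]mulmxBr [in RHS]mulmxBl.
by rewrite mul_mx_scalar -scalemxAl mulmxV // scalemx1.
Qed.

Lemma gap_conj S M : S \in unitmx -> gap (S *m M *m invmx S) = gap M.
Proof. by move=> uS; rewrite /gap tr2_conj // tr3_conj. Qed.

Lemma gap_addC M a : gap (M + a%:M) = gap M.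
Proof. by rewrite /gap /tr3 /tr2 trl_addC. Qed.
Lemma pdouble_addC M a : pdouble (M + a%:M) = pdouble M.
Proof. by rewrite /pdouble trl_addC gap_addC. Qed.
Lemma psimple_addC M a : psimple (M + a%:M) = psimple M.
Proof. by rewrite /psimple trl_addC gap_addC. Qed.

Lemma conj_eq0 S M : S \in unitmx -> S *m M *m invmx S = 0 -> M = 0.
Proof.
move=> uS E; have := congr1 (fun X => invmx S *m X *m S) E.
by rewrite !mulmxA mulmxKV // mulVmx // mul1mx mulmx0 mul0mx.
Qed.

Section Tangent.
Variables (a b d : K).
Local Notation T := (tangent_mx a b d).

Lemma trl_tangent : trl T =
  \matrix_(i, j) (nth [::] [:: [:: - (a / 6); - b; - d]; [:: 0; a / 3; b / 2]; [:: 0; 0; - (a / 6)]] i)`_j.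
Proof.
have six : 6 != 0 :> K by rewrite (natrM K 2 3) mulf_neq0.
apply/matrixP => i j; rewrite /trl !mxE /mxtrace sum3 !mxE /=.
by elim/ord3P: i; elim/ord3P: j; rewrite /= ?mulr1n ?mulr0n; field; rewrite ?two ?three ?six.
Qed.

Lemma tr2_tangent : tr2 T = a ^+ 2 / 6.
Proof.
have six : 6 != 0 :> K by rewrite (natrM K 2 3) mulf_neq0.
rewrite /tr2 trl_tangent /mxtrace sum3 !mxE !sum3 !mxE /=.
by field; rewrite ?two ?three ?six.
Qed.

Lemma tr3_tangent : tr3 T = a ^+ 3 / 36.
Proof.
have six : 6 != 0 :> K by rewrite (natrM K 2 3) mulf_neq0.
have h36 : 36 != 0 :> K by rewrite (natrM K 6 6) mulf_neq0.
rewrite /tr3 -mulmxA trl_tangent /mxtrace sum3 !mxE !sum3 !mxE !sum3 !mxE /=.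
by field; rewrite ?two ?three ?six ?h36.
Qed.

Lemma gap_tangent : a != 0 -> gap T = a / 2.
Proof.
have six : 6 != 0 :> K by rewrite (natrM K 2 3) mulf_neq0.
have h36 : 36 != 0 :> K by rewrite (natrM K 6 6) mulf_neq0.
move=> a0; rewrite /gap tr2_tangent tr3_tangent; field.
by rewrite ?two ?six ?h36 ?a0.
Qed.

Lemma pdouble_tangent : a != 0 -> pdouble T = T.
Proof.
have six : 6 != 0 :> K by rewrite (natrM K 2 3) mulf_neq0.
move=> a0; rewrite /pdouble gap_tangent // trl_tangent; apply/matrixP => i j; rewrite !mxE.
by elim/ord3P: i; elim/ord3P: j; rewrite /= ?mulr1n ?mulr0n; field; rewrite ?two ?three ?six.
Qed.

Lemma psimple_tangent : a != 0 -> psimple T = T - (a / 2)%:M.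
Proof.
have six : 6 != 0 :> K by rewrite (natrM K 2 3) mulf_neq0.
move=> a0; rewrite /psimple gap_tangent // trl_tangent; apply/matrixP => i j; rewrite !mxE.
by elim/ord3P: i; elim/ord3P: j; rewrite /= ?mulr1n ?mulr0n; field; rewrite ?two ?three ?six.
Qed.

(** Up to a factor [-4], [a d - b^2] is the discriminant of [a + 2 b X + d X^2], whose roots are the
    two remaining intersection points. They coincide exactly when this product vanishes. *)
Lemma tangent_mul : T *m (T - (a / 2)%:M) = ((a * d - b ^+ 2) / 2) *: delta_mx o0 o2.
Proof.
apply/matrixP => i j; rewrite !mxE !sum3 !mxE.
by elim/ord3P: i; elim/ord3P: j; rewrite /= ?mulr1n ?mulr0n; field.
Qed.

Lemma tangent_delta : T *m delta_mx o0 o2 = 0.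
Proof.
apply/matrixP => i j; rewrite !mxE !sum3 !mxE.
by elim/ord3P: i; elim/ord3P: j; rewrite /= ?mulr1n ?mulr0n; field.
Qed.

Lemma tangent_segre2 : a != 0 ->
  [/\ gap T != 0, pdouble T *m pdouble T *m psimple T = 0 &
     (pdouble T *m psimple T = 0 <-> a * d = b ^+ 2)].
Proof.
have six : 6 != 0 :> K by rewrite (natrM K 2 3) mulf_neq0.
move=> a0; rewrite pdouble_tangent // psimple_tangent // gap_tangent //; split.
- by rewrite mulf_neq0 // invr_eq0.
- by rewrite -mulmxA tangent_mul -scalemxAr tangent_delta scaler0.
rewrite tangent_mul; split=> [/matrixP/(_ o0 o2)|->].
  rewrite !mxE /= mulr1 => /eqP; rewrite mulf_eq0 invr_eq0 (negbTE two) orbF subr_eq0.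
  by move/eqP.
by rewrite subrr mul0r scale0r.
Qed.

Lemma tangent_segre3 : a = 0 ->
  [/\ trl T *m trl T *m trl T = 0, (trl T *m trl T = 0 <-> b = 0) &
      trl T = 0 <-> b = 0 /\ d = 0].
Proof.
move=> a0.
have TT : trl T *m trl T = (- (b ^+ 2 / 2)) *: delta_mx o0 o2.
  rewrite trl_tangent a0; apply/matrixP => i j; rewrite !mxE !sum3 !mxE.
  by elim/ord3P: i; elim/ord3P: j; rewrite /= ?mulr1n ?mulr0n ?mul0r ?oppr0; field.
split.
- rewrite TT -scalemxAl trl_tangent a0; apply/matrixP => i j; rewrite !mxE sum3 !mxE.
  by elim/ord3P: i; elim/ord3P: j; rewrite /= ?mul0r ?oppr0; ring.
- rewrite TT; split=> [/matrixP/(_ o0 o2)|->]; last by rewrite expr0n mul0r oppr0 scale0r.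
  rewrite !mxE /= mulr1 => /eqP; rewrite oppr_eq0 mulf_eq0 invr_eq0 (negbTE two) orbF.
  by rewrite expf_eq0 => /eqP.
rewrite trl_tangent a0; split=> [/matrixP h|[-> ->]].
  have := h o0 o1; have := h o0 o2; rewrite !mxE /= => /eqP; rewrite oppr_eq0 => /eqP ->.
  by move=> /eqP; rewrite oppr_eq0 => /eqP ->.
apply/matrixP => i j; rewrite !mxE.
by elim/ord3P: i; elim/ord3P: j; rewrite /= ?mul0r ?oppr0.
Qed.

End Tangent.
End Structure.

Section Multiplicities.
Variable K : closedFieldType.
Hypotheses (two : 2 != 0 :> K) (three : 3 != 0 :> K).
Variables A B : 'M[K]_3.
Hypotheses (sA : A^T = A) (sB : B^T = B) (uB : B \in unitmx).
Hypothesis AB : forall l, A <> l *: B.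
Implicit Types (v w : 'cV[K]_3) (S T : 'M[K]_3).

Definition common v := [/\ v != 0, bil A v v = 0 & bil B v v = 0].
Definition tangent v := exists l, A *m v = l *: (B *m v).
(** All charts centred at [v] are covered, so that the multiplicity can be compared in whichever
    chart [intersection_mult] provides. *)
Definition has_mult v m := forall T, T \in unitmx -> (exists k, col o0 T = k *: v) ->
  local_dim (affine_equation T A) (affine_equation T B) m.

Lemma conic_restrE (G : 'M[K]_3) : G^T = G -> conic_restr G =
  (G o0 o0)%:P + (2 * G o0 o1)%:P * 'X + (2 * G o0 o2 + G o1 o1)%:P * 'X^2 +
  (2 * G o1 o2)%:P * 'X^3 + (G o2 o2)%:P * 'X^4.
Proof.
move=> sG; have g i j : G i j = G j i by rewrite -[in LHS]sG mxE.
rewrite /conic_restr qeval3 !sum3 !mxE /= (g o1 o0) (g o2 o0) (g o2 o1).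
rewrite !polyCD !polyCM; ring.
Qed.

Lemma has_multP S c m rho v : adapted S B c -> col o0 S = v -> (0 < m)%N ->
  conic_restr (S^T *m A *m S) = 'X^m * rho -> rho.[0] != 0 -> has_mult v m.
Proof.
move=> aS <- m0 h1 h2 T uT [k Tk].
exact: affine_mult aS Tk m0 h1 h2.
Qed.

Lemma common_frame v : common v -> exists S c, adapted S B c /\ col o0 S = v.
Proof. by move=> [v0 _ vB]; apply: isotropic_frame. Qed.

Lemma frame_sym S : (S^T *m A *m S)^T = S^T *m A *m S.
Proof. by rewrite !trmx_mul trmxK sA mulmxA. Qed.

Lemma frame00 v S : common v -> col o0 S = v -> (S^T *m A *m S) o0 o0 = 0.
Proof. by move=> [_ vA _] Sv; rewrite congr_entry Sv. Qed.

(** Entry (0,1) of the Gram matrix is half the linear coefficient of the restricted quartic. When it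
    vanishes too, a multiple of [conic_std] absorbs entry (0,2) and only the lower right block is
    left. *)
Lemma frame_tangent v S c : common v -> adapted S B c -> col o0 S = v ->
  (S^T *m A *m S) o0 o1 = 0 -> exists l a b d,
  S^T *m A *m S = c *: (l *: conic_std K + tangent_form a b d).
Proof.
move=> vc aS Sv a01; have a00 := frame00 vc Sv; have [_ c0 _] := aS.
have := frame_sym S; move: (S^T *m A *m S) a01 a00 => G g01 g00 sG.
have g i j : G i j = G j i by rewrite -[in LHS]sG mxE.
exists (- G o0 o2 / c), ((G o1 o1 + 2 * G o0 o2) / c), (G o1 o2 / c), (G o2 o2 / c).
apply/matrixP => i j; rewrite !mxE.
elim/ord3P: i; elim/ord3P: j; rewrite /= ?(g o1 o0) ?(g o2 o0) ?(g o2 o1) ?g00 ?g01;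
by field.
Qed.

Lemma tangent_frame v S c : common v -> adapted S B c -> col o0 S = v ->
  tangent v -> (S^T *m A *m S) o0 o1 = 0.
Proof.
move=> vc [uS c0 SB] Sv [l E]; rewrite -frame_sym mxE congr_entry Sv.
rewrite /bil -mulmxA E -scalemxAr mulmxA mxE.
have := congr1 (fun M : 'M[K]_3 => M o1 o0) SB; rewrite congr_entry Sv /bil => ->.
by rewrite !mxE /= !mulr0.
Qed.

Lemma frame_conj S c l a b d : adapted S B c ->
  S^T *m A *m S = c *: (l *: conic_std K + tangent_form a b d) ->
  invmx B *m A = S *m (tangent_mx a b d + l%:M) *m invmx S.
Proof.
move=> [uS c0 SB] E.
have : S^T *m A *m S = S^T *m B *m S *m (tangent_mx a b d + l%:M).
  rewrite E SB -scalemxAl mulmxDr std_tangent // mul_mx_scalar addrC //.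
rewrite -!mulmxA => /(congr1 (mulmx (invmx S^T))); rewrite !mulKmx ?unitmx_tr // => h.
by rewrite -[A](mulmxK uS) h !mulmxA mulVmx // mul1mx.
Qed.

(** As [conic_std] vanishes on its own parametrization, the quartic is [c X^2 (a + 2 b X + d X^2)]
    and the first non-zero coefficient gives the order. If all three vanish, the two forms are
    proportional. *)
Lemma frame_tangent_mult v S c l a b d : adapted S B c -> col o0 S = v ->
  S^T *m A *m S = c *: (l *: conic_std K + tangent_form a b d) ->
  [/\ a != 0 -> has_mult v 2, a = 0 -> b != 0 -> has_mult v 3 &
     a = 0 -> b = 0 -> d != 0 /\ has_mult v 4].
Proof.
move=> aS Sv E; have [uS c0 SB] := aS.
have phi : conic_restr (S^T *m A *m S) =
    c%:P * ('X^2 * (a%:P + (2 * b)%:P * 'X + d%:P * 'X^2)).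
  rewrite conic_restrE ?frame_sym // E !mxE /=; ring.
split.
- move=> a0; apply: (has_multP (rho := c%:P * (a%:P + (2 * b)%:P * 'X + d%:P * 'X^2)) aS Sv) => //.
    by rewrite phi; ring.
  by rewrite !hornerE ?expr0n /= ?mulr0 ?addr0 mulf_neq0.
- move=> a0 b0; apply: (has_multP (rho := c%:P * ((2 * b)%:P + d%:P * 'X)) aS Sv) => //.
    by rewrite phi a0 polyC0; ring.
  by rewrite !hornerE ?expr0n /= ?mulr0 ?addr0 !mulf_neq0.
move=> a0 b0.
have d0 : d != 0.
  apply/eqP => d0; apply: (AB (l := l)).
  have : S^T *m A *m S = S^T *m (l *: B) *m S.
    rewrite E (_ : tangent_form _ _ _ = 0); last first.
      by apply/matrixP => i j; rewrite !mxE a0 b0 d0; elim/ord3P: i; elim/ord3P: j.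
    by rewrite addr0 scalerA mulrC -scalerA -SB -!scalemxAr -!scalemxAl.
  rewrite -!mulmxA => /(congr1 (mulmx (invmx S^T))); rewrite !mulKmx ?unitmx_tr //.
  by move=> /(congr1 (mulmx^~ (invmx S))); rewrite !mulmxK.
split=> //; apply: (has_multP (rho := c%:P * d%:P) aS Sv) => //.
  by rewrite phi a0 b0 polyC0 mulr0; ring.
by rewrite !hornerE mulf_neq0.
Qed.

Lemma frame_eigen v S c : common v -> adapted S B c -> col o0 S = v ->
  (S^T *m A *m S) o0 o1 = 0 -> tangent v.
Proof.
move=> vc aS Sv a01; have [l [a [b [d E]]]] := frame_tangent vc aS Sv a01.
have ME := frame_conj aS E; exists l; have [uS c0 SB] := aS.
have Mv : invmx B *m A *m v = l *: v.
  rewrite ME -Sv colE -!mulmxA (mulKmx uS) mulmxDl mul_scalar_mx.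
  have -> : tangent_mx a b d *m delta_mx o0 0 = 0 :> 'cV_3.
    apply/colP => i; rewrite !mxE sum3 !mxE.
    by elim/ord3P: i; rewrite /= ?mulr0 ?mul0r ?addr0.
  by rewrite add0r -scalemxAr.
by rewrite scalemxAr -Mv -mulmxA mulKVmx.
Qed.

Lemma transversal_mult v : common v -> ~ tangent v -> has_mult v 1.
Proof.
move=> vc nt; have [S [c [aS Sv]]] := common_frame vc.
have [a01|a01] := eqVneq ((S^T *m A *m S) o0 o1) 0.
  by case: nt; apply: frame_eigen aS Sv a01.
pose G := S^T *m A *m S.
apply: (has_multP (rho := (2 * G o0 o1)%:P + (2 * G o0 o2 + G o1 o1)%:P * 'X +
  (2 * G o1 o2)%:P * 'X^2 + (G o2 o2)%:P * 'X^3) aS Sv) => //.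
  by rewrite conic_restrE ?frame_sym // -/G (frame00 vc Sv) polyC0; ring.
by rewrite !hornerE ?expr0n /= ?mulr0 ?addr0 mulf_neq0.
Qed.

Lemma tangent_cases v : common v -> tangent v ->
  [\/ has_mult v 2 /\ (segre21 (invmx B *m A) \/ segre111 (invmx B *m A)),
      has_mult v 3 /\ segre3 (invmx B *m A) |
      has_mult v 4 /\ segre_21 (invmx B *m A)].
Proof.
move=> vc tv; have [S [c [aS Sv]]] := common_frame vc.
have [l [a [b [d E]]]] := frame_tangent vc aS Sv (tangent_frame vc aS Sv tv).
have [m2 m3 m4] := frame_tangent_mult aS Sv E.
have uS : S \in unitmx by case: aS.
have conjM X Y : (S *m X *m invmx S) *m (S *m Y *m invmx S) = S *m (X *m Y) *m invmx S.
  by rewrite !mulmxA mulmxKV.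
rewrite (frame_conj aS E) /segre21 /segre111 /segre3 /segre_21.
rewrite gap_conj // gap_addC // trl_conj // trl_addC //.
rewrite pdouble_conj // psimple_conj // pdouble_addC // psimple_addC //.
have [a0|a0] := eqVneq a 0.
  have [] := tangent_segre3 two three b d a0.
  move: (trl _) => X h1 h2 h3; rewrite !conjM.
  have [b0|b0] := eqVneq b 0.
    have [d0 h4] := m4 a0 b0; apply: Or33; split=> //.
    split; first by rewrite (h2.2 b0) mulmx0 mul0mx.
    by move=> /(conj_eq0 uS)/h3 [_ /eqP]; rewrite (negbTE d0).
  apply: Or32; split; first exact: m3.
  split; first by rewrite h1 mulmx0 mul0mx.
  by move=> /(conj_eq0 uS)/h2/eqP; rewrite (negbTE b0).
have [] := tangent_segre2 two three b d a0.
move: (gap _) (pdouble _) (psimple _) => t X Y h1 h2 h3; rewrite !conjM.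
apply: Or31; split; first exact: m2.
have [ad|/eqP ad] := eqVneq (a * d) (b ^+ 2); [right|left].
  by split=> //; rewrite h3.2 // mulmx0 mul0mx.
by split=> //; [rewrite h2 mulmx0 mul0mx|move=> /(conj_eq0 uS)/h3].
Qed.

Lemma frame_gap S c l a b d : adapted S B c ->
  S^T *m A *m S = c *: (l *: conic_std K + tangent_form a b d) ->
  gap (invmx B *m A) != 0 -> a != 0 /\
  (pdouble (invmx B *m A) *m psimple (invmx B *m A) = 0 <-> a * d = b ^+ 2).
Proof.
move=> aS E; rewrite (frame_conj aS E); have uS : S \in unitmx by case: aS.
have conjM X Y : (S *m X *m invmx S) *m (S *m Y *m invmx S) = S *m (X *m Y) *m invmx S.
  by rewrite !mulmxA mulmxKV.
rewrite gap_conj // gap_addC //.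
rewrite pdouble_conj // psimple_conj // pdouble_addC // psimple_addC // conjM => t0.
have a0 : a != 0 by apply: contra t0 => /eqP a0; rewrite /gap tr2_tangent // a0 expr0n mul0r invr0 mulr0.
split=> //; have [_ _] := tangent_segre2 two three b d a0.
move: (pdouble _) (psimple _) => X Y h3; rewrite -h3; split=> [/(conj_eq0 uS)//|->].
by rewrite mulmx0 mul0mx.
Qed.

Lemma bil_frame (G S : 'M[K]_3) x y : bil G (S *m x) (S *m y) = bil (S^T *m G *m S) x y.
Proof. by rewrite /bil trmx_mul !mulmxA. Qed.

Lemma bilZm k (G : 'M[K]_3) x y : bil (k *: G) x y = k * bil G x y.
Proof. by rewrite /bil -scalemxAr -scalemxAl mxE. Qed.

Lemma bil_std x : bil (conic_std K) x x = 2 * (x o1 0 ^+ 2 - x o0 0 * x o2 0).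
Proof. by rewrite -qeval_bil qeval3 !sum3 !mxE /=; ring. Qed.

Lemma bil_tangent_form l a b d x : bil (l *: conic_std K + tangent_form a b d) x x =
  l * bil (conic_std K) x x +
  (a * x o1 0 ^+ 2 + 2 * b * x o1 0 * x o2 0 + d * x o2 0 ^+ 2).
Proof. by rewrite bil_std -qeval_bil qeval3 !sum3 !mxE /=; ring. Qed.

Lemma mul_tangent_mx a b d (x : 'cV[K]_3) : tangent_mx a b d *m x =
  \col_i [:: - (b * x o1 0 + d * x o2 0); (a * x o1 0 + b * x o2 0) / 2; 0]`_i.
Proof.
apply/colP => i; rewrite !mxE sum3 !mxE.
by elim/ord3P: i; rewrite /=; field.
Qed.

Lemma frame_common S c l a b d x : adapted S B c ->
  S^T *m A *m S = c *: (l *: conic_std K + tangent_form a b d) ->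
  common (S *m x) <-> [/\ x != 0, x o1 0 ^+ 2 = x o0 0 * x o2 0 &
     a * x o1 0 ^+ 2 + 2 * b * x o1 0 * x o2 0 + d * x o2 0 ^+ 2 = 0].
Proof.
move=> [uS c0 SB] E; rewrite /common !bil_frame E SB !bilZm bil_tangent_form bil_std.
have x0 : (S *m x == 0) = (x == 0).
  apply/eqP/eqP => [h|->]; last by rewrite mulmx0.
  by rewrite -(mulKmx uS x) h mulmx0.
rewrite x0; split=> -[? h1 h2]; split=> //.
- move/eqP: h2; rewrite !mulf_eq0 (negbTE c0) (negbTE two) /= subr_eq0.
  by move/eqP.
- move/eqP: h2; rewrite mulf_eq0 (negbTE c0) /= => /eqP h2.
  by move/eqP: h1; rewrite h2 !mulr0 add0r mulf_eq0 (negbTE c0) /= => /eqP.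
- by rewrite h2 h1 subrr !mulr0 addr0 mulr0.
- by rewrite h1 subrr !mulr0.
Qed.

Lemma frame_tangentP S c l a b d x : adapted S B c ->
  S^T *m A *m S = c *: (l *: conic_std K + tangent_form a b d) ->
  tangent (S *m x) <-> exists mu, tangent_mx a b d *m x = mu *: x.
Proof.
move=> aS E; have ME := frame_conj aS E; have uS : S \in unitmx by case: aS.
have AB' y : A *m y = B *m (invmx B *m A *m y) by rewrite -mulmxA mulKVmx.
split=> -[mu].
  rewrite AB' scalemxAr => /(congr1 (mulmx (invmx B))); rewrite !mulKmx //.
  rewrite ME -!mulmxA mulKmx // scalemxAr => /(congr1 (mulmx (invmx S))).
  rewrite !mulKmx // mulmxDl mul_scalar_mx => h; exists (mu - l).
  by rewrite scalerBl -h addrK.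
move=> h; exists (mu + l); rewrite AB' ME -!mulmxA mulKmx // mulmxDl h.
by rewrite mul_scalar_mx -scalerDl -!scalemxAr.
Qed.

Lemma quadratic_root (d e f : K) : d != 0 -> exists s, d * s ^+ 2 + e * s + f = 0.
Proof.
move=> d0; pose P i := nth 0 [:: - (f / d); - (e / d)] i.
have [s] := @solve_monicpoly K 2 P isT.
rewrite !big_ord_recl big_ord0 /P /= expr0 expr1 mulr1 addr0 => sE; exists s.
by rewrite sE; field.
Qed.

(** The other common points are the roots of [a + 2 b X + d X^2]. Such a root is a point of tangency
    only if it is double, which would give [a d = b^2]. *)
Lemma segre21_transversal v : common v -> tangent v -> segre21 (invmx B *m A) ->
  exists w, common w /\ ~ tangent w.
Proof.
move=> vc tv [t2 _ nps]; have [S [c [aS Sv]]] := common_frame vc.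
have [l [a [b [d E]]]] := frame_tangent vc aS Sv (tangent_frame vc aS Sv tv).
have [a0 ad] := frame_gap aS E t2.
have {nps} nad : a * d != b ^+ 2 by apply/eqP => /ad.
(* For [d = 0] one of the two roots is at infinity: it is the point [(0, 0, 1)]. *)
have [d0|d0] := eqVneq d 0.
  exists (S *m delta_mx o2 0); rewrite (frame_common _ aS E) (frame_tangentP _ aS E); split.
    split; rewrite ?mxE ?d0 /= ?expr0n ?mulr0 ?mul0r ?addr0 //.
    by apply/eqP => /colP/(_ o2); rewrite !mxE /= => /eqP; rewrite oner_eq0.
  move=> [mu]; rewrite mul_tangent_mx => /colP/(_ o1); rewrite !mxE /= !mulr0 mulr1 add0r.
  move=> /eqP; rewrite mulf_eq0 invr_eq0 (negbTE two) orbF => /eqP b0.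
  by move: nad; rewrite d0 b0 expr0n mulr0 eqxx.
have [s sE] := quadratic_root (2 * b) a d0.
have s0 : s != 0.
  by apply: contra a0 => /eqP s0; rewrite -sE s0 expr0n !mulr0 !add0r.
exists (S *m \col_(i < 3) s ^+ i); rewrite (frame_common _ aS E) (frame_tangentP _ aS E); split.
  rewrite !mxE /= expr0 expr1 mul1r; split=> //.
    by apply/eqP => /colP/(_ o0); rewrite !mxE /= => /eqP; rewrite oner_eq0.
  transitivity (s ^+ 2 * (d * s ^+ 2 + 2 * b * s + a)); first by ring.
  by rewrite sE mulr0.
move=> [mu]; rewrite mul_tangent_mx => /colP h.
have mu0 : mu = 0.
  have := h o2; rewrite !mxE /= => /esym/eqP; rewrite mulf_eq0 expf_eq0 (negbTE s0) /= orbF.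
  by move/eqP.
have h1 : a + b * s = 0.
  have := h o1; rewrite !mxE /= mu0 mul0r => /eqP; rewrite mulf_eq0 invr_eq0 (negbTE two) orbF.
  by rewrite expr1 expr2 mulrA -mulrDl mulf_eq0 (negbTE s0) orbF => /eqP.
have h2 : b + d * s = 0.
  have := h o0; rewrite !mxE /= mu0 mul0r => /eqP; rewrite oppr_eq0.
  by rewrite expr1 expr2 mulrA -mulrDl mulf_eq0 (negbTE s0) orbF => /eqP.
move/negP: nad; apply; apply/eqP.
have -> : a = - (b * s) by apply/eqP; rewrite -subr_eq0 opprK h1.
have -> : b = - (d * s) by apply/eqP; rewrite -subr_eq0 opprK h2.
ring.
Qed.

(** When [a d = b^2], [a] times the residual quadratic form is the square of [a x1 + b x2]. A common
    point therefore kills this linear form, and with it the whole image under [tangent_mx]. *)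
Lemma segre111_tangent v w : common v -> tangent v -> segre111 (invmx B *m A) ->
  common w -> tangent w.
Proof.
move=> vc tv [t2 nps]; have [S [c [aS Sv]]] := common_frame vc.
have [l [a [b [d E]]]] := frame_tangent vc aS Sv (tangent_frame vc aS Sv tv).
have [a0 ad] := frame_gap aS E t2.
have {nps} nad := ad.1 nps; have uS : S \in unitmx by case: aS.
rewrite -(mulKVmx uS w); move: (invmx S *m w) => x.
rewrite (frame_common _ aS E) (frame_tangentP _ aS E) => -[x0 h1 h2].
have h3 : a * x o1 0 + b * x o2 0 = 0.
  apply/eqP; rewrite -sqrf_eq0; apply/eqP.
  transitivity (a * (a * x o1 0 ^+ 2 + 2 * b * x o1 0 * x o2 0 + d * x o2 0 ^+ 2) -
    (a * d - b ^+ 2) * x o2 0 ^+ 2); first by ring.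
  by rewrite h2 nad subrr mulr0 mul0r subrr.
have h4 : b * x o1 0 + d * x o2 0 = 0.
  apply: (mulfI a0); rewrite mulr0.
  transitivity (b * (a * x o1 0 + b * x o2 0) + (a * d - b ^+ 2) * x o2 0); first by ring.
  by rewrite h3 nad subrr mulr0 mul0r addr0.
exists 0; rewrite mul_tangent_mx h3 h4 scale0r; apply/colP => i; rewrite !mxE.
by elim/ord3P: i; rewrite /= ?oppr0 ?mul0r.
Qed.

End Multiplicities.

(** * Segre symbols under field extension *)

Section SegreMap.
Variables (K L : fieldType) (f : {rmorphism K -> L}).
Implicit Types M : 'M[K]_3.
Local Notation "M ^f" := (map_mx f M).

Lemma trl_map M : trl M^f = (trl M)^f.
Proof.
by rewrite /trl map_mxD map_mxN map_scalar_mx /= trace_map_mx (fmorph_div f) (rmorph_nat f).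
Qed.

Lemma tr2_map M : tr2 M^f = f (tr2 M).
Proof. by rewrite /tr2 trl_map -map_mxM trace_map_mx. Qed.

Lemma tr3_map M : tr3 M^f = f (tr3 M).
Proof. by rewrite /tr3 trl_map -!map_mxM trace_map_mx. Qed.

Lemma gap_map M : gap M^f = f (gap M).
Proof. by rewrite /gap tr3_map tr2_map (fmorph_div f) (rmorphM f) (rmorph_nat f). Qed.

Lemma pdouble_map M : pdouble M^f = (pdouble M)^f.
Proof.
by rewrite /pdouble gap_map trl_map [RHS]map_mxD map_scalar_mx /= (fmorph_div f (gap M)) (rmorph_nat f).
Qed.

Lemma psimple_map M : psimple M^f = (psimple M)^f.
Proof.
rewrite /psimple gap_map trl_map [RHS]map_mxD map_mxN map_scalar_mx /=.
by rewrite (fmorph_div f (2 * gap M)) (rmorphM f 2) !(rmorph_nat f).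
Qed.

Lemma map_mx_eq0P m n (M : 'M[K]_(m, n)) : M^f = 0 <-> M = 0.
Proof. by split=> [/eqP|->]; rewrite ?map_mx0 // map_mx_eq0 => /eqP. Qed.

Lemma segre21_map M : segre21 M^f <-> segre21 M.
Proof.
rewrite /segre21 gap_map pdouble_map psimple_map -!map_mxM fmorph_eq0.
by split=> -[h1 h2 h3]; split=> //; first [exact/map_mx_eq0P|move=> /map_mx_eq0P].
Qed.

Lemma segre111_map M : segre111 M^f <-> segre111 M.
Proof.
rewrite /segre111 gap_map pdouble_map psimple_map -!map_mxM fmorph_eq0.
by split=> -[h1 h2]; split=> //; exact/map_mx_eq0P.
Qed.

Lemma segre3_map M : segre3 M^f <-> segre3 M.
Proof.
rewrite /segre3 trl_map -!map_mxM.
by split=> -[h1 h2]; split; first [exact/map_mx_eq0P|move=> /map_mx_eq0P].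
Qed.

Lemma segre_21_map M : segre_21 M^f <-> segre_21 M.
Proof.
rewrite /segre_21 trl_map -!map_mxM.
by split=> -[h1 h2]; split; first [exact/map_mx_eq0P|move=> /map_mx_eq0P].
Qed.
End SegreMap.

Lemma rank1_factor (K : fieldType) m n (M : 'M[K]_(m, n)) : (\rank M <= 1)%N ->
  exists (c : 'cV[K]_m) (r : 'rV[K]_n), M = c *m r.
Proof.
move: (col_base M) (row_base M) (mulmx_base M); move: (\rank M) => [|[|//]] c r <- _.
  by exists 0, 0; rewrite mulmx0 flatmx0 mulmx0.
by exists c, r.
Qed.

Lemma rank1_sqr (K : fieldType) n (c : 'cV[K]_n) (r : 'rV[K]_n) :
  (c *m r) *m (c *m r) = \tr (c *m r) *: (c *m r).
Proof.
rewrite mulmxA -[c *m r *m c]mulmxA (mx11_scalar (r *m c)) mul_mx_scalar -scalemxAl.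
by rewrite mxtrace_mulC /mxtrace big_ord1.
Qed.

(** * From intersection points to the Segre symbol of real forms *)

Section Classification.
Variable R : realType.
Local Notation C := R[i].
Variables A B : 'M[R]_3.
Hypotheses (sA : A^T = A) (sB : B^T = B) (uB : B \in unitmx).
Hypothesis AB : forall l, A <> l *: B.
Local Notation Ac := (complexify A).
Local Notation Bc := (complexify B).

Definition mult_point m (p : projective_plane C) :=
  [/\ qeval Ac (homogeneous_coords p) = 0, qeval Bc (homogeneous_coords p) = 0 &
      intersection_mult Ac Bc p m].

Let two : 2 != 0 :> C. Proof. by rewrite pnatr_eq0. Qed.
Let three : 3 != 0 :> C. Proof. by rewrite pnatr_eq0. Qed.
Let sAc : Ac^T = Ac. Proof. by rewrite /complexify map_trmx sA. Qed.
Let sBc : Bc^T = Bc. Proof. by rewrite /complexify map_trmx sB. Qed.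
Let uBc : Bc \in unitmx. Proof. by rewrite /complexify map_unitmx. Qed.
(** A complex ratio of two real forms is a quotient of real entries, hence real. *)
Let ABc l : Ac <> l *: Bc.
Proof.
move=> E; have [i [j Bij]] : exists i j, B i j != 0.
  apply: contrapT => h; have B0 : B = 0.
    apply/matrixP => i j; rewrite mxE; apply/eqP; apply: contrapT => /negP Bij.
    by apply: h; exists i, j.
  by move: uB; rewrite B0 unitmxE det0 unitr0.
have := congr1 (fun M : 'M[C]_3 => M i j) E; rewrite !mxE => lE.
have le : l = (A i j / B i j)%:C%C.
  by rewrite fmorph_div /= lE mulfK // fmorph_eq0.
apply: (AB (l := A i j / B i j)); apply/matrixP => a b.
have := congr1 (fun M : 'M[C]_3 => M a b) E; rewrite !mxE le -rmorphM.
by move/(fmorph_inj _).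
Qed.

Lemma has_mult_intersection (p : projective_plane C) m : common Ac Bc (homogeneous_coords p) ->
  has_mult Ac Bc (homogeneous_coords p) m -> intersection_mult Ac Bc p m.
Proof.
move=> pc pm; have [S [c [[uS _ _] Sv]]] := common_frame two sBc uBc pc.
exists S; split=> //; first by rewrite ord3_0 Sv; apply: represents_hc.
by apply: pm => //; exists 1; rewrite scale1r.
Qed.

Lemma intersection_mult_uniq (p : projective_plane C) m m' : has_mult Ac Bc (homogeneous_coords p) m ->
  intersection_mult Ac Bc p m' -> m' = m.
Proof.
move=> pm [T [uT Tp d']].
have [k k0 Tk] := represents_hc_eq Tp.
apply: local_dim_uniq d' (pm T uT _).
by exists k; rewrite -Tk ord3_0.
Qed.

Lemma mult_point_common m p : mult_point m p -> common Ac Bc (homogeneous_coords p).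
Proof. by move=> [h1 h2 _]; split; [apply/eqP; exact: (hcP p)|exact h1|exact h2]. Qed.

Lemma common_point v : common Ac Bc v -> exists (p : projective_plane C) (k : C),
  k != 0 /\ homogeneous_coords p = k *: v /\ common Ac Bc (homogeneous_coords p).
Proof.
move=> [v0 h1 h2].
have Dv : [set v : 'cV[C]_3 | v <> 0] v by apply/eqP.
have [p pv] := represents_ex Dv.
have [k k0 vk] := represents_hc_eq pv.
have pk : homogeneous_coords p = k^-1 *: v by rewrite vk scalerA mulVf // scale1r.
exists p, k^-1; rewrite invr_eq0; split=> //; split=> //; rewrite pk; split.
- by rewrite scaler_eq0 invr_eq0 negb_or k0 v0.
- by rewrite bilZl bilZr h1 !mulr0.
- by rewrite bilZl bilZr h2 !mulr0.
Qed.

Lemma tangentZ k v : k != 0 -> tangent Ac Bc (k *: v) <-> tangent Ac Bc v.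
Proof.
move=> k0; split=> -[l E]; exists l; last first.
  by rewrite -!scalemxAr E scalerA mulrC -scalerA.
apply: (scalerI k0); move: E; rewrite -!scalemxAr => ->.
by rewrite !scalerA mulrC.
Qed.

Definition has_point m := exists p, mult_point m p.

Lemma mult_point_cases m p : mult_point m p ->
  (m = 1%N /\ ~ tangent Ac Bc (homogeneous_coords p)) \/
  tangent Ac Bc (homogeneous_coords p) /\
  [\/ m = 2 /\ (segre21 (invmx B *m A) \/ segre111 (invmx B *m A)),
      m = 3 /\ segre3 (invmx B *m A) |
      m = 4 /\ segre_21 (invmx B *m A)].
Proof.
move=> pm; have pc := mult_point_common pm; have [_ _ im] := pm.
have MC : invmx Bc *m Ac = map_mx (real_complex R) (invmx B *m A).
  by rewrite map_mxM map_invmx.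
have [t|nt] := pselect (tangent Ac Bc (homogeneous_coords p)); last first.
  left; split=> //; apply: intersection_mult_uniq im.
  exact: (transversal_mult two sAc sBc uBc).
right; split=> //; have := tangent_cases two three sAc sBc uBc ABc pc t.
rewrite MC => -[[hm h]|[hm h]|[hm h]].
- apply: Or31; split; first exact: intersection_mult_uniq im.
  by case: h => [/segre21_map|/segre111_map]; [left|right].
- by apply: Or32; split; [exact: intersection_mult_uniq im|exact: (segre3_map _ _).1 h].
- by apply: Or33; split; [exact: intersection_mult_uniq im|exact: (segre_21_map _ _).1 h].
Qed.

Lemma no_tangent v : ~ has_point 2 -> ~ has_point 3 -> ~ has_point 4 ->
  common Ac Bc v -> ~ tangent Ac Bc v.
Proof.
move=> n2 n3 n4 vc vt; have [p [k [k0 [pk pc]]]] := common_point vc.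
have t : tangent Ac Bc (homogeneous_coords p) by rewrite pk; apply/tangentZ.
have pm m : has_mult Ac Bc (homogeneous_coords p) m -> mult_point m p.
  by have [_ h1 h2] := pc => h; split; [exact h1|exact h2|exact: has_mult_intersection].
by case: (tangent_cases two three sAc sBc uBc ABc pc t) => -[/pm h _];
   [apply: n2|apply: n3|apply: n4]; exists p.
Qed.

(** With the symbol [(1,1),1] every common point is a point of tangency, which leaves no room for a
    point of multiplicity 1. *)
Lemma has_point21 : has_point 2 -> has_point 1 -> segre21 (invmx B *m A).
Proof.
move=> [p pm] [q qm]; have pc := mult_point_common pm; have qc := mult_point_common qm.
case: (mult_point_cases pm) => [[]//|[pt]]; case=> -[] // _ [//|s].
have [[_ qt]|[_]] := mult_point_cases qm; last by case=> -[].
case: qt; apply: (segre111_tangent two three sAc sBc uBc pc pt) => //.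
have -> : invmx Bc *m Ac = map_mx (real_complex R) (invmx B *m A).
  by rewrite map_mxM map_invmx.
exact/segre111_map.
Qed.

Lemma has_point111 : has_point 2 -> ~ has_point 1 -> segre111 (invmx B *m A).
Proof.
move=> [p pm] n1; have pc := mult_point_common pm.
case: (mult_point_cases pm) => [[]//|[pt]]; case=> -[] // _ [s|//].
have s' : segre21 (invmx Bc *m Ac).
  have -> : invmx Bc *m Ac = map_mx (real_complex R) (invmx B *m A).
    by rewrite map_mxM map_invmx.
  exact/segre21_map.
have [w [wc wt]] := segre21_transversal two three sAc sBc uBc pc pt s'.
have [q [k [k0 [qk qc]]]] := common_point wc.
case: n1; exists q; have [_ h1 h2] := qc; split; [exact h1|exact h2|].
apply: (has_mult_intersection qc); apply: (transversal_mult two sAc sBc uBc qc).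
by have [h _] := @tangentZ k w k0; rewrite qk => /h/wt.
Qed.

Lemma has_point3 : has_point 3 -> segre3 (invmx B *m A).
Proof.
by move=> [p pm]; case: (mult_point_cases pm) => [[]//|[pt]]; case=> -[].
Qed.

Lemma has_point4 : has_point 4 -> segre_21 (invmx B *m A).
Proof.
by move=> [p pm]; case: (mult_point_cases pm) => [[]//|[pt]]; case=> -[].
Qed.

(** The hypotheses say that [l] is at least a double eigenvalue, and an isotropic vector in the
    kernel of [P] is a common point of tangency. Since [P] is selfadjoint for [B], the image of
    [P (P - d)] is isotropic and lies in this kernel; if that product is zero, [P] has rank at most
    one and its kernel contains an isotropic vector over the complex numbers. *)
Lemma double_root_tangent (l d : R) (P := invmx B *m A - l%:M) :
  P *m P *m (P - d%:M) = 0 -> \tr P = d ->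
  exists v, common Ac Bc v /\ tangent Ac Bc v.
Proof.
move=> PPQ trP.
have BP : B *m P = A - l *: B by rewrite mulmxBr mulKVmx // mul_mx_scalar.
have PB : P^T *m B = B *m P.
  have : (B *m P)^T = B *m P by rewrite BP linearB linearZ /= sA sB.
  by rewrite trmx_mul sB.
have kerP v : map_mx (real_complex R) P *m v = 0 -> tangent Ac Bc v.
  move=> Pv; exists l%:C%C.
  have -> : Ac = Bc *m map_mx (real_complex R) P + l%:C%C *: Bc.
    by rewrite -map_mxM BP /complexify -map_mxZ -map_mxD subrK.
  by rewrite mulmxDl -mulmxA Pv mulmx0 add0r scalemxAl.
have bilc (x y : 'cV[R]_3) : bil Bc (complexify x) (complexify y) = (bil B x y)%:C%C.
  by rewrite /bil /complexify map_trmx -!map_mxM mxE.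
have [PQ|PQ] := eqVneq (P *m (P - d%:M)) 0; last first.
  have [w w0] : exists w : 'cV[R]_3, P *m (P - d%:M) *m w != 0.
    apply: contrapT => /forallNP h; move/eqP: PQ; apply; apply/matrixP => i j.
    have /negP := h (delta_mx j 0); rewrite negbK => /eqP /colP/(_ i).
    by rewrite -colE !mxE.
  pose x := P *m (P - d%:M) *m w.
  exists (complexify x); split; last first.
    by apply: kerP; rewrite /complexify -map_mxM /x !mulmxA PPQ mul0mx map_mx0.
  have xB : bil B x x = 0.
    have QB : (P - d%:M)^T *m B = B *m (P - d%:M).
      by rewrite linearB /= tr_scalar_mx mulmxBl mulmxBr PB mul_scalar_mx mul_mx_scalar.
    have h : (P *m (P - d%:M))^T *m B *m (P *m (P - d%:M)) = 0.
      rewrite trmx_mul -[_ *m P^T *m B]mulmxA PB [_^T *m (B *m P)]mulmxA QB -!mulmxA.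
      by rewrite [P *m (P *m _)]mulmxA PPQ !mulmx0.
    transitivity ((w^T *m ((P *m (P - d%:M))^T *m B *m (P *m (P - d%:M))) *m w) 0 0).
      by rewrite /bil /x [(_ *m w)^T]trmx_mul !mulmxA.
    by rewrite h mulmx0 mul0mx mxE.
  have xA : bil A x x = 0.
    have Ax : A *m x = l *: (B *m x).
      have -> : A = B *m P + l *: B by rewrite BP subrK.
      have Px : P *m x = 0 by rewrite /x !mulmxA PPQ mul0mx.
      by rewrite mulmxDl -scalemxAl -mulmxA Px mulmx0 add0r.
    by rewrite bilE Ax scalemxAr -bilE bilZr xB mulr0.
  split; first by rewrite /complexify map_mx_eq0.
    by rewrite /bil /complexify map_trmx -!map_mxM mxE -/(bil A x x) xA.
  by rewrite bilc xB.
have [c [r Pcr]] : exists (c : 'cV[R]_3) (r : 'rV[R]_3), P = c *m r.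
  (* Otherwise [Q = P - d] has rank at most one and trace [- 2 d], so [Q^2 = - 2 d Q]; with
     [P Q = 0] this gives [d Q = 0]. The trace of [P] then forces [d = 0], so that [P] is [Q], or is
     zero. *)
  have [rk|rk] := leqP (\rank P) 1; first exact: rank1_factor.
  have rkQ : (\rank (P - d%:M)%R <= 1)%N.
    by have := mulmx0_rank_max PQ; lia.
  have [c [r Q]] := rank1_factor rkQ.
  have QQ : (P - d%:M) *m (P - d%:M) = (- (2 * d)) *: (P - d%:M).
    rewrite {1 2}Q rank1_sqr -Q; congr (_ *: _).
    have -> : \tr (P - d%:M) = \tr P - \tr (d%:M : 'M[R]_3) by exact: raddfB.
    by rewrite trP mxtrace_scalar -mulr_natl; ring.
  have dQ : d *: (P - d%:M) = 0.
    move: PQ; rewrite -{1}[P](subrK d%:M) mulmxDl QQ mul_scalar_mx -scalerDl => dQ.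
    have -> : d *: (P - d%:M) = - ((- (2 * d) + d) *: (P - d%:M)).
      by rewrite -scaleNr; congr (_ *: _); ring.
    by rewrite dQ oppr0.
  move/eqP: dQ; rewrite scaler_eq0 subr_eq0 => /orP[|] /eqP E.
    by exists c, r; rewrite -Q E raddf0 subr0.
  have d0 : d = 0.
    move: trP; rewrite E mxtrace_scalar -mulr_natl => h.
    by lra.
  by exists 0, 0; rewrite E d0 raddf0 mulmx0.
(* Both [y1] and [y2] are in the kernel of [r], with [y2] orthogonal to [y1]. If neither is
   isotropic, [y1 + s y2] is, for a complex square root [s] of [- B(y1, y1) / B(y2, y2)]. *)
have [y1 y10 [ry1 _]] := ker_two r^T r^T.
have [y2 y20 [ry2 y12]] := ker_two r^T (B *m y1).
rewrite trmxK in ry1 ry2.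
have {}y12 : bil B y1 y2 = 0 by rewrite /bil -{1}sB -trmx_mul y12 mxE.
have kerS (v : 'cV[C]_3) : map_mx (real_complex R) r *m v = 0 -> v != 0 -> bil Bc v v = 0 ->
    exists v, common Ac Bc v /\ tangent Ac Bc v.
  move=> rv v0 vB; exists v.
  have vt : tangent Ac Bc v by apply: kerP; rewrite Pcr map_mxM -mulmxA rv mulmx0.
  split; last exact vt.
  split; [exact v0| |exact vB]; have [l' E] := vt.
  by rewrite bilE E scalemxAr -bilE bilZr vB mulr0.
have c0 (y : 'cV[R]_3) : y != 0 -> complexify y != 0 by rewrite /complexify map_mx_eq0.
have rc y : r *m y = 0 -> map_mx (real_complex R) r *m complexify y = 0.
  by rewrite /complexify -map_mxM => ->; rewrite map_mx0.
have [y11|y11] := eqVneq (bil B y1 y1) 0.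
  by apply: (kerS (complexify y1)); rewrite ?rc ?c0 // bilc y11.
have [y22|y22] := eqVneq (bil B y2 y2) 0.
  by apply: (kerS (complexify y2)); rewrite ?rc ?c0 // bilc y22.
have y22c : (bil B y2 y2)%:C%C != 0 by rewrite fmorph_eq0.
have [s sE] := quadratic_root 0 (bil B y1 y1)%:C%C y22c.
apply: (kerS (complexify y1 + s *: complexify y2)).
- by rewrite mulmxDr -scalemxAr !rc // scaler0 addr0.
- apply/eqP => E; have := congr1 (bil Bc (complexify y1)) E.
  rewrite bilDr bilZr !bilc y12 mulr0 addr0 [RHS]/bil mulmx0 mxE => /eqP.
  by rewrite fmorph_eq0 (negbTE y11).
rewrite !(bilDl, bilDr, bilZl, bilZr) !bilc y12 [bil B y2 y1]bilC // y12 !mulr0 add0r addr0.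
by rewrite -sE; ring.
Qed.

End Classification.

(** * Couples with conjugate pencils *)

Section MatrixLimits.
Variables (R : realType) (T : Type) (F : set_system T).
Context {FF : Filter F}.

Lemma cvg_mxP m n (f : T -> 'M[R]_(m, n)) (M : 'M[R]_(m, n)) :
  f @ F --> M <-> forall i j, (fun t => f t i j) @ F --> M i j.
Proof.
split=> [h i j|h].
  apply/cvgrPdist_lt => e e0; move/cvgrPdist_lt/(_ e e0): h; apply: filterS => t.
  apply: le_lt_trans; rewrite [leRHS]/Num.norm /= mx_normrE.
  by apply: le_trans (le_bigmax _ _ (i, j)); rewrite !mxE.
apply/cvgrPdist_lt => e e0.
have : \forall t \near F, forall i j, `|M i j - f t i j| < e.
  apply: filter_forall => i; apply: filter_forall => j.
  by move/cvgrPdist_lt/(_ e e0): (h i j).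
apply: filterS => t ht; rewrite [ltLHS]/Num.norm /= mx_normrE.
by apply/bigmax_ltP; split=> // -[i j] _; rewrite !mxE.
Qed.

Lemma cvg_bigD (I : Type) (r : seq I) (P : pred I) (f : I -> T -> R) (a : I -> R) :
  (forall i, P i -> f i @ F --> a i) ->
  (fun t => \sum_(i <- r | P i) f i t) @ F --> \sum_(i <- r | P i) a i.
Proof.
move=> h; elim: r => [|i r IH].
  by under eq_fun do rewrite big_nil; rewrite big_nil; exact: cvg_cst.
under eq_fun do rewrite big_cons; rewrite big_cons; case: ifP => // Pi.
by apply: cvgD => //; exact: h.
Qed.

Lemma cvg_bigM (I : Type) (r : seq I) (P : pred I) (f : I -> T -> R) (a : I -> R) :
  (forall i, P i -> f i @ F --> a i) ->
  (fun t => \prod_(i <- r | P i) f i t) @ F --> \prod_(i <- r | P i) a i.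
Proof.
move=> h; elim: r => [|i r IH].
  by under eq_fun do rewrite big_nil; rewrite big_nil; exact: cvg_cst.
under eq_fun do rewrite big_cons; rewrite big_cons; case: ifP => // Pi.
by apply: cvgM => //; exact: h.
Qed.

Lemma cvg_mulmx m n p (f : T -> 'M[R]_(m, n)) (g : T -> 'M[R]_(n, p))
    (M : 'M[R]_(m, n)) (N : 'M[R]_(n, p)) :
  f @ F --> M -> g @ F --> N -> (fun t => f t *m g t) @ F --> M *m N.
Proof.
move=> /cvg_mxP hf /cvg_mxP hg; apply/cvg_mxP => i j.
rewrite mxE; under eq_fun do rewrite mxE.
by apply: cvg_bigD => k _; apply: cvgM.
Qed.

Lemma cvg_trmx m n (f : T -> 'M[R]_(m, n)) (M : 'M[R]_(m, n)) :
  f @ F --> M -> (fun t => (f t)^T) @ F --> M^T.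
Proof.
move=> /cvg_mxP hf; apply/cvg_mxP => i j.
by rewrite mxE; under eq_fun do rewrite mxE; exact: hf.
Qed.

Lemma cvg_scalemx m n (k : T -> R) (f : T -> 'M[R]_(m, n)) (a : R) (M : 'M[R]_(m, n)) :
  k @ F --> a -> f @ F --> M -> (fun t => k t *: f t) @ F --> a *: M.
Proof.
move=> hk /cvg_mxP hf; apply/cvg_mxP => i j.
by rewrite mxE; under eq_fun do rewrite mxE; apply: cvgM.
Qed.

Lemma cvg_scalar_mx n (k : T -> R) (a : R) :
  k @ F --> a -> (fun t => (k t)%:M : 'M[R]_n) @ F --> (a%:M : 'M[R]_n).
Proof.
move=> hk; apply/cvg_mxP => i j; rewrite mxE; under eq_fun do rewrite mxE.
by case: (i == j) => //=; rewrite ?mulr0n //; exact: cvg_cst.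
Qed.

Lemma cvg_mxD m n (f g : T -> 'M[R]_(m, n)) (M N : 'M[R]_(m, n)) :
  f @ F --> M -> g @ F --> N -> (fun t => f t + g t) @ F --> M + N.
Proof. exact: cvgD. Qed.

Lemma cvg_mxtrace n (f : T -> 'M[R]_n) (M : 'M[R]_n) :
  f @ F --> M -> (fun t => \tr (f t)) @ F --> \tr M.
Proof. by move=> /cvg_mxP h; apply: cvg_bigD. Qed.

Lemma cvg_det n (f : T -> 'M[R]_n) (M : 'M[R]_n) :
  f @ F --> M -> (fun t => \det (f t)) @ F --> \det M.
Proof.
move=> /cvg_mxP h; apply: cvg_bigD => s _; apply: cvgM; first exact: cvg_cst.
exact: cvg_bigM.
Qed.

Lemma cvg_adj n (f : T -> 'M[R]_n) (M : 'M[R]_n) :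
  f @ F --> M -> (fun t => \adj (f t)) @ F --> \adj M.
Proof.
move=> /cvg_mxP h; apply/cvg_mxP => i j; rewrite mxE; under eq_fun do rewrite mxE.
apply: cvgM; first exact: cvg_cst.
apply: cvg_det; apply/cvg_mxP => a b; rewrite !mxE; under eq_fun do rewrite !mxE.
exact: h.
Qed.

Lemma near_unitmx n (f : T -> 'M[R]_n) (M : 'M[R]_n) : M \in unitmx -> f @ F --> M ->
  \forall t \near F, f t \in unitmx.
Proof.
rewrite unitmxE unitfE => M0 /cvg_det h.
by apply: filterS (cvgr_neq0 _ h M0) => t; rewrite unitmxE unitfE.
Qed.

Lemma cvg_invmx n (f : T -> 'M[R]_n) (M : 'M[R]_n) : M \in unitmx -> f @ F --> M ->
  (fun t => invmx (f t)) @ F --> invmx M.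
Proof.
move=> uM hf; have := near_unitmx uM hf => un.
rewrite {2}/invmx uM.
have d0 : \det M != 0 by rewrite -unitfE -unitmxE.
apply: cvg_trans (cvg_scalemx (cvgV d0 (cvg_det hf)) (cvg_adj hf)).
by apply: near_eq_cvg; apply: filterS un => t ut; rewrite /invmx ut.
Qed.

End MatrixLimits.

(** Completeness of matrix spaces, for the Banach fixed point theorem. *)
HB.instance Definition _ (R : realType) m n := Complete.on 'M[R]_(m, n).

(** * Square roots of matrices close to the identity *)

Section MatrixSquareRoot.
Variable R : realType.
Implicit Types X Y E : 'M[R]_3.

Lemma mx_norm_le X a : 0 <= a -> (forall i j, `|X i j| <= a) -> `|X| <= a.
Proof.
move=> a0 h; rewrite [leLHS]/Num.norm /= mx_normrE.
by apply/bigmax_leP; split=> // -[i j] _; exact: h.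
Qed.

Lemma norm_entry X i j : `|X i j| <= `|X|.
Proof. by rewrite [leRHS]/Num.norm /= mx_normrE (le_bigmax _ (fun ij => `|X ij.1 ij.2|) (i, j)). Qed.

Lemma norm_mulmx X Y : `|X *m Y| <= 3 * `|X| * `|Y|.
Proof.
apply: mx_norm_le => [|i j]; first by rewrite !mulr_ge0.
rewrite mxE (le_trans (ler_norm_sum _ _ _)) //.
have : forall k, true -> `|X i k * Y k j| <= `|X| * `|Y|.
  by move=> k _; rewrite normrM ler_pM // norm_entry.
move=> /(ler_sum (index_enum 'I_3)) /le_trans; apply.
by rewrite sumr_const card_ord -mulrA mulr_natl.
Qed.

(* The fixed point of X = (E - X^2) / 2; V allows one to choose the square root
   in a prescribed closed subalgebra. *)
Lemma sqrt_mx (e : R) : 0 < e -> exists2 d : R, 0 < d &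
  forall E (V : set 'M[R]_3), `|E| <= d -> closed V -> V 0 ->
  (forall X, V X -> V (2^-1 *: (E - X *m X))) ->
  exists2 X, V X & `|X| <= e /\ (1%:M + X) *m (1%:M + X) = 1%:M + E.
Proof.
(* The norm is the largest entry, so products cost a factor 3. For [r <= 1/6] the ball is preserved,
   as [(r + 3 r^2) / 2 <= r], and the map contracts by [(3 r + 3 r) / 2 <= 1/2]. *)
move=> e0; pose r := Num.min e (6^-1 : R).
have r0 : 0 < r by rewrite lt_min e0 invr_gt0 ltr0n.
have re : r <= e by rewrite ge_min lexx.
have r6 : r <= 6^-1 by rewrite ge_min lexx orbT.
exists r => // E V Er Vc V0 VE.
pose U := V `&` [set X | `|X| <= r].
pose f X := 2^-1 *: (E - X *m X).
have fU : {homo f : X / U X >-> U X}.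
  move=> X [VX Xr]; split; first exact: VE.
  rewrite /= /f normrZ ger0_norm ?invr_ge0 //.
  have h1 : `|E - X *m X| <= r + 3 * r * r.
    apply: le_trans (ler_normB _ _) _; apply: lerD => //.
    apply: le_trans (norm_mulmx _ _) _.
    by rewrite ler_pM ?mulr_ge0 // ler_pM2l.
  apply: le_trans (ler_wpM2l _ h1) _; first by rewrite invr_ge0.
  by nra.
have Uc : closed U.
  apply: closedI => //; apply: preimage_closed (@closed_le _ r) => X _.
  exact: norm_continuous.
have ctr : is_contraction (mkfun fU).
  have q : {q : {nonneg R} | q%:num = 2^-1} by exists (2^-1)%:nng.
  exists (sval q); split; first by rewrite (svalP q); lra.
  move=> [X Y] [[_ /= Xr] [_ /= Yr]]; rewrite (svalP q) /= /f.
  rewrite -scalerBr normrZ ger0_norm ?invr_ge0 //.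
  rewrite ler_pM2l ?invr_gt0 //.
  have -> : E - X *m X - (E - Y *m Y) = - (X *m (X - Y) + (X - Y) *m Y).
    rewrite mulmxBr mulmxBl addrA subrK; move: (X *m X) (Y *m Y) => a b.
    by apply/matrixP => i j; rewrite !mxE; ring.
  rewrite normrN; apply: le_trans (ler_normD _ _) _.
  have h1 := norm_mulmx X (X - Y); have h2 := norm_mulmx (X - Y) Y.
  have h3 : 0 <= `|X - Y| by [].
  nra.
have U0 : U !=set0 by exists 0; split=> //=; rewrite normr0 ltW.
have [X [VX Xr] XE] := banach_fixed_point ctr Uc U0.
exists X => //; split; first exact: le_trans Xr re.
move: XE; rewrite /= /f => XE.
rewrite mulmxDl !mulmxDr !mul1mx mulmx1 -addrA; congr (_ + _).
have XX : E - X *m X = 2 *: X by rewrite {3}XE scalerA mulfV // scale1r.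
by rewrite -[E](subrK (X *m X)) XX scaler_nat mulr2n addrA.
Qed.

End MatrixSquareRoot.

(** * Elementary moves on couples of forms *)

Section Moves.
Variable R : realType.
Implicit Types (A B M h X : 'M[R]_3) (x y z : 'M[R]_3 * 'M[R]_3).

Definition unit01 (t : R) := 0 <= t <= 1.

(** Slidings and congruences carry the invertibility along a segment that later turns them into
    paths. A rescaling is invisible on conics and needs no path. *)
Variant move x : 'M[R]_3 * 'M[R]_3 -> Prop :=
| MoveLeft k of (forall t, unit01 t -> x.1 + (t * k) *: x.2 \in unitmx) :
    move x (x.1 + k *: x.2, x.2)
| MoveRight k of (forall t, unit01 t -> x.2 + (t * k) *: x.1 \in unitmx) :
    move x (x.1, x.2 + k *: x.1)
| MoveCongr h of (forall t, unit01 t -> 1%:M + t *: (h - 1%:M) \in unitmx) :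
    move x (h^T *m x.1 *m h, h^T *m x.2 *m h)
| MoveScale a b of a != 0 & b != 0 : move x (a *: x.1, b *: x.2).

Inductive reach x : 'M[R]_3 * 'M[R]_3 -> Prop :=
| Reach0 : reach x x
| ReachS y z : reach x y -> move y z -> reach x z.

Lemma reach_trans x y z : reach x y -> reach y z -> reach x z.
Proof. by move=> xy yz; elim: yz => [//|w v _ xw wv]; apply: ReachS xw wv. Qed.

Lemma reach1 x y : move x y -> reach x y.
Proof. by apply: ReachS; apply: Reach0. Qed.

Lemma unit01C t : unit01 t -> unit01 (1 - t).
Proof. by rewrite /unit01 => /andP[t0 t1]; rewrite subr_ge0 t1 /=; lra. Qed.

Lemma unit01_1 : unit01 1. Proof. by rewrite /unit01 lexx ler01. Qed.

(** The segment is run backwards; for a congruence, the segment from [1] to [h^-1] is [h^-1] times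
    the reversed segment from [1] to [h]. *)
Lemma move_sym x y : move x y -> move y x.
Proof.
case: x => A B [] /=.
- move=> k hk; suff : move (A + k *: B, B) (A + k *: B + (- k) *: B, B) by rewrite scaleNr addrK.
  apply: (@MoveLeft (A + k *: B, B)) => t /unit01C /hk /=.
  by rewrite -addrA -scalerDl (_ : (1 - t) * k = k + t * - k) //; ring.
- move=> k hk; suff : move (A, B + k *: A) (A, B + k *: A + (- k) *: A) by rewrite scaleNr addrK.
  apply: (@MoveRight (A, B + k *: A)) => t /unit01C /hk /=.
  by rewrite -addrA -scalerDl (_ : (1 - t) * k = k + t * - k) //; ring.
- move=> h hh; have uh : h \in unitmx.
    by have := hh 1 unit01_1; rewrite scale1r addrC subrK.
  have E X : X = (invmx h)^T *m (h^T *m X *m h) *m invmx h.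
    by rewrite !mulmxA mulmxK // -trmx_mul mulmxV // trmx1 mul1mx.
  suff : move (h^T *m A *m h, h^T *m B *m h)
    ((invmx h)^T *m (h^T *m A *m h) *m invmx h, (invmx h)^T *m (h^T *m B *m h) *m invmx h).
    by rewrite -!E.
  apply: (@MoveCongr (h^T *m A *m h, h^T *m B *m h) (invmx h)) => t /unit01C /hh.
  have -> : 1%:M + t *: (invmx h - 1%:M) = invmx h *m (1%:M + (1 - t) *: (h - 1%:M)).
    rewrite mulmxDr mulmx1 -scalemxAr mulmxBr mulVmx // mulmx1.
    by apply/matrixP => i j; rewrite !mxE; ring.
  by rewrite unitmx_mul unitmx_inv uh.
move=> a b a0 b0.
suff : move (a *: A, b *: B) (a^-1 *: (a *: A), b^-1 *: (b *: B)).
  by rewrite !scalerA !mulVf // !scale1r.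
by apply: (@MoveScale (a *: A, b *: B)); rewrite invr_eq0.
Qed.

Lemma reach_sym x y : reach x y -> reach y x.
Proof.
elim=> [|{}y z _ IH yz]; first exact: Reach0.
by apply: reach_trans IH; apply/reach1/move_sym.
Qed.

Lemma unitmx_ball M : M \in unitmx ->
  exists2 e : R, 0 < e & forall X, `|M - X| < e -> X \in unitmx.
Proof.
move=> uM; have h := @near_unitmx R _ (nbhs M) (nbhs_filter M) _ id M uM (@cvg_id _ (nbhs M)).
have [e e0 he] := (nbhs_normP _ _).1 h; exists e => // X; exact: he.
Qed.

End Moves.

Section Limits.
Variables (R : realType) (T : Type) (F : set_system T).
Context {FF : Filter F}.

Lemma near_segment_unitmx (f g : T -> 'M[R]_3) (M : 'M[R]_3) : M \in unitmx ->
  f @ F --> M -> g @ F --> (0 : 'M[R]_3) ->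
  \forall x \near F, forall t, unit01 t -> f x + t *: g x \in unitmx.
Proof.
move=> /unitmx_ball[e e0 he] hf hg.
have e2 : 0 < e / 2 by rewrite divr_gt0.
move/cvgrPdist_lt/(_ _ e2): hf => hf.
move/cvgrPdist_lt/(_ _ e2): hg => hg.
apply: filterS2 hf hg => x fx; rewrite sub0r normrN => gx t /andP[t0 t1].
apply: he; rewrite opprD addrA; apply: le_lt_trans (ler_normB _ _) _.
rewrite [ltRHS]splitr; apply: ltr_leD => //.
rewrite normrZ ger0_norm //; apply: le_trans (ltW gx).
by rewrite ler_piMl.
Qed.

Variables (A B : T -> 'M[R]_3) (A0 B0 : 'M[R]_3).
Hypotheses (sA : forall x, (A x)^T = A x) (sB : forall x, (B x)^T = B x).
Hypotheses (sA0 : A0^T = A0) (sB0 : B0^T = B0).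
Hypotheses (uA0 : A0 \in unitmx) (uB0 : B0 \in unitmx).
Hypotheses (cA : A @ F --> A0) (cB : B @ F --> B0).

Let M x := invmx (B x) *m A x.
Let M0 := invmx B0 *m A0.

(** The relation says, without denominators, that a Moebius function of [M x] is conjugate to [M0]
    by [h x]. Since the coefficients tend to those of the identity and [h] to [1], every segment of
    the moves is eventually made of invertible matrices. *)
Lemma reach_of_similar (p q r s : T -> R) (h : T -> 'M[R]_3) :
  p @ F --> (1 : R) -> q @ F --> (0 : R) -> r @ F --> (0 : R) -> s @ F --> (1 : R) ->
  h @ F --> (1%:M : 'M[R]_3) ->
  (\forall x \near F, (p x *: M x + (q x)%:M) *m h x = (r x *: M x + (s x)%:M) *m h x *m M0) ->
  \forall x \near F, reach (A x, B x) (A0, B0).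
Proof.
move=> cp cq cr cs ch hE.
(* The matrix [(p q; r s)] is factored into two slidings and a rescaling: with [A1 = A + (q / p) B],
   one has [p A + q B = p A1] and [r A + s B = u (B + (r / u) A1)]. *)
pose u x := s x - r x * (q x / p x).
have c1 : (fun x => q x / p x) @ F --> (0 : R).
  by rewrite -(mul0r (1^-1 : R)); apply: cvgM => //; apply: cvgV => //; exact: oner_neq0.
have cu : u @ F --> (1 : R).
  by rewrite -[X in _ --> X](subr0 (1 : R)) -(mulr0 (0 : R)); apply: cvgB => //; apply: cvgM.
have c2 : (fun x => r x / u x) @ F --> (0 : R).
  by rewrite -(mul0r (1^-1 : R)); apply: cvgM => //; apply: cvgV => //; exact: oner_neq0.
pose A1 x := A x + (q x / p x) *: B x.
have cA1 : A1 @ F --> A0.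
  rewrite -[X in _ --> X]addr0 -(scale0r B0); apply: cvgD => //.
  exact: cvg_scalemx.
have n1 := near_segment_unitmx uA0 cA (_ : (fun x => (q x / p x) *: B x) @ F --> (0 : 'M[R]_3)).
have {}n1 : \forall x \near F, forall t, unit01 t -> A x + t *: ((q x / p x) *: B x) \in unitmx.
  by apply: n1; rewrite -(scale0r B0); apply: cvg_scalemx.
have n2 : \forall x \near F, forall t, unit01 t -> B x + t *: ((r x / u x) *: A1 x) \in unitmx.
  apply: (near_segment_unitmx uB0 cB).
  by rewrite -(scale0r A0); apply: cvg_scalemx.
have n3 : \forall x \near F, forall t, unit01 t -> 1%:M + t *: (h x - 1%:M) \in unitmx.
  apply: (near_segment_unitmx (unitmx1 _ _) (cvg_cst _)).
  by rewrite -(subrr (1%:M : 'M[R]_3)); apply: cvgB => //; exact: cvg_cst.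
have [e e0 he] := unitmx_ball (unitmx1 R 3).
have e2 : 0 < e / 2 by rewrite divr_gt0.
have [d d0 hd] := sqrt_mx e2.
pose B2 x := r x *: A x + s x *: B x.
pose B3 x := (h x)^T *m B2 x *m h x.
have cB3 : B3 @ F --> B0.
  rewrite -[X in _ --> X](_ : 1%:M^T *m (0 *: A0 + 1 *: B0) *m 1%:M = B0).
    apply: cvg_mulmx => //; apply: cvg_mulmx; first exact: cvg_trmx.
    by apply: cvgD; apply: cvg_scalemx.
  by rewrite scale0r scale1r add0r trmx1 mul1mx mulmx1.
pose E x := invmx B0 *m B3 x - 1%:M.
have cE : E @ F --> (0 : 'M[R]_3).
  rewrite -(subrr (1%:M : 'M[R]_3)) -{1}(mulVmx uB0); apply: cvgB; last exact: cvg_cst.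
  by apply: cvg_mulmx => //; exact: cvg_cst.
have n4 : \forall x \near F, `|E x| <= d.
  move/cvgrPdist_lt/(_ _ d0): cE; apply: filterS => x.
  by rewrite sub0r normrN => /ltW.
have n5 : \forall x \near F, B x \in unitmx by exact: near_unitmx uB0 cB.
have n6 : \forall x \near F, p x != 0 by apply: (cvgr_neq0 _ cp); exact: oner_neq0.
have n7 : \forall x \near F, u x != 0 by apply: (cvgr_neq0 _ cu); exact: oner_neq0.
near=> x.
have px : p x != 0 by near: x.
have ux : u x != 0 by near: x.
have uBx : B x \in unitmx by near: x.
have hx : (p x *: M x + (q x)%:M) *m h x = (r x *: M x + (s x)%:M) *m h x *m M0 by near: x.
have l1 : forall t, unit01 t -> A x + t *: ((q x / p x) *: B x) \in unitmx by near: x.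
have l2 : forall t, unit01 t -> B x + t *: ((r x / u x) *: A1 x) \in unitmx by near: x.
have l3 : forall t, unit01 t -> 1%:M + t *: (h x - 1%:M) \in unitmx by near: x.
have l4 : `|E x| <= d by near: x.
pose A2 := p x *: A x + q x *: B x; pose A3 := (h x)^T *m A2 *m h x.
have r1 : reach (A x, B x) (A3, B3 x).
  apply: reach_trans (reach1 (@MoveLeft R (A x, B x) (q x / p x) _)) _ => [t /l1|].
    by rewrite scalerA.
  apply: reach_trans (reach1 (@MoveRight R (A1 x, B x) (r x / u x) _)) _ => [t /l2|].
    by rewrite scalerA.
  apply: reach_trans (reach1 (@MoveScale R (A1 x, B x + (r x / u x) *: A1 x) _ _ px ux)) _ => /=.
  have -> : p x *: A1 x = A2.
    by rewrite /A1 scalerDr scalerA mulrC divfK.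
  have -> : u x *: (B x + (r x / u x) *: A1 x) = B2 x.
    rewrite scalerDr scalerA [u x * _]mulrC divfK // /A1 /B2 scalerDr scalerA addrCA.
    by congr (_ + _); rewrite -scalerDl /u subrK.
  exact: reach1 (@MoveCongr R (A2, B2 x) (h x) l3).
have A2E : A2 = B x *m (p x *: M x + (q x)%:M).
  by rewrite mulmxDr -scalemxAr mulKVmx // mul_mx_scalar.
have B2E : B2 x = B x *m (r x *: M x + (s x)%:M).
  by rewrite mulmxDr -scalemxAr mulKVmx // mul_mx_scalar.
have A3E : A3 = B3 x *m M0.
  by rewrite /A3 /B3 A2E B2E -!mulmxA; congr (_ *m (_ *m _)); rewrite hx -!mulmxA.
have sA3 : A3^T = A3.
  by rewrite /A3 !trmx_mul trmxK mulmxA linearD !linearZ /= sA sB.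
have sB3 : (B3 x)^T = B3 x.
  by rewrite /B3 !trmx_mul trmxK mulmxA linearD !linearZ /= sA sB.
pose N := invmx B0 *m B3 x.
have BN : B0 *m N = B3 x by rewrite mulKVmx.
have BM : B0 *m M0 = A0 by rewrite mulKVmx.
have MB : M0^T *m B0 = A0 by rewrite -{1}sB0 -trmx_mul BM.
(* Transposing [A3 = B3 M0] gives a second expression of [A3]; comparing the two shows that [N]
   commutes with [M0]. *)
have A3E' : A3 = A0 *m N by rewrite -sA3 A3E trmx_mul sB3 -BN mulmxA MB.
have NM : N *m M0 = M0 *m N.
  by rewrite -mulmxA -A3E A3E' mulmxA.
have NB : N^T *m B0 = B0 *m N by rewrite -{1}sB0 -trmx_mul BN sB3.
(* The square root of [N] is sought in this closed set, stable under the iteration. Both conditions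
   are what makes the congruence by it send [(A0, B0)] to [(A0 N, B0 N)]. *)
pose V := [set X | X *m M0 = M0 *m X /\ X^T *m B0 = B0 *m X].
have Vc : closed V.
  have cl (f g : 'M[R]_3 -> 'M[R]_3) : continuous f -> continuous g ->
      closed [set X | f X = g X].
    move=> cf cg; rewrite (_ : [set X | f X = g X] = (fun X => `|f X - g X|) @^-1` [set 0]).
      apply: preimage_closed => [X _|]; last exact: closed_eq.
      exact: (cvg_norm (cvgB (cf X) (cg X))).
    apply/seteqP; split=> X /= => [->|/eqP]; first by rewrite subrr normr0.
    by rewrite normr_eq0 subr_eq0 => /eqP.
  apply: closedI; apply: cl => X.
  - exact: (cvg_mulmx (@cvg_id _ (nbhs X)) (cvg_cst _)).
  - exact: (cvg_mulmx (cvg_cst _) (@cvg_id _ (nbhs X))).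
  - exact: (cvg_mulmx (cvg_trmx (@cvg_id _ (nbhs X))) (cvg_cst _)).
  - exact: (cvg_mulmx (cvg_cst _) (@cvg_id _ (nbhs X))).
have EE : E x = N - 1%:M by [].
have [||X [XM XB] [Xe XX]] := hd (E x) V l4 Vc.
- by split; rewrite ?trmx0 ?mulmx0 ?mul0mx.
- move=> X [XM XB]; split.
    rewrite EE -scalemxAl -scalemxAr; congr (_ *: _).
    rewrite !mulmxBl !mulmxBr mul1mx mulmx1 NM; congr (_ - _).
    by rewrite -mulmxA XM mulmxA XM mulmxA.
  rewrite EE linearZ /= -scalemxAl -scalemxAr; congr (_ *: _).
  have trB (Y Z : 'M[R]_3) : (Y - Z)^T = Y^T - Z^T by exact: linearB.
  rewrite !trB trmx1 (trmx_mul X X) !mulmxBl !mulmxBr NB mul1mx mulmx1; congr (_ - _).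
  by rewrite -mulmxA XB mulmxA XB mulmxA.
have XN : (1%:M + X) *m (1%:M + X) = N by rewrite XX EE addrC subrK.
have XB' : (1%:M + X)^T *m B0 = B0 *m (1%:M + X).
  by rewrite linearD /= trmx1 mulmxDl mulmxDr XB mul1mx mulmx1.
have XM' : (1%:M + X) *m M0 = M0 *m (1%:M + X).
  by rewrite mulmxDl mulmxDr XM mul1mx mulmx1.
apply: reach_trans r1 _; apply/reach_sym/reach1.
have -> : (A3, B3 x) = ((1%:M + X)^T *m (A0, B0).1 *m (1%:M + X), (1%:M + X)^T *m (A0, B0).2 *m (1%:M + X)).
  congr (_, _); rewrite /=; last by rewrite XB' -mulmxA XN BN.
  rewrite A3E' -{2}BM [_^T *m (B0 *m M0)]mulmxA XB' -[B0 *m _ *m M0]mulmxA XM'.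
  by rewrite [B0 *m (M0 *m _)]mulmxA BM -mulmxA XN.
apply: (@MoveCongr R (A0, B0)) => t /andP[t0 t1]; apply: he.
rewrite opprD addrA subrr sub0r normrN addrAC subrr add0r normrZ ger0_norm //.
by apply: le_lt_trans (ler_piMl _ t1) _ => //; apply: le_lt_trans Xe _; lra.
Unshelve. all: by end_near.
Qed.

End Limits.

(** * Conjugation close to the identity *)

Section Intertwiners.
Variables (R : realType) (T : Type) (F : set_system T).
Context {FF : Filter F}.
Variables (y : T -> 'M[R]_3) (z : 'M[R]_3).
Hypothesis cy : y @ F --> z.

Definition intertwined := exists h : T -> 'M[R]_3,
  h @ F --> (1%:M : 'M[R]_3) /\ \forall x \near F, y x *m h x = h x *m z.

(** For multiples of projectors, [y + z - d] intertwines: both products are [y z]. At [y = z] it is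
    [D = 2 z - d], whose square is [d^2], and multiplying by its inverse makes the limit [1]. *)
Lemma intertwined_semisimple (d : R) : d != 0 -> z *m z = d *: z ->
  (\forall x \near F, y x *m y x = d *: y x) -> intertwined.
Proof.
move=> d0 zz yy; pose D := z + z - d%:M.
have DD : D *m D = (d ^+ 2)%:M.
  rewrite /D !mulmxDl !mulmxDr !mulmxN !mulNmx zz.
  rewrite !mul_mx_scalar !mul_scalar_mx scale_scalar_mx.
  by apply/matrixP => i j; rewrite !mxE; case: (i == j); rewrite ?mulr1n ?mulr0n; ring.
have uD : D \in unitmx.
  have : D *m D \in unitmx by rewrite DD -scalemx1 unitmxZ ?unitmx1 // unitfE expf_neq0.
  by rewrite unitmx_mul => /andP[].
exists (fun x => (y x + z - d%:M) *m invmx D); split.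
  rewrite -(mulmxV uD); apply: cvg_mulmx; last exact: cvg_cst.
  by apply: cvgB; last exact: cvg_cst; apply: cvgD => //; exact: cvg_cst.
apply: filterS yy => x yy.
have Dz : invmx D *m z = z *m invmx D.
  have zD : z *m D = D *m z.
    by rewrite /D mulmxBr mulmxBl mulmxDr mulmxDl mul_mx_scalar mul_scalar_mx.
  by rewrite -[RHS](mulKmx uD) [D *m _]mulmxA -zD mulmxK.
rewrite -[RHS]mulmxA Dz !mulmxA; congr (_ *m _).
rewrite mulmxBr mulmxBl mulmxDr mulmxDl yy zz mul_mx_scalar mul_scalar_mx.
by rewrite addrAC subrr add0r addrK.
Qed.

Definition krylov (M : 'M[R]_3) (v : 'cV[R]_3) := col3 v (M *m v) (M *m (M *m v)).

Lemma cvg_col3 (u v w : T -> 'cV[R]_3) (a b c : 'cV[R]_3) :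
  u @ F --> a -> v @ F --> b -> w @ F --> c ->
  (fun x => col3 (u x) (v x) (w x)) @ F --> col3 a b c.
Proof.
move=> /cvg_mxP hu /cvg_mxP hv /cvg_mxP hw; apply/cvg_mxP => i j.
rewrite mxE; under eq_fun do rewrite mxE.
by elim/ord3P: j => /=; [exact: hu|exact: hv|exact: hw].
Qed.

Lemma mulmx_col3 (M : 'M[R]_3) (u v w : 'cV[R]_3) :
  M *m col3 u v w = col3 (M *m u) (M *m v) (M *m w).
Proof.
apply/matrixP => i j; rewrite mxE [RHS]mxE.
by elim/ord3P: j; rewrite mxE; apply: eq_bigr => k _; rewrite mxE.
Qed.

Lemma intertwined_of_col3 (u v w : T -> 'cV[R]_3) (a b c : 'cV[R]_3) (C : 'M[R]_3) :
  u @ F --> a -> v @ F --> b -> w @ F --> c -> col3 a b c \in unitmx ->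
  z *m col3 a b c = col3 a b c *m C ->
  (\forall x \near F, y x *m col3 (u x) (v x) (w x) = col3 (u x) (v x) (w x) *m C) ->
  intertwined.
Proof.
move=> cu cv cw uK zK yK.
exists (fun x => col3 (u x) (v x) (w x) *m invmx (col3 a b c)); split.
  rewrite -(mulmxV uK); apply: cvg_mulmx; last exact: cvg_cst.
  exact: cvg_col3.
apply: filterS yK => x yK; rewrite mulmxA yK -!mulmxA; congr (_ *m _).
by rewrite -[C](mulKmx uK) -zK -!mulmxA mulmxV // mulmx1.
Qed.

(** On the families [v, M v, M^2 v] both matrices act through the same companion matrix [C], that of
    [X^3 - d X^2]. The same [v] serves for all [y x]. *)
Lemma intertwined_cyclic (d : R) v : krylov z v \in unitmx ->
  z *m z *m z = d *: (z *m z) ->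
  (\forall x \near F, y x *m y x *m y x = d *: (y x *m y x)) -> intertwined.
Proof.
move=> uK zzz yyy.
pose C : 'M[R]_3 := \matrix_(i, j) (nth [::] [:: [:: 0; 0; 0]; [:: 1; 0; 0]; [:: 0; 1; d]] i)`_j.
have key (M : 'M[R]_3) : M *m M *m M = d *: (M *m M) -> M *m krylov M v = krylov M v *m C.
  move=> MMM; rewrite /krylov mulmx_col3.
  have -> : M *m (M *m (M *m v)) = d *: (M *m (M *m v)).
    by rewrite 2!mulmxA MMM -scalemxAl mulmxA.
  move: (M *m (M *m v)) => a; move: (M *m v) => b; apply/matrixP => i j.
  rewrite !mxE sum3 !mxE; elim/ord3P: j => /=.
  - by rewrite mulr0 mulr1 mulr0 add0r addr0.
  - by rewrite !mulr0 mulr1 !add0r.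
  - by rewrite !mulr0 !add0r mxE mulrC.
apply: (@intertwined_of_col3 (fun=> v) (fun x => y x *m v) (fun x => y x *m (y x *m v))
  _ _ _ C _ _ _ uK (key _ zzz)).
- exact: cvg_cst.
- by apply: cvg_mulmx => //; exact: cvg_cst.
- by apply: cvg_mulmx => //; apply: cvg_mulmx => //; exact: cvg_cst.
by apply: filterS yyy => x; exact: key.
Qed.

Lemma nilp_rank1 (M : 'M[R]_3) : M *m M = 0 ->
  exists (c : 'cV[R]_3) (r : 'rV[R]_3), M = c *m r.
Proof. by move=> MM; apply: rank1_factor; have := mulmx0_rank_max MM; lia. Qed.

(** Here no cyclic vector exists. A partial inverse [X] with [z X z = z] and [X^2 = 0] splits the
    identity into the projectors [z X], [X z] and [S0]. The intertwiner replaces [z] by [y] in the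
    first and corrects the third so that [y] kills it; both products then reduce to [y X z]. *)
Lemma intertwined_nilp : z <> 0 -> z *m z = 0 ->
  (\forall x \near F, y x *m y x = 0) -> intertwined.
Proof.
move=> /eqP z0 zz yy.
have [k [l zkl]] : exists k l, z k l != 0.
  apply: contrapT => h; move/eqP: z0; apply; apply/matrixP => i j; rewrite mxE.
  by apply/eqP; apply: contrapT => /negP zij; apply: h; exists i, j.
(* Reading off a non-zero entry of [z] gives [u z v0 = 1], the normalization behind [z X z = z]. *)
pose u : 'rV[R]_3 := (z k l)^-1 *: delta_mx 0 k.
have uzE (M : 'M[R]_3) (w : 'cV[R]_3) : u *m M *m w = ((z k l)^-1 * (M *m w) k 0)%:M.
  rewrite /u -mulmxA -scalemxAl -rowE; apply/matrixP => i j; rewrite !ord1 !mxE.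
  by rewrite mulr1n.
pose v0 : 'cV[R]_3 := delta_mx l 0.
have uv0 : u *m z *m v0 = 1%:M.
  by rewrite uzE -colE mxE mulVf.
(* v is chosen in the kernel of u, which makes P z and Q z orthogonal idempotents. *)
pose v := v0 - z *m v0 *m (u *m v0).
have zv : z *m v = z *m v0 by rewrite mulmxBr !mulmxA zz !mul0mx subr0.
have uzv : u *m z *m v = 1%:M by rewrite -mulmxA zv mulmxA.
have uv : u *m v = 0.
  by rewrite mulmxBr !mulmxA uv0 mul1mx subrr.
pose X := v *m u.
have XX : X *m X = 0 by rewrite /X mulmxA -[v *m u *m v]mulmxA uv mulmx0 mul0mx.
have MXM (M : 'M[R]_3) : M *m M = 0 -> M *m X *m M = (u *m M *m v) 0 0 *: M.
  move=> /nilp_rank1[c [r ->]].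
  have rv := mx11_scalar (r *m v); have uc := mx11_scalar (u *m c).
  have -> : (u *m (c *m r) *m v) 0 0 = (u *m c) 0 0 * (r *m v) 0 0.
    by rewrite mulmxA -mulmxA {1}uc {1}rv -scalar_mxM mxE mulr1n.
  rewrite /X !mulmxA -[c *m r *m v]mulmxA {1}rv mul_mx_scalar -!scalemxAl.
  rewrite -[c *m u *m c]mulmxA {1}uc mul_mx_scalar -!scalemxAl scalerA.
  by rewrite mulrC.
pose n x := (u *m y x *m v) 0 0.
have cn : n @ F --> (1 : R).
  have : (fun x => u *m y x *m v) @ F --> u *m z *m v.
    by apply: cvg_mulmx; last exact: cvg_cst; apply: cvg_mulmx => //; exact: cvg_cst.
  by move=> /cvg_mxP/(_ 0 0); rewrite uzv mxE mulr1n.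
have n0 : \forall x \near F, n x != 0 by apply: (cvgr_neq0 _ cn); exact: oner_neq0.
(* For [y] in place of [z] the product [y X y] is [n y], so [W] is the rescaling of [X] with
   [y W y = y]. *)
pose W x := (n x)^-1 *: X.
pose S x := (1%:M - y x *m W x) *m (1%:M - W x *m y x).
pose S0 := (1%:M - z *m X) *m (1%:M - X *m z).
have zXz : z *m X *m z = z by rewrite MXM // uzv mxE mulr1n scale1r.
have zS0 : S0 *m z = 0.
  have h : (1%:M - X *m z) *m z = z by rewrite mulmxBl mul1mx -mulmxA zz mulmx0 subr0.
  by rewrite /S0 -mulmxA h mulmxBl mul1mx zXz subrr.
exists (fun x => y x *m X + X *m z + S x *m S0); split.
  have -> : 1%:M = z *m X + X *m z + S0 *m S0.
    have PQ : z *m X *m (X *m z) = 0 by rewrite mulmxA -[z *m X *m X]mulmxA XX mulmx0 mul0mx.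
    have QP : X *m z *m (z *m X) = 0 by rewrite mulmxA -[X *m z *m z]mulmxA zz mulmx0 mul0mx.
    have PP : z *m X *m (z *m X) = z *m X by rewrite mulmxA zXz.
    have QQ : X *m z *m (X *m z) = X *m z by rewrite -mulmxA [z *m _]mulmxA zXz.
    rewrite /S0; move: (z *m X) (X *m z) PQ QP PP QQ => P Q PQ QP PP QQ.
    have -> : (1%:M - P) *m (1%:M - Q) = 1%:M - P - Q.
      by rewrite mulmxBr mulmx1 mulmxBl mul1mx PQ subr0.
    have -> : (1%:M - P - Q) *m (1%:M - P - Q) = 1%:M - P - Q.
      rewrite 2!mulmxBr mulmx1 !mulmxBl !mul1mx PP QP PQ QQ.
      by rewrite !(subrr, subr0).
    by apply/matrixP => i j; rewrite !mxE; ring.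
  apply: cvgD.
    by apply: cvgD; [apply: cvg_mulmx => //|]; exact: cvg_cst.
  apply: cvg_mulmx; last exact: cvg_cst.
  have cW : W @ F --> X.
    rewrite -[X in _ --> X]scale1r -{1}invr1; apply: cvg_scalemx; last exact: cvg_cst.
    by apply: cvgV => //; exact: oner_neq0.
  by apply: cvg_mulmx; apply: cvgB; try exact: cvg_cst; apply: cvg_mulmx.
near=> x.
have yyx : y x *m y x = 0 by near: x.
have nx : n x != 0 by near: x.
have yWy : y x *m W x *m y x = y x.
  by rewrite /W -scalemxAr -scalemxAl MXM // scalerA mulVf // scale1r.
have yS : y x *m S x = 0.
  rewrite /S mulmxA [y x *m _]mulmxBr mulmx1 [y x *m (y x *m _)]mulmxA yyx mul0mx subr0.
  by rewrite mulmxBr mulmx1 mulmxA yWy subrr.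
rewrite mulmxDr mulmxDl [y x *m (S x *m _)]mulmxA yS mul0mx -[S x *m S0 *m z]mulmxA zS0.
rewrite mulmx0 !addr0 mulmxDr mulmxDl [y x *m (y x *m X)]mulmxA yyx mul0mx add0r.
by rewrite [y x *m (X *m z)]mulmxA -[X *m z *m z]mulmxA zz mulmx0 addr0.
Unshelve. all: by end_near.
Qed.

End Intertwiners.

Section Krylov.
Variable R : realType.
Implicit Types (P N : 'M[R]_3).

Lemma exists_mulmx_neq0 P : P <> 0 -> exists u : 'cV[R]_3, P *m u != 0.
Proof.
move=> P0; apply: contrapT => /forallNP h; apply: P0; apply/matrixP => i j.
have /negP := h (delta_mx j 0); rewrite negbK => /eqP/colP/(_ i).
by rewrite -colE !mxE.
Qed.

Lemma krylov_unitP P v : (forall a b c : R,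
    a *: v + b *: (P *m v) + c *: (P *m (P *m v)) = 0 -> [/\ a = 0, b = 0 & c = 0]) ->
  krylov P v \in unitmx.
Proof.
move=> h; apply: unit_of_ker => c; rewrite mul_col3 => /h[c0 c1 c2].
by apply/colP; elim/ord3P; rewrite mxE.
Qed.

Lemma krylov_nilp N : N *m N *m N = 0 -> N *m N <> 0 ->
  exists v, krylov N v \in unitmx.
Proof.
move=> N3 /exists_mulmx_neq0[v Nv]; exists v; apply: krylov_unitP => a b c E.
have N3v : N *m (N *m (N *m v)) = 0 by rewrite !mulmxA N3 mul0mx.
have NNv : N *m (N *m v) != 0 by rewrite mulmxA.
have a0 : a = 0.
  have := congr1 (fun x => N *m (N *m x)) E; rewrite /= !mulmxDr -!scalemxAr N3v.
  rewrite !mulmx0 !scaler0 !addr0 => /eqP; rewrite scaler_eq0 (negbTE NNv) orbF.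
  by move/eqP.
move: E; rewrite a0 scale0r add0r => E.
have b0 : b = 0.
  have := congr1 (mulmx N) E; rewrite mulmxDr -!scalemxAr N3v mulmx0.
  rewrite scaler0 addr0 => /eqP; rewrite scaler_eq0 (negbTE NNv) orbF.
  by move/eqP.
move: E; rewrite b0 scale0r add0r => /eqP; rewrite scaler_eq0 (negbTE NNv) orbF.
by move/eqP.
Qed.

(** A cyclic vector is the sum of a generator [Q u] of the Jordan block at [0] and an eigenvector
    [w] for [d]. *)
Lemma krylov_segre21 P d : d != 0 -> \tr P = d ->
  P *m P *m (P - d%:M) = 0 -> P *m (P - d%:M) <> 0 ->
  exists v, krylov P v \in unitmx.
Proof.
move=> d0 trP PPQ PQ0; have [u PQu] := exists_mulmx_neq0 PQ0.
set Q := P - d%:M in PPQ PQ0 PQu.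
(* If [Q] were invertible, [P^2] would vanish and [P] would have rank at most one, so that
   [0 = P^2 = (tr P) P = d P] and [P] would be zero. *)
have [w w0 Qw] : exists2 w : 'cV[R]_3, w != 0 & Q *m w = 0.
  apply: ker_of_det; apply/eqP; rewrite -[_ == 0]negbK -unitfE -unitmxE; apply/negP => uQ.
  have PP : P *m P = 0 by rewrite -[P *m P](mulmxK uQ) PPQ mul0mx.
  have [c [r Pcr]] := nilp_rank1 PP.
  have := rank1_sqr c r; rewrite -Pcr PP trP => /esym/eqP; rewrite scaler_eq0 (negbTE d0).
  by move=> /eqP P0; apply: PQ0; rewrite P0 mul0mx.
have Pw : P *m w = d *: w.
  by move: Qw; rewrite mulmxBl mul_scalar_mx => /eqP; rewrite subr_eq0 => /eqP.
have PPQu : P *m (P *m (Q *m u)) = 0 by rewrite !mulmxA PPQ mul0mx.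
have PQu0 : P *m (Q *m u) != 0 by rewrite mulmxA.
exists (Q *m u + w); apply: krylov_unitP => a b c.
move: (Q *m u) PPQu PQu0 => x PPx Px E.
have {}E : a *: x + b *: (P *m x) + (a + b * d + c * d ^+ 2) *: w = 0.
  rewrite -[RHS]E !mulmxDr PPx Pw -scalemxAr Pw add0r.
  by move: (P *m x) => y; apply/matrixP => i j; rewrite !mxE; ring.
have e0 : a + b * d + c * d ^+ 2 = 0.
  have := congr1 (fun x => P *m (P *m x)) E; rewrite /= !mulmxDr -!scalemxAr PPx !mulmx0.
  rewrite Pw -!scalemxAr Pw !scaler0 !add0r !scalerA => /eqP.
  by rewrite scaler_eq0 (negbTE w0) orbF -mulrA mulf_eq0 mulf_eq0 !(negbTE d0) !orbF => /eqP.
move: E; rewrite e0 scale0r addr0 => E.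
have a0 : a = 0.
  have := congr1 (mulmx P) E; rewrite mulmxDr -!scalemxAr PPx mulmx0 scaler0 addr0.
  by move=> /eqP; rewrite scaler_eq0 (negbTE Px) orbF => /eqP.
have b0 : b = 0.
  move: E; rewrite a0 scale0r add0r.
  by move=> /eqP; rewrite scaler_eq0 (negbTE Px) orbF => /eqP.
split=> //; move: e0; rewrite a0 b0 mul0r !add0r => /eqP.
by rewrite mulf_eq0 expf_eq0 (negbTE d0) orbF => /eqP.
Qed.

End Krylov.

Lemma tr_pdouble (R : realType) (N : 'M[R]_3) : \tr (pdouble N) = gap N.
Proof.
rewrite /pdouble; move: (gap N) => g; rewrite /trl mxtraceD.
have -> : \tr (N - (\tr N / 3)%:M) = \tr N - \tr ((\tr N / 3)%:M : 'M[R]_3) by exact: raddfB.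
by rewrite !mxtrace_scalar; move: (\tr N) => a; field.
Qed.

(** * The four Segre symbols with a multiple eigenvalue *)

Section Cases.
Variables (R : realType) (T : Type) (F : set_system T).
Context {FF : Filter F}.
Variables (A B : T -> 'M[R]_3) (A0 B0 : 'M[R]_3).
Hypotheses (sA : forall x, (A x)^T = A x) (sB : forall x, (B x)^T = B x).
Hypotheses (sA0 : A0^T = A0) (sB0 : B0^T = B0).
Hypotheses (uA0 : A0 \in unitmx) (uB0 : B0 \in unitmx).
Hypotheses (cA : A @ F --> A0) (cB : B @ F --> B0).

Let M x := invmx (B x) *m A x.
Let M0 := invmx B0 *m A0.
Let cM : M @ F --> M0.
Proof. by apply: cvg_mulmx => //; apply: cvg_invmx. Qed.

Lemma trlK N : N = trl N + (\tr N / 3)%:M :> 'M[R]_3.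
Proof. by rewrite subrK. Qed.

Let cS : (fun x => \tr (M x) / 3) @ F --> \tr M0 / 3.
Proof. by apply: cvgM; [exact: cvg_mxtrace|exact: cvg_cst]. Qed.

Let cN : (fun x => trl (M x)) @ F --> trl M0.
Proof. by apply: cvgB => //; exact: cvg_scalar_mx. Qed.

Let cgap : tr2 M0 != 0 -> (fun x => gap (M x)) @ F --> gap M0.
Proof.
move=> t0; apply: cvgM.
  apply: cvgM; first exact: cvg_cst.
  by apply: cvg_mxtrace; apply: cvg_mulmx => //; apply: cvg_mulmx.
by apply: cvgV => //; apply: cvg_mxtrace; apply: cvg_mulmx.
Qed.

Lemma gap_tr2 (N : 'M[R]_3) : gap N != 0 -> tr2 N != 0.
Proof. by apply: contra => /eqP t0; rewrite /gap t0 invr0 mulr0. Qed.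

Lemma reach_of_intertwined (al : T -> R) : al @ F --> (1 : R) ->
  intertwined F (fun x => al x *: trl (M x)) (trl M0) ->
  \forall x \near F, reach (A x, B x) (A0, B0).
Proof.
move=> cal [h [ch hE]].
apply: (reach_of_similar sA sB sA0 sB0 uA0 uB0 cA cB (p := al)
  (q := fun x => \tr M0 / 3 - al x * (\tr (M x) / 3)) (r := fun=> 0) (s := fun=> 1) _ _ _ _ ch).
- exact: cal.
- rewrite -(subrr (\tr M0 / 3)) -[X in _ --> _ - X]mul1r; apply: cvgB; first exact: cvg_cst.
  exact: cvgM.
- exact: cvg_cst.
- exact: cvg_cst.
apply: filterS hE => x hE; rewrite scale0r add0r mul1mx -/(M x) -/M0.
rewrite [M0 in RHS]trlK mulmxDr -hE scalar_mxC -mulmxDl; congr (_ *m _).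
rewrite {1}[M x]trlK scalerDr -addrA; congr (_ + _).
by rewrite scale_scalar_mx -raddfD /= addrC subrK.
Qed.

Lemma cvg_gap_ratio : gap M0 != 0 -> (fun x => gap M0 / gap (M x)) @ F --> (1 : R).
Proof.
move=> g0; rewrite -(mulfV g0); apply: cvgM; first exact: cvg_cst.
by apply: cvgV => //; apply: cgap; apply: gap_tr2.
Qed.

(** [pdouble] exceeds [trl] by the scalar [gap / 3]. After multiplication by the ratio of the gaps
    this scalar is [gap M0 / 3] on both sides, and it cancels from the intertwining relation. *)
Lemma intertwined_pdouble : gap M0 != 0 -> (forall x, gap (M x) != 0) ->
  intertwined F (fun x => (gap M0 / gap (M x)) *: pdouble (M x)) (pdouble M0) ->
  \forall x \near F, reach (A x, B x) (A0, B0).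
Proof.
move=> g0 gM [h [ch hE]].
apply: (reach_of_intertwined (cvg_gap_ratio g0)); exists h; split=> //.
apply: filterS hE => x; rewrite /pdouble scalerDr mulmxDl mulmxDr mul_mx_scalar.
by rewrite scale_scalar_mx mulrA divfK // mul_scalar_mx => /addIr.
Qed.

Lemma cvg_pdouble : gap M0 != 0 -> (fun x => gap M0 / gap (M x) *: pdouble (M x)) @ F --> pdouble M0.
Proof.
move=> g0; rewrite -[pdouble M0]scale1r; apply: cvg_scalemx; first exact: cvg_gap_ratio.
apply: cvgD => //; apply: cvg_scalar_mx; apply: cvgM; last exact: cvg_cst.
by apply: cgap; apply: gap_tr2.
Qed.

Lemma psimpleE (N : 'M[R]_3) : psimple N = pdouble N - (gap N)%:M.
Proof.
rewrite /psimple /pdouble; move: (trl N) (gap N) => X g; apply/matrixP => i j.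
by rewrite !mxE; case: (i == j); rewrite ?mulr1n ?mulr0n; field.
Qed.

Lemma reach_segre111 : segre111 M0 -> (forall x, segre111 (M x)) ->
  \forall x \near F, reach (A x, B x) (A0, B0).
Proof.
have pp (N : 'M[R]_3) : pdouble N *m psimple N = 0 -> pdouble N *m pdouble N = gap N *: pdouble N.
  rewrite psimpleE mulmxBr mul_mx_scalar => /eqP; rewrite subr_eq0 => /eqP //.
move=> [g0 /pp p0] s; have gM x : gap (M x) != 0 by case: (s x).
apply: intertwined_pdouble => //.
apply: (intertwined_semisimple (cvg_pdouble g0) g0 p0).
apply: nearW => x; have [_ /pp px] := s x.
by rewrite -scalemxAl -scalemxAr px !scalerA; congr (_ *: _);
   move: (gap M0) (gap (M x)) (gM x) => a b b0; field.
Qed.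

(** Rescaling by the ratio of the gaps gives all the matrices [pdouble] the same annihilator
    [X^2 (X - gap M0)], and the limit one has a cyclic vector. *)
Lemma reach_segre21 : segre21 M0 -> (forall x, segre21 (M x)) ->
  \forall x \near F, reach (A x, B x) (A0, B0).
Proof.
have pp (N : 'M[R]_3) : pdouble N *m pdouble N *m psimple N = 0 ->
    pdouble N *m pdouble N *m pdouble N = gap N *: (pdouble N *m pdouble N).
  by rewrite psimpleE mulmxBr mul_mx_scalar => /eqP; rewrite subr_eq0 => /eqP.
move=> [g0 h0 /eqP k0] s; have gM x : gap (M x) != 0 by case: (s x).
have [v uv] : exists v, krylov (pdouble M0) v \in unitmx.
  by apply: (krylov_segre21 g0 (tr_pdouble M0)); rewrite -psimpleE //; apply/eqP.
apply: intertwined_pdouble => //.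
apply: (intertwined_cyclic (cvg_pdouble g0) uv (pp _ h0)).
apply: nearW => x; have [_ /pp px _] := s x.
rewrite -!scalemxAl -!scalemxAr -!scalemxAl px !scalerA; congr (_ *: _).
by move: (gap M0) (gap (M x)) (gM x) => a b b0; field.
Qed.

Lemma reach_segre3 : segre3 M0 -> (forall x, segre3 (M x)) ->
  \forall x \near F, reach (A x, B x) (A0, B0).
Proof.
move=> [h0 /(krylov_nilp h0)[v uv]] s.
apply: (@reach_of_intertwined (fun=> 1)); first exact: cvg_cst.
apply: (intertwined_cyclic (d := 0) _ uv).
- by under eq_fun do rewrite scale1r.
- by rewrite scale0r.
by apply: nearW => x; rewrite !scale1r scale0r; case: (s x).
Qed.

Lemma reach_segre_21 : segre_21 M0 -> (forall x, segre_21 (M x)) ->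
  \forall x \near F, reach (A x, B x) (A0, B0).
Proof.
move=> [h0 k0] s.
apply: (@reach_of_intertwined (fun=> 1)); first exact: cvg_cst.
apply: intertwined_nilp k0 h0 _.
- by under eq_fun do rewrite scale1r.
by apply: nearW => x; rewrite !scale1r; case: (s x).
Qed.

End Cases.

(** * Simple eigenvalues: characteristic polynomials and the Moebius map *)

Section CayleyHamilton.
Variable R : realType.
Implicit Types (M z : 'M[R]_3) (l : R).

(** The linear coefficient of the characteristic polynomial, recovered from the value of that
    polynomial at [1]; in this form its continuity follows from that of determinant and trace. *)
Definition minor2 M : R := \det (1%:M - M) - 1 + \tr M + \det M.

(* The coefficients of the characteristic polynomial of M, expanded at l. *)
Definition chi0 M l := l ^+ 3 - \tr M * l ^+ 2 + minor2 M * l - \det M.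
Definition chi1 M l := 3 * l ^+ 2 - 2 * \tr M * l + minor2 M.
Definition chi2 M l := 3 * l - \tr M.

Lemma horner_char_poly M x : (char_poly M).[x] = \det (x%:M - M).
Proof.
rewrite /char_poly -[LHS]/(horner_eval x (\det _)) -det_map_mx; congr (\det _).
apply/matrixP => i j; rewrite !mxE /= /horner_eval hornerD hornerN hornerC.
by case: (i == j); rewrite ?mulr1n ?mulr0n ?hornerX ?horner0.
Qed.

Lemma char_poly3 M : char_poly M =
  (- \det M)%:P + (minor2 M)%:P * 'X + (- \tr M)%:P * 'X^2 + 'X^3.
Proof.
have s4 : size (char_poly M) = 4 by rewrite size_char_poly.
have c3 : (char_poly M)`_3 = 1.
  by have /monicP := char_poly_monic M; rewrite lead_coefE s4.
have c2 : (char_poly M)`_2 = - \tr M by exact: (@char_poly_trace _ 3 M isT).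
have c0 : (char_poly M)`_0 = - \det M by rewrite char_poly_det !exprS expr0; ring.
have E : char_poly M = (- \det M)%:P + ((char_poly M)`_1)%:P * 'X + (- \tr M)%:P * 'X^2 + 'X^3.
  rewrite -{1}[char_poly M]coefK poly_def s4 !big_ord_recr big_ord0 /= c0 c2 c3.
  by rewrite add0r scale1r expr0 expr1 -!mul_polyC mulr1.
suff c1 : (char_poly M)`_1 = minor2 M by rewrite {1}E c1.
have := congr1 (fun p => p.[1]) E; rewrite horner_char_poly => h.
by rewrite /minor2 h !(hornerD, hornerM, hornerC, hornerX, hornerXn) ?expr1n; ring.
Qed.

Lemma char_shift M l w : w = M - l%:M ->
  w *m w *m w + chi2 M l *: (w *m w) + chi1 M l *: w + (chi0 M l)%:M = 0.
Proof.
move=> ->; have := Cayley_Hamilton M.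
have -> : char_poly M = ('X - l%:P) * ('X - l%:P) * ('X - l%:P) +
    chi2 M l *: (('X - l%:P) * ('X - l%:P)) + chi1 M l *: ('X - l%:P) + (chi0 M l)%:P.
  rewrite char_poly3 /chi0 /chi1 /chi2 -!mul_polyC.
  move: (\tr M) (minor2 M) (\det M) => a b c.
  rewrite !(polyCB, polyCD, polyCM, polyCN, rmorphXn) /= polyC1.
  by ring.
by rewrite !rmorphD /= !linearZ /= !rmorphM /= rmorphB /= horner_mx_X !horner_mx_C.
Qed.

Lemma chi0_horner M x : chi0 M x = (char_poly M).[x].
Proof. by rewrite char_poly3 !(hornerD, hornerM, hornerC, hornerX, hornerXn) /chi0; ring. Qed.

Lemma chi0_root M : exists l, chi0 M l = 0.
Proof.
have [|x /eqP] := @polyrcf.odd_poly_root _ (char_poly M); first by rewrite size_char_poly.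
by rewrite -chi0_horner => h; exists x.
Qed.

Lemma chi0_root_between M a b : a <= b -> chi0 M a * chi0 M b < 0 ->
  exists2 x, a <= x <= b & chi0 M x = 0.
Proof.
move=> ab; rewrite !chi0_horner => h.
have [ha|ha] := lerP (char_poly M).[a] 0.
  have hb : 0 <= (char_poly M).[b] by nra.
  have [|x xab /eqP] := poly_ivt ab (p := char_poly M); first by rewrite ha hb.
  by rewrite -chi0_horner; exists x.
have hb : (char_poly M).[b] <= 0 by nra.
have [|x xab] := poly_ivt ab (p := - char_poly M).
  by rewrite !hornerN oppr_le0 oppr_ge0 (ltW ha) hb.
by rewrite rootN => /eqP; rewrite -chi0_horner; exists x.
Qed.

End CayleyHamilton.

(** For [p = X^3 + b X^2 + a X], the sum [h2 + h1 z + h0 z^2] plays the divided difference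
    [(p(X) - p(Y)) / (X - Y)], homogenized with [X = w / W] and [Y = z]. Both ends of the
    telescoping vanish: [w h2 = 0] is the cubic of [w / W], and [z] satisfies its own cubic. *)
Lemma divided_difference (R : realType) (w W z h0 h1 h2 : 'M[R]_3) (a b : R) :
  w *m h2 = 0 -> w *m h1 = W *m h2 - a *: (W *m h0) ->
  w *m h0 = W *m h1 - b *: (W *m h0) -> z *m z *m z = - (b *: (z *m z) + a *: z) ->
  w *m (h2 + h1 *m z + h0 *m (z *m z)) = W *m (h2 + h1 *m z + h0 *m (z *m z)) *m z.
Proof.
move=> w2 w1 w0 z3; rewrite !mulmxDr !mulmxDl w2 add0r !mulmxA w1 w0 !mulmxBl.
rewrite -[W *m h0 *m z *m z *m z]mulmxA -[W *m h0 *m z *m (z *m z)]mulmxA [z *m (z *m z)]mulmxA z3.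
rewrite mulmxN mulmxDr -!scalemxAr -!scalemxAl !mulmxA.
move: (W *m h2 *m z) (W *m h1 *m z *m z) (W *m h0 *m z) (W *m h0 *m z *m z).
by move=> c d e f; apply/matrixP => i j; rewrite !mxE; ring.
Qed.

Section GenericCase.
Variables (R : realType) (T : Type) (F : set_system T).
Context {FF : Filter F}.
Variables (A B : T -> 'M[R]_3) (A0 B0 : 'M[R]_3).
Hypotheses (sA : forall x, (A x)^T = A x) (sB : forall x, (B x)^T = B x).
Hypotheses (sA0 : A0^T = A0) (sB0 : B0^T = B0).
Hypotheses (uA0 : A0 \in unitmx) (uB0 : B0 \in unitmx).
Hypotheses (cA : A @ F --> A0) (cB : B @ F --> B0).

Let M x := invmx (B x) *m A x.
Let M0 := invmx B0 *m A0.
Let cM : M @ F --> M0.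
Proof. by apply: cvg_mulmx => //; apply: cvg_invmx. Qed.

Lemma cvg_minor2 : (fun x => minor2 (M x)) @ F --> minor2 M0.
Proof.
apply: cvgD; last exact: cvg_det.
apply: cvgD; last exact: cvg_mxtrace.
apply: cvgB; last exact: cvg_cst.
by apply: cvg_det; apply: cvgB => //; exact: cvg_cst.
Qed.

Lemma cvg_chi2 (l : T -> R) (l0 : R) : l @ F --> l0 ->
  (fun x => chi2 (M x) (l x)) @ F --> chi2 M0 l0.
Proof.
move=> cl; apply: cvgB; last exact: cvg_mxtrace.
by apply: cvgM => //; exact: cvg_cst.
Qed.

Lemma cvg_chi1 (l : T -> R) (l0 : R) : l @ F --> l0 ->
  (fun x => chi1 (M x) (l x)) @ F --> chi1 M0 l0.
Proof.
move=> cl; apply: cvgD; last exact: cvg_minor2.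
apply: cvgB.
  by apply: cvgM; [exact: cvg_cst|exact: (cvgM cl cl)].
apply: cvgM => //; apply: cvgM; first exact: cvg_cst.
exact: cvg_mxtrace.
Qed.

Lemma cvg_chi0 (l : T -> R) (l0 : R) : l @ F --> l0 ->
  (fun x => chi0 (M x) (l x)) @ F --> chi0 M0 l0.
Proof.
move=> cl; apply: cvgB; last exact: cvg_det.
apply: cvgD; last by apply: cvgM => //; exact: cvg_minor2.
apply: cvgB; first by exact: (cvgM cl (cvgM cl cl)).
by apply: cvgM; [exact: cvg_mxtrace|exact: (cvgM cl cl)].
Qed.

Variables (l : T -> R) (l0 : R).
Hypotheses (cl : l @ F --> l0) (root0 : chi0 M0 l0 = 0).
Hypothesis rootF : \forall x \near F, chi0 (M x) (l x) = 0.

Let k x := chi1 (M x) (l x).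
Let k' x := chi2 (M x) (l x).
Let disc x := k' x ^+ 2 - 4 * k x.
Let k0 := chi1 M0 l0.
Let k0' := chi2 M0 l0.
Let disc0 := k0' ^+ 2 - 4 * k0.
Hypotheses (k00 : k0 != 0) (disc00 : disc0 != 0).

(* The Moebius map  M |-> l0 + w / (al + be w),  w = M - l,  sends the
   characteristic polynomial of M to that of M0. *)
Let al x := k x / k0 * Num.sqrt (disc0 / disc x).
Let ka x := k0 * al x ^+ 2 / k x.
Let be x := (ka x * k' x - al x * k0') / (2 * al x * k0).

Let z := M0 - l0%:M.
Let w x := M x - (l x)%:M.

(** The derivative, at [z], of the cubic satisfied by [z]; a divided difference on the diagonal, it
    is the limit of [Theta]. *)
Let D0 : 'M[R]_3 := 3 *: (z *m z) + (2 * k0') *: z + k0%:M.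

Lemma z_cubic : z *m z *m z = - (k0' *: (z *m z) + k0 *: z).
Proof.
have s0 : (0 : R)%:M = 0 :> 'M[R]_3 by exact: raddf0.
have := char_shift (erefl z); rewrite root0 s0 addr0 -/z -/k0 -/k0' -addrA => /eqP.
by rewrite addr_eq0 => /eqP.
Qed.

(** The cubic [g] and its derivative [d] satisfy a Bezout relation with cofactor [u], whose constant
    [k0^2 disc0] is the discriminant of [g]. *)
Lemma D0_unit : D0 \in unitmx.
Proof.
pose d : {poly R} := 3 *: ('X * 'X) + (2 * k0') *: 'X + k0 *: 1.
pose u : {poly R} := (2 * k0' ^+ 2 - 6 * k0)%:P * 'X^2 + (2 * k0' ^+ 3 - 7 * k0 * k0')%:P * 'X +
  (k0 * k0' ^+ 2 - 4 * k0 ^+ 2)%:P.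
pose g : {poly R} := 'X * 'X * 'X + k0' *: ('X * 'X) + k0 *: 'X.
have gz : horner_mx z g = 0.
  rewrite /g !rmorphD /= !linearZ /= !rmorphM /= !horner_mx_X -!mulmxE z_cubic.
  by rewrite -addrA addNr.
have dz : horner_mx z d = D0.
  by rewrite /d !rmorphD /= !linearZ /= rmorphM /= rmorph1 !horner_mx_X -!mulmxE /D0 -scalemx1.
have du : d * u = (k0 ^+ 2 * disc0)%:P + g * ((6 * k0' ^+ 2 - 18 * k0)%:P * 'X +
   (4 * k0' ^+ 3 - 15 * k0 * k0')%:P).
  rewrite /d /u /g /disc0 -!mul_polyC; move: k0 k0' => a b.
  rewrite !(polyCB, polyCD, polyCM, polyCN, rmorphXn) /= !polyC1.
  by ring.
have : D0 *m horner_mx z u = (k0 ^+ 2 * disc0)%:M.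
  have key c lin : horner_mx z (c%:P + g * lin) = c%:M.
    have -> : horner_mx z (c%:P + g * lin) = horner_mx z c%:P + horner_mx z g * horner_mx z lin.
      by rewrite -rmorphM -rmorphD.
    by rewrite gz mul0r addr0 horner_mx_C.
  have -> : D0 *m horner_mx z u = horner_mx z (d * u) by rewrite rmorphM /= -dz.
  by rewrite du; exact: key.
move=> E; have : D0 *m horner_mx z u \in unitmx.
  by rewrite E -scalemx1 unitmxZ ?unitmx1 // unitfE mulf_neq0 // expf_neq0.
by rewrite unitmx_mul => /andP[].
Qed.

Lemma cvg_disc : disc @ F --> disc0.
Proof.
apply: cvgB; first by exact: (cvgM (cvg_chi2 cl) (cvg_chi2 cl)).
by apply: cvgM; [exact: cvg_cst|exact: cvg_chi1].
Qed.

Lemma cvg_al : al @ F --> (1 : R).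
Proof.
rewrite -(mulr1 (1 : R)); apply: cvgM.
  rewrite -(mulfV k00); apply: cvgM; last exact: cvg_cst.
  exact: cvg_chi1.
rewrite -(sqrtr1 R) -(mulfV disc00).
apply: (cvg_comp (fun x => disc0 / disc x) Num.sqrt); last exact: sqrt_continuous.
by apply: cvgM; [exact: cvg_cst|apply: cvgV => //; exact: cvg_disc].
Qed.

Lemma cvg_ka : ka @ F --> (1 : R).
Proof.
have E : k0 * (1 * 1) / k0 = 1 :> R by rewrite !mulr1 mulfV.
rewrite -[X in _ --> X]E.
apply: cvgM; last by apply: cvgV => //; exact: cvg_chi1.
by apply: cvgM; [exact: cvg_cst|exact: (cvgM cvg_al cvg_al)].
Qed.

Lemma cvg_be : be @ F --> (0 : R).
Proof.
have k2 : 2 * 1 * k0 != 0 by rewrite mulr1 mulf_neq0.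
have E : (1 * k0' - 1 * k0') / (2 * 1 * k0) = 0 by rewrite subrr mul0r.
rewrite -[X in _ --> X]E; apply: cvgM.
  apply: cvgB; apply: cvgM; [exact: cvg_ka|exact: cvg_chi2|exact: cvg_al|exact: cvg_cst].
apply: cvgV => //; apply: cvgM; last exact: cvg_cst.
by apply: cvgM; [exact: cvg_cst|exact: cvg_al].
Qed.

(** The identities say that [X^2 + k0' X W + k0 W^2], with [W = al + be X], is
    [ka (X^2 + k' X + k)]. The first two define [ka] and [be]; the third compares discriminants,
    [ka^2 disc = al^2 disc0], which is how [al] was chosen. *)
Lemma moebius_coef x : k x != 0 -> al x != 0 -> 0 < disc0 / disc x ->
  [/\ ka x * k x = k0 * al x ^+ 2,
      ka x * k' x = 2 * al x * be x * k0 + al x * k0' &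
      ka x = be x ^+ 2 * k0 + be x * k0' + 1].
Proof.
move=> kx ax dx; have al2 : al x ^+ 2 = k x ^+ 2 / k0 ^+ 2 * (disc0 / disc x).
  by rewrite /al exprMn sqr_sqrtr ?ltW // expr_div_n.
have dx0 : disc x != 0.
  by apply/eqP => d; move: dx; rewrite d invr0 mulr0 ltxx.
have kak : ka x * k x = k0 * al x ^+ 2 by rewrite /ka divfK.
have kak' : ka x * k' x = 2 * al x * be x * k0 + al x * k0'.
  by rewrite /be; field; rewrite k00 ax.
split=> //.
have e1 : ka x ^+ 2 * disc x = al x ^+ 2 * disc0.
  transitivity (al x ^+ 2 * (k0 ^+ 2 / k x ^+ 2 * disc x * al x ^+ 2)).
    by rewrite /ka; field.
  by rewrite [in X in _ * (_ * X)]al2; congr (_ * _); field; rewrite k00 kx dx0.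
have e2 : (ka x * k' x) ^+ 2 = al x ^+ 2 * disc0 + 4 * ka x * (k0 * al x ^+ 2).
  by rewrite -e1 -kak /disc; ring.
have f4 : 4 != 0 :> R by rewrite pnatr_eq0.
have ne : 4 * al x ^+ 2 * k0 != 0 by rewrite mulf_neq0 // mulf_neq0 // expf_neq0.
apply: (mulfI ne); transitivity ((ka x * k' x) ^+ 2 - al x ^+ 2 * disc0).
  by rewrite e2; ring.
by rewrite kak' /disc0; ring.
Qed.

(* h satisfies w h = (al + be w) h z, the homogeneous form of the intertwining
   relation; it is obtained from the divided difference of the cubic of z. *)
Let W x := (al x)%:M + be x *: w x.
Let Theta x := (w x *m w x + k0' *: (w x *m W x) + k0 *: (W x *m W x)) +
  (w x *m W x + k0' *: (W x *m W x)) *m z + W x *m W x *m (z *m z).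

Lemma Theta_intertwines x : chi0 (M x) (l x) = 0 -> k x != 0 -> al x != 0 ->
  0 < disc0 / disc x -> w x *m Theta x = W x *m Theta x *m z.
Proof.
move=> rx kx ax dx; have [m1 m2 m3] := moebius_coef kx ax dx.
pose Wp : {poly R} := al x *: 1 + be x *: 'X.
pose p0 := Wp * Wp; pose p1 := 'X * Wp + k0' *: (Wp * Wp).
pose p2 := 'X * 'X + k0' *: ('X * Wp) + k0 *: (Wp * Wp).
pose H := horner_mx (w x).
have HM p q : H (p * q) = H p *m H q by exact: rmorphM.
have HD p q : H (p + q) = H p + H q by exact: rmorphD.
have HB p q : H (p - q) = H p - H q by exact: rmorphB.
have HZ a p : H (a *: p) = a *: H p by exact: linearZ.
have HX : H 'X = w x by rewrite /H horner_mx_X.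
have HW : H Wp = W x by rewrite /Wp HD !HZ HX /W -scalemx1; congr (_ *: _ + _); exact: rmorph1.
have ThE : Theta x = H p2 + H p1 *m z + H p0 *m (z *m z).
  have -> : H p2 = w x *m w x + k0' *: (w x *m W x) + k0 *: (W x *m W x).
    by rewrite HD HD !HZ !HM HX HW.
  have -> : H p1 = w x *m W x + k0' *: (W x *m W x) by rewrite HD HZ !HM HX HW.
  by have -> : H p0 = W x *m W x by rewrite HM HW.
have p2E : p2 = ka x *: ('X * 'X + k' x *: 'X + k x *: 1).
  rewrite 2!scalerDr !scalerA m1 m2 m3 /p2 /Wp -!mul_polyC.
  rewrite !(polyCD, polyCM, rmorphXn) /= polyC1.
  by ring.
have wp2 : w x *m H p2 = 0.
  rewrite p2E HZ !(HD, HZ, HM) HX (_ : H 1 = 1%:M); last exact: rmorph1.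
  have gen (X : 'M[R]_3) a b : X *m (X *m X + a *: X + b *: 1%:M) = X *m X *m X + a *: (X *m X) + b *: X.
    by rewrite !mulmxDr -!scalemxAr mulmx1 mulmxA.
  rewrite -scalemxAr gen.
  have s0 : (0 : R)%:M = 0 :> 'M[R]_3 by exact: raddf0.
  have := char_shift (erefl (w x)); rewrite rx s0 addr0 -/(k x) -/(k' x) => ->.
  by rewrite scaler0.
have c1 : w x *m H p1 = W x *m H p2 - k0 *: (W x *m H p0).
  rewrite -HX -HW -!HM -HZ -HB; congr (H _).
  by rewrite /p1 /p2 /p0 -!mul_polyC; ring.
have c0 : w x *m H p0 = W x *m H p1 - k0' *: (W x *m H p0).
  rewrite -HX -HW -!HM -HZ -HB; congr (H _).
  by rewrite /p1 /p2 /p0 -!mul_polyC; ring.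
by rewrite ThE; apply: divided_difference wp2 c1 c0 z_cubic.
Qed.

Lemma cvg_w : w @ F --> z.
Proof. by apply: cvgB => //; exact: cvg_scalar_mx. Qed.

Lemma cvg_W : W @ F --> (1%:M : 'M[R]_3).
Proof.
have E : 1%:M + 0 *: z = 1%:M by rewrite scale0r addr0.
rewrite -[X in _ --> X]E; apply: cvgD.
  by apply: cvg_scalar_mx; exact: cvg_al.
by apply: cvg_scalemx; [exact: cvg_be|exact: cvg_w].
Qed.

Lemma cvg_Theta : Theta @ F --> D0.
Proof.
have WW : (fun x => W x *m W x) @ F --> (1%:M *m 1%:M : 'M[R]_3) by exact: cvg_mulmx cvg_W cvg_W.
have wW : (fun x => w x *m W x) @ F --> z *m 1%:M by exact: cvg_mulmx cvg_w cvg_W.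
have -> : D0 = (z *m z + k0' *: (z *m 1%:M) + k0 *: (1%:M *m 1%:M)) +
  (z *m 1%:M + k0' *: (1%:M *m 1%:M)) *m z + 1%:M *m 1%:M *m (z *m z).
  rewrite !mulmx1 mul1mx mulmxDl -scalemxAl mul1mx /D0 scalemx1.
  move: (z *m z) => zz; apply/matrixP => i j; rewrite !mxE; ring.
have h1 : (fun x => w x *m w x) @ F --> z *m z by exact: cvg_mulmx cvg_w cvg_w.
have cst (a : R) : (fun _ : T => a) @ F --> a by exact: cvg_cst.
have h2 : (fun x => k0' *: (w x *m W x)) @ F --> k0' *: (z *m 1%:M).
  exact: (cvg_scalemx (cst k0') wW).
have h3 : (fun x => k0 *: (W x *m W x)) @ F --> k0 *: (1%:M *m 1%:M : 'M[R]_3).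
  exact: (cvg_scalemx (cst k0) WW).
have h4 : (fun x => w x *m W x + k0' *: (W x *m W x)) @ F -->
    (z *m 1%:M + k0' *: (1%:M *m 1%:M)).
  exact: (cvg_mxD wW (cvg_scalemx (cst k0') WW)).
have cstm (a : 'M[R]_3) : (fun _ : T => a) @ F --> a by exact: cvg_cst.
have h5 : (fun x => (w x *m W x + k0' *: (W x *m W x)) *m z) @ F -->
    (z *m 1%:M + k0' *: (1%:M *m 1%:M)) *m z.
  exact: (cvg_mulmx h4 (cstm z)).
have h6 : (fun x => W x *m W x *m (z *m z)) @ F --> 1%:M *m 1%:M *m (z *m z).
  exact: (cvg_mulmx WW (cstm (z *m z))).
exact: (cvg_mxD (cvg_mxD (cvg_mxD (cvg_mxD h1 h2) h3) h5) h6).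
Qed.

Lemma reach_generic_along : \forall x \near F, reach (A x, B x) (A0, B0).
Proof.
apply: (reach_of_similar sA sB sA0 sB0 uA0 uB0 cA cB
  (* The coefficients of [l0 W + w] and of [W], expanded in [M]; their quotient is the Moebius
     function [l0 + w / W]. *)
  (p := fun x => l0 * be x + 1) (q := fun x => l0 * (al x - be x * l x) - l x)
  (r := be) (s := fun x => al x - be x * l x) (h := fun x => Theta x *m invmx D0)).
- have E : l0 * 0 + 1 = 1 :> R by rewrite mulr0 add0r.
  rewrite -[X in _ --> X]E; apply: cvgD; last exact: cvg_cst.
  by apply: cvgM; [exact: cvg_cst|exact: cvg_be].
- have E : l0 * (1 - 0 * l0) - l0 = 0 :> R by rewrite mul0r subr0 mulr1 subrr.
  rewrite -[X in _ --> X]E.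
  apply: cvgB => //; apply: cvgM; first exact: cvg_cst.
  by apply: cvgB; [exact: cvg_al|apply: cvgM => //; exact: cvg_be].
- exact: cvg_be.
- have E : 1 - 0 * l0 = 1 :> R by rewrite mul0r subr0.
  rewrite -[X in _ --> X]E.
  by apply: cvgB; [exact: cvg_al|apply: cvgM => //; exact: cvg_be].
- rewrite -(mulmxV D0_unit); apply: cvg_mulmx; [exact: cvg_Theta|exact: cvg_cst].
have n1 : \forall x \near F, k x != 0 by apply: (cvgr_neq0 _ (cvg_chi1 cl)).
have n2 : \forall x \near F, al x != 0 by apply: (cvgr_neq0 _ cvg_al); exact: oner_neq0.
have n3 : \forall x \near F, 0 < disc0 / disc x.
  apply: (cvgr_gt (disc0 / disc0)); last by rewrite mulfV // ltr01.
  by apply: cvgM; [exact: cvg_cst|apply: cvgV => //; exact: cvg_disc].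
apply: filterS (filterI rootF (filterI n1 (filterI n2 n3))) => x [rx [kx [ax dx]]].
have := Theta_intertwines rx kx ax dx => wT.
have Dz : invmx D0 *m z = z *m invmx D0.
  have gen (X : 'M[R]_3) a c : X *m (3 *: (X *m X) + a *: X + c%:M) =
      (3 *: (X *m X) + a *: X + c%:M) *m X.
    rewrite !mulmxDr !mulmxDl -!scalemxAr -!scalemxAl mulmxA.
    by rewrite mul_mx_scalar mul_scalar_mx.
  have zD : z *m D0 = D0 *m z by exact: gen.
  by rewrite -[RHS](mulKmx D0_unit) [D0 *m _]mulmxA -zD mulmxK ?D0_unit.
have -> : (l0 * be x + 1) *: M x + (l0 * (al x - be x * l x) - l x)%:M = l0 *: W x + w x.
  rewrite /W /w; apply/matrixP => i j; rewrite !mxE.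
  by case: (i == j); rewrite ?mulr1n ?mulr0n; ring.
have -> : be x *: M x + (al x - be x * l x)%:M = W x.
  rewrite /W /w; apply/matrixP => i j; rewrite !mxE.
  by case: (i == j); rewrite ?mulr1n ?mulr0n; ring.
have M0E : M0 = z + l0%:M by rewrite subrK.
have wh : w x *m (Theta x *m invmx D0) = W x *m (Theta x *m invmx D0) *m z.
  by rewrite mulmxA wT !mulmxA -2!(mulmxA (W x *m Theta x)) Dz.
move: (Theta x *m invmx D0) wh => h wh.
have gen (u v X : 'M[R]_3) : u *m h = v *m h *m X ->
    (l0 *: v + u) *m h = v *m h *m (X + l0%:M).
  by move=> E; rewrite mulmxDl mulmxDr E mul_mx_scalar -scalemxAl addrC.
by rewrite -/M0 M0E; apply: gen.
Qed.

End GenericCase.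

Section Generic.
Variables (R : realType) (T : Type) (F : set_system T).
Context {FF : Filter F}.
Variables (A B : T -> 'M[R]_3) (A0 B0 : 'M[R]_3).
Hypotheses (sA : forall x, (A x)^T = A x) (sB : forall x, (B x)^T = B x).
Hypotheses (sA0 : A0^T = A0) (sB0 : B0^T = B0).
Hypotheses (uA0 : A0 \in unitmx) (uB0 : B0 \in unitmx).
Hypotheses (cA : A @ F --> A0) (cB : B @ F --> B0).

Let M0 := invmx B0 *m A0.
Hypothesis no_double_root : forall (l d : R) (P := M0 - l%:M),
  P *m P *m (P - d%:M) = 0 -> \tr P <> d.

Lemma trB_scalar (N : 'M[R]_3) (l : R) : \tr (N - l%:M) = \tr N - 3 * l.
Proof.
have -> : \tr (N - l%:M) = \tr N - \tr (l%:M : 'M[R]_3) by exact: raddfB.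
by rewrite mxtrace_scalar; ring.
Qed.

(** If [chi1] vanishes, [l0] itself is a double root and the third one is [l0 - k']. If the
    discriminant vanishes, the other two roots coincide at [l0 - k' / 2]. *)
Lemma simple_root (l0 : R) : chi0 M0 l0 = 0 ->
  chi1 M0 l0 != 0 /\ chi2 M0 l0 ^+ 2 - 4 * chi1 M0 l0 != 0.
Proof.
move=> r0; have s0 : (0 : R)%:M = 0 :> 'M[R]_3 by exact: raddf0.
have tr2E : \tr M0 = 3 * l0 - chi2 M0 l0 by rewrite /chi2; ring.
have := char_shift (erefl (M0 - l0%:M)); rewrite r0 s0 addr0.
move: (chi1 M0 l0) (chi2 M0 l0) tr2E => k k' trE E; split; apply/eqP => h.
  apply: (no_double_root (l := l0) (d := - k')).
    rewrite mulmxBr mul_mx_scalar scaleNr opprK.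
    by move: E; rewrite h scale0r addr0.
  by rewrite trB_scalar trE; ring.
apply: (no_double_root (l := l0 - k' / 2) (d := k' / 2)).
  have -> : M0 - (l0 - k' / 2)%:M = (M0 - l0%:M) + (k' / 2)%:M.
    by apply/matrixP => i j; rewrite !mxE; case: (i == j); rewrite ?mulr1n ?mulr0n; ring.
  rewrite addrK; have hk : k = (k' / 2) ^+ 2 by lra.
  move: (M0 - l0%:M) E => w; rewrite hk => E.
  have wc : (w + (k' / 2)%:M) *m w = w *m w + (k' / 2) *: w by rewrite mulmxDl mul_scalar_mx.
  rewrite -mulmxA wc mulmxDl mulmxDr mul_scalar_mx -scalemxAr mulmxA scalerDr scalerA.
  rewrite -[RHS]E; move: (w *m w *m w) (w *m w) => w3 w2.
  by apply/matrixP => i j; rewrite !mxE; field.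
by rewrite trB_scalar trE; field.
Qed.

Lemma reach_generic : \forall x \near F, reach (A x, B x) (A0, B0).
Proof.
have [l0 r0] := chi0_root M0; have [k00 disc00] := simple_root r0.
pose k := chi1 M0 l0; pose k' := chi2 M0 l0.
have chiE e : chi0 M0 (l0 + e) = e * (e ^+ 2 + k' * e + k).
  have -> : chi0 M0 (l0 + e) = chi0 M0 l0 + e * (e ^+ 2 + k' * e + k).
    by rewrite /chi0 /k /k' /chi1 /chi2; ring.
  by rewrite r0 add0r.
(* The root becomes a second coordinate: along this filter it tends to [l0] by construction. *)
pose D := [set p : T * R | chi0 (invmx (B p.1) *m A p.1) p.2 = 0].
pose F' := within D (filter_prod F (nbhs l0)).
have FF' : Filter F' by exact: within_filter.
have cfst (V : topologicalType) (f : T -> V) (a : V) : f @ F --> a -> (f \o fst) @ F' --> a.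
  move=> h S /h FS; exists (f @^-1` S, setT); first by split=> //=; exact: filterT.
  by move=> p [/= Sp _] _.
have csnd : (@snd T R) @ F' --> l0.
  move=> S hS; exists (setT, S); first by split=> //=; exact: filterT.
  by move=> p [/= _ Sp] _.
have rF' : \forall p \near F', chi0 (invmx ((B \o fst) p) *m (A \o fst) p) (snd p) = 0.
  by exists (setT, setT) => //=; split; exact: filterT.
have [[P Q] [/= FP Ql] PQ] := @reach_generic_along R _ F' FF' (A \o fst) (B \o fst) A0 B0
  (fun p => sA p.1) (fun p => sB p.1)
  sA0 sB0 uA0 uB0 (cfst _ _ _ cA) (cfst _ _ _ cB) snd l0 csnd r0 rF' k00 disc00.
have [e e0 he] := (nbhs_normP _ _).1 Ql.
(* [K] bounds the correction in the product of the values of the cubic at [l0 - d] and [l0 + d]: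
   that product is negative once [d <= 1] and [d K < k^2]. The bound [d < e] keeps the root found
   between them in the neighbourhood [Q]. *)
pose K := 2 * `|k| + k' ^+ 2 + 1.
have K0 : 0 < K by rewrite /K; have := normr_ge0 k; nra.
have k2 : 0 < k ^+ 2 by rewrite exprn_even_gt0.
pose d := Num.min (Num.min (e / 2) 1) (k ^+ 2 / K / 2).
have d0 : 0 < d by rewrite !lt_min !divr_gt0 // ltr01.
have de : d < e by rewrite !gt_min ltr_pdivrMr // ltr_pMr // ltr1n.
have d1 : d <= 1 by rewrite !ge_min lexx orbT.
have dK : d * K < k ^+ 2.
  have : d <= k ^+ 2 / K / 2 by rewrite !ge_min lexx orbT.
  move=> h; rewrite -ltr_pdivlMr //; apply: le_lt_trans h _.
  by rewrite ltr_pdivrMr // ltr_pMr ?divr_gt0 // ltr1n.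
have neg : chi0 M0 (l0 - d) * chi0 M0 (l0 + d) < 0.
  rewrite !chiE.
  have -> : - d * ((- d) ^+ 2 + k' * - d + k) * (d * (d ^+ 2 + k' * d + k)) =
    - (d ^+ 2 * (k ^+ 2 + d ^+ 2 * (d ^+ 2 + 2 * k - k' ^+ 2))) by ring.
  rewrite oppr_lt0 mulr_gt0 ?exprn_gt0 //.
  have h1 : - (2 * `|k|) <= 2 * k by have := ler_norm (- k); rewrite normrN; lra.
  have h2 : - K <= d ^+ 2 + 2 * k - k' ^+ 2 by rewrite /K; nra.
  have h3 : d ^+ 2 <= d by nra.
  nra.
have cc a : (fun x => chi0 (invmx (B x) *m A x) a) @ F --> chi0 M0 a.
  apply: (cvg_chi0 uB0 cA cB); exact: cvg_cst.
have near_neg : \forall x \near F,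
    chi0 (invmx (B x) *m A x) (l0 - d) * chi0 (invmx (B x) *m A x) (l0 + d) < 0.
  by apply: (cvgr_lt (chi0 M0 (l0 - d) * chi0 M0 (l0 + d))) => //; apply: cvgM; exact: cc.
apply: filterS2 FP near_neg => x Px nx.
have [|l /andP[l1 l2] lr] := chi0_root_between _ nx; first by lra.
apply: (PQ (x, l)); last exact: lr.
split=> //=; apply: he; rewrite /= ltr_norml; apply/andP; split; lra.
Qed.

End Generic.

(** * Paths of couples *)

Section Paths.
Variable R : realType.
Implicit Types (A B S : 'M[R]_3) (x y z : 'M[R]_3 * 'M[R]_3) (t : R).

Definition clamp t : R := (`|t| - `|t - 1| + 1) / 2.

Lemma clamp_le0 t : t <= 0 -> clamp t = 0.
Proof. by move=> t0; rewrite /clamp ler0_norm // ler0_norm; lra. Qed.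

Lemma clamp_ge1 t : 1 <= t -> clamp t = 1.
Proof. by move=> t1; rewrite /clamp ger0_norm ?ger0_norm; lra. Qed.

Lemma clamp_id t : 0 <= t <= 1 -> clamp t = t.
Proof. by case/andP=> t0 t1; rewrite /clamp ger0_norm // ler0_norm; lra. Qed.

Lemma clamp01 t : unit01 (clamp t).
Proof.
rewrite /unit01; have [t0|t0] := lerP t 0; first by rewrite clamp_le0 ?lexx ?ler01.
have [t1|t1] := lerP 1 t; first by rewrite clamp_ge1 ?lexx ?ler01.
by rewrite clamp_id ltW // ltW.
Qed.

Lemma continuous_clamp : continuous clamp.
Proof.
move=> t; apply: cvgM; last exact: cvg_cst.
apply: cvgD; last exact: cvg_cst.
apply: cvgB; first exact: norm_continuous.
by apply: cvg_norm; apply: cvgB; [exact: cvg_id|exact: cvg_cst].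
Qed.

Definition same_pencil x y :=
  [/\ exists a b, y.1 = a *: x.1 + b *: x.2, exists a b, y.2 = a *: x.1 + b *: x.2,
      exists a b, x.1 = a *: y.1 + b *: y.2 & exists a b, x.2 = a *: y.1 + b *: y.2].

Lemma same_pencil_refl x : same_pencil x x.
Proof.
have h1 : exists a b, x.1 = a *: x.1 + b *: x.2 by exists 1, 0; rewrite scale1r scale0r addr0.
have h2 : exists a b, x.2 = a *: x.1 + b *: x.2 by exists 0, 1; rewrite scale1r scale0r add0r.
by split.
Qed.

Lemma same_pencil_left x A B k : same_pencil x (A, B) -> same_pencil x (A + k *: B, B).
Proof.
move=> [] /= [a [b E1]] [c [d E2]] [a' [b' E3]] [c' [d' E4]]; split=> /=.
- exists (a + k * c), (b + k * d); rewrite E1 E2.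
  by apply/matrixP => i j; rewrite !mxE; ring.
- by exists c, d.
- exists a', (b' - a' * k); rewrite [LHS]E3.
  by apply/matrixP => i j; rewrite !mxE; ring.
- exists c', (d' - c' * k); rewrite [LHS]E4.
  by apply/matrixP => i j; rewrite !mxE; ring.
Qed.

Lemma same_pencil_right x A B k : same_pencil x (A, B) -> same_pencil x (A, B + k *: A).
Proof.
move=> [] /= [a [b E1]] [c [d E2]] [a' [b' E3]] [c' [d' E4]]; split=> /=.
- by exists a, b.
- exists (c + k * a), (d + k * b); rewrite E1 E2.
  by apply/matrixP => i j; rewrite !mxE; ring.
- exists (a' - b' * k), b'; rewrite [LHS]E3.
  by apply/matrixP => i j; rewrite !mxE; ring.
- exists (c' - d' * k), d'; rewrite [LHS]E4.
  by apply/matrixP => i j; rewrite !mxE; ring.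
Qed.

Definition slides (SA SB : R -> 'M[R]_3) (i : R) := exists k,
  (forall t, i <= t <= i + 1 -> SA t = SA i + ((t - i) * k) *: SB i /\ SB t = SB i) \/
  (forall t, i <= t <= i + 1 -> SB t = SB i + ((t - i) * k) *: SA i /\ SA t = SA i).

(** [SA] and [SB] perform the slidings inside the pencil of [x], while [d] gathers the congruences.
    Each sliding or congruence takes one unit of time, and nothing moves after [n]. The end is met
    up to the scalars [a] and [b], so rescalings take no time. *)
Definition path_data x y (n : nat) (SA SB d : R -> 'M[R]_3) :=
  [/\ [/\ continuous SA, continuous SB & continuous d],
      forall t, [/\ SA t \in unitmx, SB t \in unitmx, d t \in unitmx &
                    same_pencil x (SA t, SB t)],
      [/\ SA 0 = x.1, SB 0 = x.2 & d 0 = 1%:M],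
      (forall t, n%:R <= t -> [/\ SA t = SA n%:R, SB t = SB n%:R & d t = d n%:R]) /\
      (forall i : nat, (i < n)%N -> slides SA SB i%:R) &
      exists a b : R, [/\ a != 0, b != 0, y.1 = a *: ((d n%:R)^T *m SA n%:R *m d n%:R) &
                         y.2 = b *: ((d n%:R)^T *m SB n%:R *m d n%:R)]].

Lemma path_data_ex x y : x.1 \in unitmx -> x.2 \in unitmx -> reach x y ->
  exists n SA SB d, (0 < n)%N /\ path_data x y n SA SB d.
Proof.
move=> ux1 ux2; elim=> [|{}y z _ [n [SA [SB [d [n0 pd]]]]] yz].
  (* An idle first unit keeps [n] positive, since time is later divided by [n]. *)
  exists 1%N, (fun=> x.1), (fun=> x.2), (fun=> 1%:M); split=> //; split=> //.
  - by split=> t; exact: cvg_cst.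
  - by move=> t; rewrite unitmx1; split=> //; case: x {ux1 ux2} => A B; exact: same_pencil_refl.
  - split=> // i _; exists 0; left=> t _; rewrite mulr0 scale0r addr0; by split.
  by exists 1, 1; rewrite oner_neq0 !scale1r trmx1 !mul1mx !mulmx1.
have [[cSA cSB cd] un [SA0 SB0 d0] [cn sl] [a [b [a0 b0 y1 y2]]]] := pd.
pose c t := clamp (t - n%:R).
have cc : continuous c.
  move=> t; apply: (cvg_comp (fun t => t - n%:R) clamp); last exact: continuous_clamp.
  by apply: cvgB; [exact: cvg_id|exact: cvg_cst].
have c_le t : t <= n%:R -> c t = 0 by move=> tn; rewrite /c clamp_le0 // subr_le0.
have c_ge t : n.+1%:R <= t -> c t = 1.
  by move=> tn; rewrite /c clamp_ge1 // lerBrDl natr1.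
have c_mid t : n%:R <= t <= n%:R + 1 -> c t = t - n%:R.
  by move=> /andP[h1 h2]; rewrite /c clamp_id // subr_ge0 h1 /= lerBlDl.
have cn1 : c n.+1%:R = 1 by exact: c_ge.
have n1 : n%:R <= n.+1%:R :> R by rewrite ler_nat.
have [un1 un2 un3 _] := un n%:R.
case: yz pd => [k hk|k hk|h hh|a' b' a0' b0'] pd.
(* The current couple is [(a d^T SA d, b d^T SB d)], so adding [k] times the second form amounts to
   adding [(b / a) k SB] to [SA] in the initial pencil. *)
- pose k' := b / a * k.
  exists n.+1, (fun t => SA t + (c t * k') *: SB n%:R), SB, d; split=> //.
  have hS t : t <= n%:R -> SA t + (c t * k') *: SB n%:R = SA t.
    by move=> tn; rewrite c_le // mul0r scale0r addr0.
  split=> //.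
  + split=> // t; apply: cvgD; first exact: cSA.
    apply: cvg_scalemx; last exact: cvg_cst.
    by apply: cvgM; [exact: cc|exact: cvg_cst].
  + move=> t; have [u1 u2 u3 pp] := un t.
    have [tn|tn] := lerP t n%:R; first by rewrite hS.
    have [SAt SBt dt] := cn t (ltW tn).
    rewrite SBt in u2 pp *; rewrite SAt in u1 pp *; split=> //; last exact: same_pencil_left.
    have := hk (c t) (clamp01 _).
    have -> : y.1 + (c t * k) *: y.2 =
        a *: ((d n%:R)^T *m (SA n%:R + (c t * k') *: SB n%:R) *m d n%:R).
      rewrite y1 y2 mulmxDr mulmxDl scalerDr -scalemxAr -scalemxAl !scalerA; congr (_ + _ *: _).
      by rewrite /k'; field.
    rewrite unitmxZ ?unitfE // !unitmx_mul => /andP[/andP[_ ->]] //.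
  + rewrite hS ?ler0n //.
  + split=> [t tn|i].
      have tn' : n%:R <= t by exact: le_trans tn.
      have [-> -> ->] := cn _ tn'; have [-> -> ->] := cn _ n1.
      by rewrite c_ge // cn1.
    rewrite ltnS leq_eqVlt => /orP[/eqP ->|ni].
      exists k'; left=> t tn; rewrite c_mid // hS //.
      have /andP[tn' _] := tn; have [-> -> _] := cn _ tn'.
      by [].
    have ni' : i%:R + 1 <= n%:R :> R by rewrite natr1 ler_nat.
    have ni2 : i%:R <= n%:R :> R by rewrite ler_nat ltnW.
    have [q hq] := sl i ni; exists q; case: hq => hq; [left|right] => t ti;
    have /andP[_ ti2] := ti; rewrite (hS _ ni2) hS ?(le_trans ti2) //; exact: hq.
  have [E1 E2 E3] := cn _ n1; exists a, b; rewrite cn1 E1 E2 E3 /=; split=> //.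
  rewrite y1 y2 mul1r mulmxDr mulmxDl scalerDr -scalemxAr -scalemxAl !scalerA; congr (_ + _ *: _).
  by rewrite /k'; field.
- pose k' := a / b * k.
  exists n.+1, SA, (fun t => SB t + (c t * k') *: SA n%:R), d; split=> //.
  have hS t : t <= n%:R -> SB t + (c t * k') *: SA n%:R = SB t.
    by move=> tn; rewrite c_le // mul0r scale0r addr0.
  split=> //.
  + split=> // t; apply: cvgD; first exact: cSB.
    apply: cvg_scalemx; last exact: cvg_cst.
    by apply: cvgM; [exact: cc|exact: cvg_cst].
  + move=> t; have [u1 u2 u3 pp] := un t.
    have [tn|tn] := lerP t n%:R; first by rewrite hS.
    have [SAt SBt dt] := cn t (ltW tn).
    rewrite SBt in u2 pp *; rewrite SAt in u1 pp *; split=> //; last exact: same_pencil_right.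
    have := hk (c t) (clamp01 _).
    have -> : y.2 + (c t * k) *: y.1 =
        b *: ((d n%:R)^T *m (SB n%:R + (c t * k') *: SA n%:R) *m d n%:R).
      rewrite y1 y2 mulmxDr mulmxDl scalerDr -scalemxAr -scalemxAl !scalerA; congr (_ + _ *: _).
      by rewrite /k'; field.
    rewrite unitmxZ ?unitfE // !unitmx_mul => /andP[/andP[_ ->]] //.
  + rewrite hS ?ler0n //.
  + split=> [t tn|i].
      have tn' : n%:R <= t by exact: le_trans tn.
      have [-> -> ->] := cn _ tn'; have [-> -> ->] := cn _ n1.
      by rewrite c_ge // cn1.
    rewrite ltnS leq_eqVlt => /orP[/eqP ->|ni].
      exists k'; right=> t tn; rewrite c_mid // hS //.
      have /andP[tn' _] := tn; have [-> -> _] := cn _ tn'.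
      by [].
    have ni' : i%:R + 1 <= n%:R :> R by rewrite natr1 ler_nat.
    have ni2 : i%:R <= n%:R :> R by rewrite ler_nat ltnW.
    have [q hq] := sl i ni; exists q; case: hq => hq; [left|right] => t ti;
    have /andP[_ ti2] := ti; rewrite (hS _ ni2) hS ?(le_trans ti2) //; exact: hq.
  have [E1 E2 E3] := cn _ n1; exists a, b; rewrite cn1 E1 E2 E3 /=; split=> //.
  rewrite y1 y2 mul1r mulmxDr mulmxDl scalerDr -scalemxAr -scalemxAl !scalerA; congr (_ + _ *: _).
  by rewrite /k'; field.
(* The new congruence acts after the previous ones, hence on the right of [d]; the slidings rest
   meanwhile, with coefficient [0]. *)
- pose e t := d t *m (1%:M + c t *: (h - 1%:M)).
  exists n.+1, SA, SB, e; split=> //.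
  have hd t : t <= n%:R -> e t = d t by move=> tn; rewrite /e c_le // scale0r addr0 mulmx1.
  have uh t : 1%:M + c t *: (h - 1%:M) \in unitmx by apply: hh; exact: clamp01.
  split=> //.
  + split=> // t; apply: cvg_mulmx; first exact: cd.
    apply: cvgD; first exact: cvg_cst.
    by apply: cvg_scalemx; [exact: cc|exact: cvg_cst].
  + by move=> t; have [u1 u2 u3 pp] := un t; split=> //; rewrite unitmx_mul u3 uh.
  + by split=> //; rewrite hd ?ler0n.
  + split=> [t tn|i].
      have tn' : n%:R <= t by exact: le_trans tn.
      rewrite /e; have [-> -> ->] := cn _ tn'; have [-> -> ->] := cn _ n1.
      by rewrite c_ge // cn1.
    rewrite ltnS leq_eqVlt => /orP[/eqP ->|ni]; last exact: sl.
    exists 0; left=> t /andP[tn _]; rewrite mulr0 scale0r addr0.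
    by have [-> -> _] := cn _ tn.
  have [E1 E2 E3] := cn _ n1; exists a, b; rewrite /e cn1 E1 E2 E3 /= scale1r.
  rewrite [1%:M + _]addrC subrK; split=> //.
    by rewrite y1 -scalemxAr -scalemxAl trmx_mul !mulmxA.
  by rewrite y2 -scalemxAr -scalemxAl trmx_mul !mulmxA.
exists n, SA, SB, d; split=> //; split=> //; exists (a' * a), (b' * b).
by rewrite !mulf_neq0 //= y1 y2 !scalerA.
Qed.

End Paths.

(** * Multiplicities in a pencil and under congruence *)

Section Combinations.
Variables (K L : fieldType) (iota : {rmorphism {poly {poly K}} -> L}).
Hypothesis iota_inj : injective iota.

Lemma loc_ideal_comb (F G F' G' : {poly {poly K}}) (a b c d : K) z :
  F = const2 a * F' + const2 b * G' -> G = const2 c * F' + const2 d * G' ->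
  loc_ideal iota F G z -> loc_ideal iota F' G' z.
Proof.
have comb x y : loc_ideal iota F' G' (iota (const2 x * F' + const2 y * G')).
  rewrite (rmorphD iota) (rmorphM iota (const2 x)) (rmorphM iota (const2 y)).
  apply: (loc_idealD iota_inj); apply: loc_idealM.
  - exact: loc_ring_poly.
  - exact: loc_idealF.
  - exact: loc_ring_poly.
  - exact: loc_idealG.
move=> -> -> [u [v [uO vO ->]]].
by apply: (loc_idealD iota_inj); apply: loc_idealM => //; exact: comb.
Qed.

Lemma loc_dim_ideal (F G F' G' : {poly {poly K}}) m :
  (forall z, loc_ideal iota F G z <-> loc_ideal iota F' G' z) ->
  loc_dim iota F G m -> loc_dim iota F' G' m.
Proof.
move=> h [e [eO eb]]; exists e; split=> // z zO; have [c [cI cu]] := eb z zO.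
by exists c; split=> [|c' c'I]; [apply/h|apply: cu; apply/h].
Qed.
End Combinations.

Lemma local_dim_comb (K : fieldType) (F G F' G' : {poly {poly K}}) (a b c d a' b' c' d' : K) m :
  F = const2 a * F' + const2 b * G' -> G = const2 c * F' + const2 d * G' ->
  F' = const2 a' * F + const2 b' * G -> G' = const2 c' * F + const2 d' * G ->
  local_dim F G m -> local_dim F' G' m.
Proof.
move=> h1 h2 h3 h4 h; refine (loc_dim_ideal (iota := @iotaF K) _ h) => z.
by split; [apply: (loc_ideal_comb (@iotaF_inj K)) h1 h2|apply: (loc_ideal_comb (@iotaF_inj K)) h3 h4].
Qed.

Section AffineEquation.
Variable K : fieldType.
Implicit Types (T H A B : 'M[K]_3).

Lemma affine_equation_comb T A B a b : affine_equation T (a *: A + b *: B) =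
  const2 a * affine_equation T A + const2 b * affine_equation T B.
Proof.
rewrite /affine_equation !qeval3 !mulr_sumr -big_split; apply: eq_bigr => i _ /=.
rewrite !mulr_sumr -big_split; apply: eq_bigr => j _ /=.
rewrite [map_mx _ (_ + _) i j]mxE [map_mx _ A i j]mxE [map_mx _ B i j]mxE.
have -> : (a *: A + b *: B) i j = a * A i j + b * B i j by rewrite !mxE.
by rewrite /const2 !(polyCD, polyCM); ring.
Qed.

Lemma affine_equation_congr T H A :
  affine_equation T (H^T *m A *m H) = affine_equation (H *m T) A.
Proof.
rewrite /affine_equation /qeval !(map_mxM (polyC \o polyC)) !trmx_mul !mulmxA.
by rewrite -(map_trmx (polyC \o polyC)).
Qed.

Lemma qeval_congr A H (v : 'cV[K]_3) : qeval (H^T *m A *m H) v = qeval A (H *m v).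
Proof. by rewrite /qeval trmx_mul !mulmxA. Qed.

Lemma qevalZ A a (v : 'cV[K]_3) : qeval A (a *: v) = a * (a * qeval A v).
Proof. by rewrite !qeval_bil bilZl bilZr. Qed.
End AffineEquation.

Section PointAction.
Variable K : fieldType.
Implicit Types (H : 'M[K]_3) (p : projective_plane K) (v : 'cV[K]_3).

(** The fallback [p] makes the action total; it is not reached when [H] is invertible. *)
Definition act H p : projective_plane K :=
  if pselect ([set v : 'cV[K]_3 | v <> 0] (H *m homogeneous_coords p)) is left e then
    \pi_(projectivization [set v : 'cV[K]_3 | v <> 0])%qT (SigSub (mem_set e))
  else p.

Lemma scaled_neq0 (c : K) v : c != 0 -> v <> 0 -> c *: v <> 0.
Proof. by move=> c0 /eqP v0; apply/eqP; rewrite scaler_eq0 negb_or c0 v0. Qed.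

Lemma represents_act H v p : H \in unitmx -> represents v p -> represents (H *m v) (act H p).
Proof.
move=> uH vp; have [c c0 vE] := represents_hc_eq vp.
rewrite /act; case: pselect => [e|]; last first.
  move=> h; exfalso; apply: h => h; apply: (hcP p).
  by rewrite -(mulKmx uH (homogeneous_coords p)) h mulmx0.
rewrite vE -scalemxAr; apply: representsZ => //.
  by move=> w /=; exact: scaled_neq0.
by exists (SigSub (mem_set e)).
Qed.

Lemma actK H p : H \in unitmx -> act (invmx H) (act H p) = p.
Proof.
move=> uH; have h := represents_act uH (represents_hc p).
have uH' : invmx H \in unitmx by rewrite unitmx_inv.
have := represents_act uH' h; rewrite mulKmx // => h'.
exact: represents_eq h' (represents_hc p).
Qed.

Lemma actVK H p : H \in unitmx -> act H (act (invmx H) p) = p.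
Proof. by move=> uH; rewrite -{1}[H]invmxK actK // unitmx_inv. Qed.

Lemma hc_act H p : H \in unitmx -> exists2 c, c != 0 &
  H *m homogeneous_coords p = c *: homogeneous_coords (act H p).
Proof. by move=> uH; apply: represents_hc_eq; apply: represents_act => //; apply: represents_hc. Qed.
End PointAction.

Section MultPoints.
Variable R : realType.
Local Notation C := R[i].
Implicit Types (A B : 'M[R]_3) (p : projective_plane C).

Lemma complexify_comb (a b : R) A B :
  complexify (a *: A + b *: B) = a%:C%C *: complexify A + b%:C%C *: complexify B.
Proof. by rewrite /complexify map_mxD !map_mxZ. Qed.

Lemma mult_point_pencil A B A' B' m p : same_pencil (A, B) (A', B') ->
  mult_point A B m p -> mult_point A' B' m p.
Proof.
move=> [] /= [a [b E1]] [c [d E2]] [a' [b' E3]] [c' [d' E4]] [hA hB [T [uT Tp ld]]].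
have q (x y : R) : qeval (complexify (x *: A + y *: B)) (homogeneous_coords p) = 0.
  have qD (X Y : 'M[C]_3) (u v : C) (w : 'cV[C]_3) :
    qeval (u *: X + v *: Y) w = u * qeval X w + v * qeval Y w.
    by rewrite /qeval mulmxDr mulmxDl mxE -!scalemxAr -!scalemxAl !mxE.
  by rewrite complexify_comb qD hA hB !mulr0 addr0.
split; [by rewrite E1 q|by rewrite E2 q|exists T; split; [exact uT|exact Tp|]].
apply: (@local_dim_comb _ _ _ _ _ a'%:C%C b'%:C%C c'%:C%C d'%:C%C a%:C%C b%:C%C c%:C%C d%:C%C) ld;
by rewrite -affine_equation_comb -complexify_comb -?E1 -?E2 -?E3 -?E4.
Qed.

Lemma mult_point_congr A B (h : 'M[R]_3) m p : h \in unitmx ->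
  mult_point (h^T *m A *m h) (h^T *m B *m h) m p <->
  mult_point A B m (act (complexify h) p).
Proof.
move=> uh; pose H := complexify h.
have uH : H \in unitmx by rewrite /H /complexify map_unitmx.
have cE G : complexify (h^T *m G *m h) = H^T *m complexify G *m H.
  by rewrite /complexify !map_mxM map_trmx.
have [c c0 cp] := hc_act p uH.
have qE G : qeval (complexify (h^T *m G *m h)) (homogeneous_coords p) = 0 <->
    qeval (complexify G) (homogeneous_coords (act H p)) = 0.
  rewrite cE qeval_congr cp qevalZ; split=> [/eqP|->]; last by rewrite !mulr0.
  by rewrite !mulf_eq0 (negbTE c0) => /eqP.
split=> -[hA hB [T [uT Tp ld]]]; split; try exact/qE.
  exists (H *m T); split; first by rewrite unitmx_mul uH.
    by rewrite colE -mulmxA -colE; apply: represents_act.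
  by rewrite -!affine_equation_congr -!cE.
exists (invmx H *m T); split; first by rewrite unitmx_mul unitmx_inv uH.
  rewrite colE -mulmxA -colE -(actK p uH); apply: represents_act => //.
  by rewrite unitmx_inv.
by rewrite !cE !affine_equation_congr mulKVmx.
Qed.

Lemma real_point_act (h : 'M[R]_3) p : h \in unitmx ->
  real_point (act (complexify h) p) <-> real_point p.
Proof.
have key (k : 'M[R]_3) q : k \in unitmx -> real_point q -> real_point (act (complexify k) q).
  move=> uk [v vq]; exists (k *m v); rewrite /complexify map_mxM.
  by apply: represents_act; rewrite ?map_unitmx.
move=> uh; split=> [hp|]; last exact: key.
have uH : complexify h \in unitmx by rewrite map_unitmx.
rewrite -(actK p uH); have -> : invmx (complexify h) = complexify (invmx h).
  by rewrite /complexify map_invmx.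
by apply: key => //; rewrite unitmx_inv.
Qed.

End MultPoints.

(** * Local constancy along a rigid isotopy *)

Lemma cvg_trsq (R : realType) (T : Type) (F : set_system T) (FF : Filter F)
  (f : T -> 'M[R]_3) (M N : 'M[R]_3) : f @ F --> M ->
  (fun t => \tr (N^T *m f t)) @ F --> \tr (N^T *m M).
Proof. by move=> h; apply: cvg_mxtrace; apply: cvg_mulmx => //; exact: cvg_cst. Qed.

Section Lift.
Variable R : realType.
Implicit Types (f A B : 'M[R]_3) (c : conic R) (x y : 'M[R]_3 * 'M[R]_3) (a b : R).

Definition normsq f : R := \tr (f^T *m f).

Lemma normsqE f : normsq f = \sum_j \sum_i f i j ^+ 2.
Proof.
apply: eq_bigr => j _; rewrite mxE; apply: eq_bigr => i _.
by rewrite mxE expr2.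
Qed.

Lemma normsq_gt0 f : f != 0 -> 0 < normsq f.
Proof.
move=> f0; rewrite lt_neqAle normsqE; apply/andP; split; last first.
  by apply: sumr_ge0 => j _; apply: sumr_ge0 => i _; exact: sqr_ge0.
rewrite eq_sym; apply: contra f0 => /eqP s0; apply/eqP/matrixP => i j; rewrite mxE.
have s1 : \sum_i f i j ^+ 2 = 0.
  by apply: (psumr_eq0P _ s0) => // k _; apply: sumr_ge0 => l _; exact: sqr_ge0.
have /eqP : f i j ^+ 2 = 0 by apply: (psumr_eq0P _ s1) => // k _; exact: sqr_ge0.
by rewrite sqrf_eq0 => /eqP.
Qed.

(** The orthogonal projection of [f0] onto the line of [f]. It ignores the scale of [f] and fixes
    [f0], so it descends to a continuous choice of equations near the conic of [f0]. *)
Definition lift_form f0 f : 'M[R]_3 := (\tr (f0^T *m f) / normsq f) *: f.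

Lemma lift_formZ f0 a f : a != 0 -> lift_form f0 (a *: f) = lift_form f0 f.
Proof.
move=> a0; rewrite /lift_form.
have -> : normsq (a *: f) = a ^+ 2 * normsq f.
  rewrite !normsqE mulr_sumr; apply: eq_bigr => j _; rewrite mulr_sumr; apply: eq_bigr => i _.
  by rewrite mxE exprMn.
rewrite -scalemxAr mxtraceZ scalerA; have [->|n0] := eqVneq (normsq f) 0.
  by rewrite mulr0 invr0 !mulr0 mul0r.
by congr (_ *: _); field; rewrite n0 a0.
Qed.

Lemma scale_neq0 (a : R) f : a *: f \in unitmx -> a != 0.
Proof. by apply: contraTneq => ->; rewrite scale0r unitmxE det0 unitr0. Qed.

Lemma lift_form_id f : f != 0 -> lift_form f f = f.
Proof. by move=> f0; rewrite /lift_form divff ?scale1r // gt_eqF // normsq_gt0. Qed.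

Definition lift f0 c : 'M[R]_3 := lift_form f0 (form_of c).

Lemma continuous_set_val : continuous (set_val : nonzero_qform R -> 'M[R]_3).
Proof. exact: initial_continuous. Qed.

Lemma continuous_lift f0 : continuous (lift f0).
Proof.
apply: (@repr_comp_continuous _
  (projectivization [set A : 'M[R]_3 | A^T = A /\ A <> 0]) _
  (fun f : nonzero_qform R => lift_form f0 (set_val f))).
  move=> f; have cf : set_val @ nbhs f --> (set_val f : 'M[R]_3) by exact: continuous_set_val.
  have fn0 : normsq (set_val f) != 0.
    by rewrite gt_eqF // normsq_gt0 //; apply/eqP; have [] := set_valP f.
  have ct : (fun g : nonzero_qform R => \tr (f0^T *m set_val g)) @ nbhs f -->
    \tr (f0^T *m set_val f) by exact: cvg_trsq cf.
  have cn : (fun g : nonzero_qform R => normsq (set_val g)) @ nbhs f --> normsq (set_val f).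
    by apply: cvg_mxtrace; apply: cvg_mulmx; [exact: cvg_trmx|exact: cf].
  exact: cvg_scalemx (cvgM ct (cvgV fn0 cn)) cf.
move=> f g /eqP/pi_eqP[c c0 fg]; apply/eqP; rewrite /= fg lift_formZ //.
Qed.

Lemma form_sym c : (form_of c)^T = form_of c.
Proof. by have [] := set_valP (repr c : nonzero_qform R). Qed.

Lemma form_neq0 c : form_of c != 0.
Proof. by apply/eqP; have [] := set_valP (repr c : nonzero_qform R). Qed.

Lemma form_of_inj c d a : form_of c = a *: form_of d -> c = d.
Proof.
move=> E; have a0 : a != 0.
  by apply/eqP => a0; have := form_neq0 c; rewrite E a0 scale0r eqxx.
rewrite -[c]reprK -[d]reprK; apply/eqmodP/asboolP; exists a => //.
Qed.

Definition forms (cd : conic R * conic R) := (form_of cd.1, form_of cd.2).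

Lemma distinct_proper_forms (cd : conic R * conic R) : distinct_proper cd ->
  [/\ form_of cd.1 \in unitmx, form_of cd.2 \in unitmx &
      forall l, form_of cd.1 <> l *: form_of cd.2].
Proof.
move=> [p1 p2 d]; split; last by move=> l /form_of_inj.
  by rewrite unitmxE unitfE; apply/eqP.
by rewrite unitmxE unitfE; apply/eqP.
Qed.

Lemma card_eq_nonempty T U (X : set T) (Y : set U) : (X #= Y)%card -> X !=set0 -> Y !=set0.
Proof.
move=> XY X0; apply: contrapT => /nonemptyPn Y0; move: XY X0; rewrite Y0 card_eq0.
by move=> /eqP -> [].
Qed.

Lemma same_pencil_scale x a b : a != 0 -> b != 0 -> same_pencil x (a *: x.1, b *: x.2).
Proof.
move=> a0 b0; have h1 : exists c d : R, a *: x.1 = c *: x.1 + d *: x.2.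
  by exists a, 0; rewrite scale0r addr0.
have h2 : exists c d : R, b *: x.2 = c *: x.1 + d *: x.2.
  by exists 0, b; rewrite scale0r add0r.
have h3 : exists c d : R, x.1 = c *: (a *: x.1) + d *: (b *: x.2).
  by exists a^-1, 0; rewrite scale0r addr0 scalerA mulVf ?scale1r.
have h4 : exists c d : R, x.2 = c *: (a *: x.1) + d *: (b *: x.2).
  by exists 0, b^-1; rewrite scale0r add0r scalerA mulVf ?scale1r.
by split.
Qed.

Lemma same_pencil_sym x y : same_pencil x y -> same_pencil y x.
Proof. by move=> [h1 h2 h3 h4]; split; [exact h3|exact h4|exact h1|exact h2]. Qed.

Lemma mult_point_scale A B a b m p : a != 0 -> b != 0 ->
  mult_point (a *: A) (b *: B) m p <-> mult_point A B m p.
Proof.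
move=> a0 b0; have h := same_pencil_scale (A, B) a0 b0.
by split; apply: mult_point_pencil; [exact: same_pencil_sym|exact: h].
Qed.

Lemma has_point_scale A B a b m : a != 0 -> b != 0 ->
  has_point (a *: A) (b *: B) m <-> has_point A B m.
Proof.
by move=> a0 b0; split=> -[p /(mult_point_scale _ _ _ _ a0 b0) h]; exists p.
Qed.

(** Of the cardinalities preserved by the isotopy, only the existence of a point of each
    multiplicity, real or not, is retained. *)
Lemma has_point_card m (x y : conic R * conic R) :
  (real_intersection_points m x #= real_intersection_points m y)%card ->
  (imaginary_intersection_points m x #= imaginary_intersection_points m y)%card ->
  has_point (form_of x.1) (form_of x.2) m -> has_point (form_of y.1) (form_of y.2) m.
Proof.
move=> rE iE [p pm]; have [rp|ip] := EM (real_point p).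
  have [|q [qm _]] := card_eq_nonempty rE; first by exists p; split.
  by exists q.
have [|q [qm _]] := card_eq_nonempty iE; first by exists p; split.
by exists q.
Qed.

End Lift.

Section Isotopy.
Variable R : realType.
Variable gamma : R -> conic R * conic R.
Hypothesis iso : rigid_isotopy gamma.

Local Notation I := [set` `[0, 1 : R]].

Lemma near_reach (T : Type) (F : set_system T) (FF : Filter F) (A B : T -> 'M[R]_3) (A0 B0 : 'M[R]_3) :
  (forall t, (A t)^T = A t) -> (forall t, (B t)^T = B t) -> A0^T = A0 -> B0^T = B0 ->
  A0 \in unitmx -> B0 \in unitmx -> (forall t, B t \in unitmx) ->
  (forall l, A0 <> l *: B0) -> (forall t l, A t <> l *: B t) ->
  A @ F --> A0 -> B @ F --> B0 ->
  (forall t m, has_point (A t) (B t) m <-> has_point A0 B0 m) ->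
  \forall t \near F, reach (A t, B t) (A0, B0).
Proof.
move=> sA sB sA0 sB0 uA0 uB0 uB AB0 AB cA cB hp.
have [h3|n3] := EM (has_point A0 B0 3).
  apply: (reach_segre3 sA sB sA0 sB0 uA0 uB0 cA cB).
    exact: (has_point3 sA0 sB0 uB0 AB0 h3).
  by move=> t; apply: (has_point3 (sA t) (sB t) (uB t) (AB t)); apply/hp.
have [h4|n4] := EM (has_point A0 B0 4).
  apply: (reach_segre_21 sA sB sA0 sB0 uA0 uB0 cA cB).
    exact: (has_point4 sA0 sB0 uB0 AB0 h4).
  by move=> t; apply: (has_point4 (sA t) (sB t) (uB t) (AB t)); apply/hp.
have [h2|n2] := EM (has_point A0 B0 2).
  have [h1|n1] := EM (has_point A0 B0 1).
    apply: (reach_segre21 sA sB sA0 sB0 uA0 uB0 cA cB).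
      exact: (has_point21 sA0 sB0 uB0 AB0 h2 h1).
    by move=> t; apply: (has_point21 (sA t) (sB t) (uB t) (AB t)); apply/hp.
  apply: (reach_segre111 sA sB sA0 sB0 uA0 uB0 cA cB).
    exact: (has_point111 sA0 sB0 uB0 AB0 h2 n1).
  move=> t; apply: (has_point111 (sA t) (sB t) (uB t) (AB t)); first exact/hp.
  by move/hp.
apply: (reach_generic sA sB sA0 sB0 uA0 uB0 cA cB) => l d P PQ trP.
have [v [vc vt]] := double_root_tangent sA0 sB0 uB0 PQ trP.
exact: (no_tangent sA0 sB0 uB0 AB0 n2 n3 n4 vc vt).
Qed.

Lemma local_reach (t0 : R) : t0 \in `[0, 1] ->
  \forall t \near within I (nbhs t0), reach (forms (gamma t)) (forms (gamma t0)).
Proof.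
move=> t01; have [gc gd gm] := iso.
set f0 := form_of (gamma t0).1; set g0 := form_of (gamma t0).2.
have [uf0 ug0 fg0] := distinct_proper_forms (gd _ t01).
set F := within I (nbhs t0).
have cg : gamma @ F --> gamma t0 by move/subspace_continuousP: gc => /(_ t0 t01).
pose A1 t := lift f0 (gamma t).1; pose B1 t := lift g0 (gamma t).2.
have cA1 : A1 @ F --> f0.
  have -> : f0 = lift f0 (gamma t0).1 by rewrite /lift lift_form_id // form_neq0.
  apply: (@cvg_comp _ _ _ (fun t => (gamma t).1) (lift f0) _ (nbhs (gamma t0).1)).
    exact: (cvg_comp _ _ cg (@cvg_fst _ _ _ _ _)).
  exact: continuous_lift.
have cB1 : B1 @ F --> g0.
  have -> : g0 = lift g0 (gamma t0).2 by rewrite /lift lift_form_id // form_neq0.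
  apply: (@cvg_comp _ _ _ (fun t => (gamma t).2) (lift g0) _ (nbhs (gamma t0).2)).
    exact: (cvg_comp _ _ cg (@cvg_snd _ _ _ _ _)).
  exact: continuous_lift.
(* Where [G] fails the base forms are substituted, so that the hypotheses of [near_reach] hold for
   every [t] and not only near [t0]. *)
pose G t := [&& t \in `[0, 1], A1 t \in unitmx & B1 t \in unitmx].
have nG : \forall t \near F, G t.
  have nA : \forall t \near F, A1 t \in unitmx by exact: near_unitmx cA1.
  have nB : \forall t \near F, B1 t \in unitmx by exact: near_unitmx cB1.
  have nI : \forall t \near F, t \in `[0, 1] by exact: withinT.
  by near=> t; apply/and3P; split; near: t.
pose A t := if G t then A1 t else f0; pose B t := if G t then B1 t else g0.
have cA : A @ F --> f0.
  by apply: cvg_trans cA1; apply: near_eq_cvg; near=> t; rewrite /A ifT //; near: t.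
have cB : B @ F --> g0.
  by apply: cvg_trans cB1; apply: near_eq_cvg; near=> t; rewrite /B ifT //; near: t.
have AB t : exists t' a b, [/\ t' \in `[0, 1], a != 0, b != 0,
    A t = a *: form_of (gamma t').1 & B t = b *: form_of (gamma t').2].
  rewrite /A /B; case: ifPn => [/and3P[tI uA uB]|_]; last first.
    by exists t0, 1, 1; rewrite !scale1r oner_neq0.
  exists t; do 2 eexists; split; [exact tI|exact: scale_neq0 uA|exact: scale_neq0 uB| |];
    reflexivity.
have near_AB : \forall t \near F, reach (A t, B t) (f0, g0).
  have sA t : (A t)^T = A t.
    by have [t' [a [b [_ _ _ -> _]]]] := AB t; rewrite linearZ /= form_sym.
  have sB t : (B t)^T = B t.
    by have [t' [a [b [_ _ _ _ ->]]]] := AB t; rewrite linearZ /= form_sym.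
  have uB t : B t \in unitmx.
    have [t' [a [b [t'I _ b0 _ ->]]]] := AB t.
    by have [_ u _] := distinct_proper_forms (gd _ t'I); rewrite unitmxZ // unitfE.
  have nAB t l : A t <> l *: B t.
    have [t' [a [b [t'I a0 _ -> ->]]]] := AB t.
    have [_ _ u] := distinct_proper_forms (gd _ t'I).
    move=> /(congr1 (fun X => a^-1 *: X)); rewrite !scalerA mulVf // scale1r.
    exact: u.
  have hp t m : has_point (A t) (B t) m <-> has_point f0 g0 m.
    have [t' [a [b [t'I a0 b0 -> ->]]]] := AB t.
    have [r1 i1] := gm _ _ t'I t01 m; have [r2 i2] := gm _ _ t01 t'I m.
    have [sc1 sc2] := has_point_scale (form_of (gamma t').1) (form_of (gamma t').2) m a0 b0.
    split=> h; first exact: has_point_card r1 i1 (sc1 h).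
    exact: sc2 (has_point_card r2 i2 h).
  exact: (near_reach _ sA sB (form_sym _) (form_sym _) uf0 ug0 uB fg0 nAB cA cB hp).
have := nG; apply: filterS2 near_AB => t tAB Gt; apply: reach_trans tAB.
have -> : (A t, B t) = (\tr (f0^T *m form_of (gamma t).1) / normsq (form_of (gamma t).1) *:
    (forms (gamma t)).1, \tr (g0^T *m form_of (gamma t).2) / normsq (form_of (gamma t).2) *:
    (forms (gamma t)).2) by rewrite /A /B Gt.
by case/and3P: Gt => _ /scale_neq0 a0 /scale_neq0 b0; apply: reach1; apply: MoveScale.
Unshelve. all: by end_near. Qed.

Lemma reach_isotopy : reach (forms (gamma 0)) (forms (gamma 1)).
Proof.
pose P := [set t | t \in `[0, 1] /\ reach (forms (gamma 0)) (forms (gamma t))].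
have I0 : (0 : R) \in `[0, 1] by rewrite in_itv /= lexx ler01.
suff PI : P = I.
  have : I 1 by rewrite /= in_itv /= lexx ler01.
  by rewrite -PI => -[].
apply: (@segment_connected R 0 1).
- by exists 0; split; [exact: I0|exact: Reach0].
- exists (interior [set t | I t -> P t]); first exact: open_interior.
  apply/seteqP; split=> t0 [t0I h].
    split; first exact: t0I.
    have hl : nbhs (t0 : R) [set t | I t -> reach (forms (gamma t)) (forms (gamma t0))].
      exact: (local_reach t0I).
    change (nbhs (t0 : R) [set t | I t -> P t]).
    apply: filterS hl => t ht tI; split; first exact: tI.
    exact: reach_trans h (reach_sym (ht tI)).
  exact: (interior_subset h t0I).
- exists (~` interior [set t | I t -> ~ P t]).
    by apply: open_closedC; exact: open_interior.
  apply/seteqP; split=> t0 [t0I h].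
    by split=> [|/interior_subset]; [exact: t0I|apply].
  split; first exact: t0I.
  apply: contrapT => nP; apply: h.
  have hl : nbhs (t0 : R) [set t | I t -> reach (forms (gamma t)) (forms (gamma t0))].
      exact: (local_reach t0I).
    change (nbhs (t0 : R) [set t | I t -> ~ P t]).
    apply: filterS hl => t ht tI [_ h]; apply: nP; exact: (reach_trans h (ht tI)).
Qed.

End Isotopy.

Lemma lift_set (T V : Type) (D : set V) (F : T -> V) : (forall t, D (F t)) ->
  exists f : T -> D, forall t, set_val (f t) = F t.
Proof. by move=> h; exists (fun t => SigSub (mem_set (h t))). Qed.

Lemma same_pencil_free (R : realType) (x y : 'M[R]_3 * 'M[R]_3) : same_pencil x y ->
  x.2 != 0 -> (forall l, x.1 <> l *: x.2) -> forall l, y.1 <> l *: y.2.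
Proof.
move=> [_ _ [a [b E1]] [c [d E2]]] x20 xF l yE.
have E2' : x.2 = (c * l + d) *: y.2 by rewrite E2 yE scalerA scalerDl.
have k0 : c * l + d != 0 by apply: contra x20 => /eqP k0; rewrite E2' k0 scale0r.
apply: (xF ((a * l + b) / (c * l + d))).
by rewrite E1 yE [in RHS]E2' !scalerA -scalerDl divfK.
Qed.

Lemma same_pencil_tr (R : realType) (x y : 'M[R]_3 * 'M[R]_3) : same_pencil x y ->
  x.1^T = x.1 -> x.2^T = x.2 -> y.1^T = y.1 /\ y.2^T = y.2.
Proof.
move=> [[a [b ->]] [c [d ->]] _ _] s1 s2.
by rewrite !linearD !linearZ /= s1 s2.
Qed.

(** * From paths of forms to the required isotopy of conics *)

Section Realization.
Variable R : realType.
Implicit Types (f g : nonzero_qform R) (c : conic R).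

Lemma form_of_conic f : exists2 k : R, k != 0 & form_of (conic_of f) = k *: set_val f.
Proof. by apply/conic_of_eqP; rewrite /conic_of reprK. Qed.

Lemma conic_of_form f c k : k != 0 -> form_of c = k *: set_val f -> conic_of f = c.
Proof.
by move=> k0 E; rewrite -[c]reprK; apply/esym/conic_of_eqP; exists k.
Qed.

Lemma unit_nondegenerate (A : 'M[R]_3) : A \in unitmx -> Defs.nondegenerate A.
Proof. by rewrite unitmxE unitfE => /eqP. Qed.

Lemma continuous_conic_of (T : topologicalType) (f : T -> nonzero_qform R) (F : T -> 'M[R]_3) :
  (forall t, set_val (f t) = F t) -> continuous F -> continuous (fun t => conic_of (f t)).
Proof.
move=> /funext fE cf t; have cf' : continuous f.
  by apply: continuous_comp_initial; move: cf; rewrite -fE.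
exact: (continuous_comp (cf' t)
  (@pi_continuous _ (projectivization [set A : 'M[R]_3 | A^T = A /\ A <> 0]) _)).
Qed.

Lemma continuous_pgl_of (T : topologicalType) (f : T -> GL3 R) (F : T -> 'M[R]_3) :
  (forall t, set_val (f t) = F t) -> continuous F -> continuous (fun t => pgl_of (f t)).
Proof.
move=> /funext fE cf t; have cf' : continuous f.
  by apply: continuous_comp_initial; move: cf; rewrite -fE.
exact: (continuous_comp (cf' t)
  (@pi_continuous _ (projectivization [set A : 'M[R]_3 | A \in unitmx]) _)).
Qed.

Lemma intersection_points_congr (A B : 'M[R]_3) f g (h : 'M[R]_3) m p : h \in unitmx ->
  same_pencil (h^T *m A *m h, h^T *m B *m h) (set_val f, set_val g) ->
  intersection_points m (conic_of f, conic_of g) p <->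
  mult_point A B m (act (complexify h) p).
Proof.
move=> uh pe.
have [a a0 E1] := form_of_conic f; have [b b0 E2] := form_of_conic g.
have -> : intersection_points m (conic_of f, conic_of g) p =
    mult_point (a *: set_val f) (b *: set_val g) m p by rewrite -E1 -E2.
split=> [/(mult_point_scale _ _ m p a0 b0) pm|pm].
  by apply/(mult_point_congr _ _ m p uh); exact: mult_point_pencil (same_pencil_sym pe) pm.
apply/(mult_point_scale _ _ m p a0 b0); apply: mult_point_pencil pe _.
exact/(mult_point_congr _ _ m p uh).
Qed.

Lemma card_act (P : set (projective_plane R[i])) (h : 'M[R]_3) : h \in unitmx ->
  ([set p | P (act (complexify h) p)] #= P)%card.
Proof.
move=> uh; have uH : complexify h \in unitmx by rewrite map_unitmx.
have E : P = act (complexify h) @` [set p | P (act (complexify h) p)].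
  apply/seteqP; split=> [p Pp|p [q qP <-]]; last exact: qP.
  by exists (act (invmx (complexify h)) p); rewrite /= actVK.
rewrite [X in (_ #= X)%card]E card_eq_sym; apply: inj_card_eq => p q _ _ pq.
by rewrite -[p](actK _ uH) pq actK.
Qed.

Section Couples.
Variables C0 D0 : conic R.
Hypothesis couple0 : distinct_proper (C0, D0).
Variables (n : nat) (SA SB d : R -> 'M[R]_3) (y : conic R * conic R).
Hypothesis n0 : (0 < n)%N.
Hypothesis pd : path_data (forms (C0, D0)) (forms y) n SA SB d.

Let free0 : forall l, form_of C0 <> l *: form_of D0.
Proof. by have [] := distinct_proper_forms couple0. Qed.

Let free t l : SA t <> l *: SB t.
Proof.
have [_ un _ _ _] := pd; have [_ _ _ h] := un t.
exact: (same_pencil_free h (form_neq0 D0) free0).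
Qed.

Definition pencil_of : set (conic R) := [set c | exists a b : R,
  represents (a *: form_of C0 + b *: form_of D0) c].

Lemma is_pencil_of : is_pencil pencil_of.
Proof.
exists (repr C0), (repr D0); split; last by [].
by rewrite /conic_of !reprK; case: couple0.
Qed.

Variables (fa fb : R -> nonzero_qform R) (da : R -> GL3 R).
Hypotheses (faE : forall t, set_val (fa t) = SA t) (fbE : forall t, set_val (fb t) = SB t).
(** A matrix acts on forms through its inverse, hence the inverse here: the moved forms are the
    congruences by [d t]. *)
Hypothesis (daE : forall t, set_val (da t) = invmx (d t)).

Let N : R := n%:R.

Definition slide_path t : conic R * conic R := (conic_of (fa (N * t)), conic_of (fb (N * t))).

Lemma free_conics t : conic_of (fa t) <> conic_of (fb t).
Proof. by move=> /conic_of_eqP[l _]; rewrite faE fbE; exact: free. Qed.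

Lemma slide_path_sliding (i : nat) : (i < n)%N ->
  sliding 0 1 (fun u => slide_path ((u + i%:R) / N)).
Proof.
move=> lin; have [_ un _ [_ sl] _] := pd.
have N0 : N != 0 by rewrite pnatr_eq0 -lt0n.
have NK u : N * ((u + i%:R) / N) = u + i%:R by rewrite mulrC divfK.
have [k slk] := sl i lin; have [uA uB _ _] := un i%:R.
have mid (t : R) : t \in `[0, 1] -> i%:R <= t + i%:R <= i%:R + 1.
  by rewrite in_itv /= => /andP[t0 t1]; lra.
split; first by rewrite lexx ler01.
case: slk => slk; [left; exists (fa i%:R), (fb i%:R), k|right; exists (fb i%:R), (fa i%:R), k].
  split; [by apply: unit_nondegenerate; rewrite faE|by apply: unit_nondegenerate; rewrite fbE|
    exact: free_conics|].
  move=> t /mid ti; have [E1 E2] := slk _ ti; have [uA' _ _ _] := un (t + i%:R).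
  have E : set_val (fa (t + i%:R)) = set_val (fa i%:R) + (t * k) *: set_val (fb i%:R).
    by rewrite !faE fbE E1 addrK.
  split; first by rewrite -E faE; exact: unit_nondegenerate.
    by rewrite -E /slide_path NK; exists (fa (t + i%:R)).
  rewrite /slide_path NK; apply/conic_of_eqP; exists 1; first exact: oner_neq0.
  by rewrite scale1r !fbE.
split; [by apply: unit_nondegenerate; rewrite fbE|by apply: unit_nondegenerate; rewrite faE|
  by move/esym; exact: free_conics|].
move=> t /mid ti; have [E1 E2] := slk _ ti; have [_ uB' _ _] := un (t + i%:R).
have E : set_val (fb (t + i%:R)) = set_val (fb i%:R) + (t * k) *: set_val (fa i%:R).
  by rewrite !fbE faE E1 addrK.
split; first by rewrite -E fbE; exact: unit_nondegenerate.
  by rewrite -E /slide_path NK; exists (fb (t + i%:R)).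
rewrite /slide_path NK; apply/conic_of_eqP; exists 1; first exact: oner_neq0.
by rewrite scale1r !faE.
Qed.

Lemma slide_path_sequence : sliding_sequence pencil_of slide_path.
Proof.
have [_ un _ _ _] := pd.
have N0 : 0 < N by rewrite ltr0n.
split.
  move=> t _; have [_ _ _ [[a [b E1]] [a' [b' E2]] _ _]] := un (N * t).
  split; [exists a, b; exists (fa (N * t))|exists a', b'; exists (fb (N * t))] => //.
    by rewrite faE; exact: E1.
  by rewrite fbE; exact: E2.
exists n, (fun i => i%:R / N); split.
- by rewrite mul0r.
- by rewrite divff // gt_eqF.
- by move=> i _; rewrite ltr_pM2r ?invr_gt0 // ltr_nat.
move=> i lin; exists 0, 1, (fun u => slide_path ((u + i%:R) / N)), (fun t => N * t - i%:R).
split.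
- exact: slide_path_sliding.
- apply: continuous_subspaceT => t; apply: cvgB; last exact: cvg_cst.
  by apply: cvgM; [exact: cvg_cst|exact: cvg_id].
- by move=> t t' _ _ tt' /=; rewrite ltrD2r ltr_pM2l.
- by split; rewrite mulrC divfK ?gt_eqF // ?subrr // -natr1 addrAC subrr add0r.
- by move=> t _; rewrite subrK mulrAC divff ?mul1r // gt_eqF.
Qed.

Definition moved_path t := pgl_act_couple (pgl_of (da (N * t))) (slide_path t).

Definition moved_A t : nonzero_qform R := qform_act (da t) (fa t).
Definition moved_B t : nonzero_qform R := qform_act (da t) (fb t).

Lemma moved_pathE t : moved_path t = (conic_of (moved_A (N * t)), conic_of (moved_B (N * t))).
Proof. by rewrite /moved_path /pgl_act_couple /= !pgl_actE. Qed.

Lemma moved_AE t : set_val (moved_A t) = (d t)^T *m SA t *m d t.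
Proof.
rewrite [LHS](_ : _ = (invmx (set_val (da t)))^T *m set_val (fa t) *m invmx (set_val (da t))) //.
by rewrite daE invmxK faE.
Qed.

Lemma moved_BE t : set_val (moved_B t) = (d t)^T *m SB t *m d t.
Proof.
rewrite [LHS](_ : _ = (invmx (set_val (da t)))^T *m set_val (fb t) *m invmx (set_val (da t))) //.
by rewrite daE invmxK fbE.
Qed.

Let continuous_N (U : topologicalType) (f : R -> U) :
  continuous f -> continuous (fun t : R => f (N * t)).
Proof.
move=> cf t; apply: (@continuous_comp R R U (fun t => N * t) f); last exact: cf.
by apply: cvgM; [exact: cvg_cst|exact: cvg_id].
Qed.

Lemma continuous_moved_path : continuous moved_path.
Proof.
have [[cSA cSB cd] _ _ _ _] := pd.
have -> : moved_path = (fun t => (conic_of (moved_A (N * t)), conic_of (moved_B (N * t)))).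
  by apply/funext => t; exact: moved_pathE.
have cA : continuous (fun t => conic_of (moved_A t)).
  apply: continuous_conic_of moved_AE _ => t.
  apply: cvg_mulmx; last exact: cd.
  by apply: cvg_mulmx; [apply: cvg_trmx; exact: cd|exact: cSA].
have cB : continuous (fun t => conic_of (moved_B t)).
  apply: continuous_conic_of moved_BE _ => t.
  apply: cvg_mulmx; last exact: cd.
  by apply: cvg_mulmx; [apply: cvg_trmx; exact: cd|exact: cSB].
move=> t.
have hA : (fun t => conic_of (moved_A (N * t))) @ nbhs t --> conic_of (moved_A (N * t)).
  exact: continuous_N cA _.
have hB : (fun t => conic_of (moved_B (N * t))) @ nbhs t --> conic_of (moved_B (N * t)).
  exact: continuous_N cB _.
exact: cvg_pair hA hB.
Qed.

Lemma continuous_alpha : continuous (fun t => pgl_of (da (N * t))).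
Proof.
have [[_ _ cd] un _ _ _] := pd.
have ca : continuous (fun t => pgl_of (da t)).
  apply: continuous_pgl_of daE _ => t.
  by apply: cvg_invmx; [have [] := un t|exact: cd].
exact: continuous_N ca.
Qed.

Lemma distinct_moved_path t : distinct_proper (moved_path t).
Proof.
have [_ un _ _ _] := pd; have [uA uB ud _] := un (N * t).
rewrite moved_pathE; split=> /=.
- by apply/Defs.properE/unit_nondegenerate; rewrite moved_AE !unitmx_mul unitmx_tr ud uA.
- by apply/Defs.properE/unit_nondegenerate; rewrite moved_BE !unitmx_mul unitmx_tr ud uB.
move=> /conic_of_eqP[l _]; rewrite moved_AE moved_BE => E; apply: (@free (N * t) l).
have := congr1 (fun X => (invmx (d (N * t)))^T *m X *m invmx (d (N * t))) E.
rewrite -scalemxAr -scalemxAl !mulmxA -trmx_mul mulmxV // trmx1 !mul1mx.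
by rewrite -!mulmxA !mulmxV // !mulmx1.
Qed.

(** At each time the intersection points are the preimage of those of the initial couple under the
    real bijection [d]; this is why their numbers stay constant. *)
Lemma moved_intersection_points m t p : intersection_points m (moved_path t) p <->
  mult_point (form_of C0) (form_of D0) m (act (complexify (d (N * t))) p).
Proof.
have [_ un _ _ _] := pd; have [_ _ ud h] := un (N * t).
have := @intersection_points_congr (SA (N * t)) (SB (N * t)) (moved_A (N * t))
  (moved_B (N * t)) (d (N * t)) m p ud.
rewrite moved_AE moved_BE => /(_ (same_pencil_refl _)).
rewrite moved_pathE => -[h1 h2]; split=> [/h1|pm].
  exact: mult_point_pencil (same_pencil_sym h).
by apply: h2; exact: mult_point_pencil h pm.
Qed.

Lemma moved_path_isotopy : rigid_isotopy moved_path.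
Proof.
have [_ un _ _ _] := pd.
split.
- by apply: continuous_subspaceT; exact: continuous_moved_path.
- by move=> t _; exact: distinct_moved_path.
pose P0 m := [set p | mult_point (form_of C0) (form_of D0) m p].
have r t m : (real_intersection_points m (moved_path t) #= P0 m `&` @real_point R)%card.
  have [_ _ ud _] := un (N * t).
  have -> : real_intersection_points m (moved_path t) =
      [set p | (P0 m `&` @real_point R) (act (complexify (d (N * t))) p)].
    apply/seteqP; split=> p [/moved_intersection_points h1 /(real_point_act _ ud) h2];
    by split.
  exact: card_act.
have i t m : (imaginary_intersection_points m (moved_path t) #= P0 m `&` ~` @real_point R)%card.
  have [_ _ ud _] := un (N * t).
  have -> : imaginary_intersection_points m (moved_path t) =
      [set p | (P0 m `&` ~` @real_point R) (act (complexify (d (N * t))) p)].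
    apply/seteqP; split=> p [/moved_intersection_points h1 h2]; split=> //;
    by move=> /(real_point_act _ ud).
  exact: card_act.
move=> t t' _ _ m; split.
  by apply: card_eq_trans (r t m) _; rewrite card_eq_sym; exact: r.
by apply: card_eq_trans (i t m) _; rewrite card_eq_sym; exact: i.
Qed.

Lemma moved_path_connects : connects moved_path (C0, D0) y.
Proof.
have [_ _ [SA0 SB0 d0] _ [a [b [a0 b0 y1 y2]]]] := pd.
split; rewrite moved_pathE ?mulr0 ?mulr1.
  congr pair.
    apply: (@conic_of_form _ _ 1); first exact: oner_neq0.
    by rewrite moved_AE SA0 d0 trmx1 mul1mx mulmx1 scale1r.
  apply: (@conic_of_form _ _ 1); first exact: oner_neq0.
  by rewrite moved_BE SB0 d0 trmx1 mul1mx mulmx1 scale1r.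
case: y y1 y2 => C1 D1 /= y1 y2; congr pair.
  by apply: (@conic_of_form _ _ a) => //; rewrite moved_AE.
by apply: (@conic_of_form _ _ b) => //; rewrite moved_BE.
Qed.

Lemma alpha0 : pgl_of (da (N * 0)) = pgl1 R.
Proof.
have [_ _ [_ _ d0] _ _] := pd.
apply/pgl_of_eqP; exists 1; first exact: oner_neq0.
by rewrite mulr0 daE d0 invmx1 scale1r.
Qed.

End Couples.
End Realization.

Theorem lemma2 (R : realType) (C0 D0 C1 D1 : conic R)
    (couple0 : distinct_proper (C0, D0)) (couple1 : distinct_proper (C1, D1))
    (nonemptyC0 : real_locus C0 !=set0) (nonemptyD0 : real_locus D0 !=set0)
    (nonemptyC1 : real_locus C1 !=set0) (nonemptyD1 : real_locus D1 !=set0)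
    (isotopic : rigidly_isotopic (C0, D0) (C1, D1)) :
  exists (L : set (conic R)) (s : R -> conic R * conic R) (alpha : R -> PGL3 R),
    [/\ is_pencil L,
        sliding_sequence L s,
        {within `[0, 1], continuous alpha},
        alpha 0 = pgl1 R &
        rigid_isotopy (fun t => pgl_act_couple (alpha t) (s t)) /\
        connects (fun t => pgl_act_couple (alpha t) (s t)) (C0, D0) (C1, D1)].
Proof.
have [gamma [iso [g0 g1]]] := isotopic.
have [u1 u2 _] := distinct_proper_forms couple0.
have r : reach (forms (C0, D0)) (forms (C1, D1)).
  by rewrite -g0 -g1; exact: reach_isotopy.
have [n [SA [SB [d [n0 pd]]]]] := @path_data_ex R (forms (C0, D0)) _ u1 u2 r.
have [_ un _ _ _] := pd.
have sym t : (SA t)^T = SA t /\ (SB t)^T = SB t.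
  by have [_ _ _ h] := un t; exact: (same_pencil_tr h (form_sym C0) (form_sym D0)).
have unit_neq0 (A : 'M[R]_3) : A \in unitmx -> A <> 0.
  by move=> + A0; rewrite A0 unitmxE det0 unitr0.
have [fa faE] : exists f : R -> nonzero_qform R, forall t, set_val (f t) = SA t.
  by apply: lift_set => t; have [? _ _ _] := un t; have [? _] := sym t; split; [|exact: unit_neq0].
have [fb fbE] : exists f : R -> nonzero_qform R, forall t, set_val (f t) = SB t.
  by apply: lift_set => t; have [_ ? _ _] := un t; have [_ ?] := sym t; split; [|exact: unit_neq0].
have [da daE] : exists f : R -> GL3 R, forall t, set_val (f t) = invmx (d t).
  by apply: lift_set => t; have [_ _ ? _] := un t; rewrite /= unitmx_inv.
exists (pencil_of C0 D0), (slide_path n fa fb), (fun t => pgl_of (da (n%:R * t))); split.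
- exact: is_pencil_of.
- exact: (slide_path_sequence couple0 n0 pd faE fbE).
- by apply: continuous_subspaceT; exact: (continuous_alpha pd daE).
- exact: (alpha0 pd daE).
split; first exact: (moved_path_isotopy couple0 pd faE fbE daE).
exact: (moved_path_connects pd faE fbE daE).
Qed.
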